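(* Let $\mathcal{H}$ be a real Hilbert space, $z\in\mathcal{H}$, $f\in\Gamma(\mathcal{H})$ and $h:\mathcal{H}\rightarrow\mathbb{R}$ a convex and differentiable function with a $\mu$-Lipschitzian gradient for $\mu>0$. Let $m$ be a strictly positive integer and, for each $i\in\{1,\dots,m\}$, let $\mathcal{G}_i$ be a real Hilbert space, $r_i\in\mathcal{G}_i$, $g_i,l_i\in\Gamma(\mathcal{G}_i)$ such that $l_i$ is $\nu_i^{-1}$-strongly convex for $\nu_i>0$, and $L_i:\mathcal{H}\rightarrow\mathcal{G}_i$ a nonzero linear continuous operator. Consider the primal problem $$(P)\qquad\inf_{x\in\mathcal{H}}\left\{f(x)+\sum_{i=1}^m(g_i\Box l_i)(L_ix-r_i)+h(x)-\langle x,z\rangle\right\}$$ and its Fenchel-type dual problem $$(D)\qquad\sup_{v_i\in\mathcal{G}_i,\,i=1,\dots,m}\left\{-(f^*\Box h^* )\Big(z-\sum_{i=1}^mL_i^*v_i\Big)-\sum_{i=1}^m\big(g_i^*(v_i)+l_i^*(v_i)+\langle v_i,r_i\rangle\big)\right\}.$$ Suppose that $(P)$ has an optimal solution and that the regularity condition $$(r_1,\dots,r_m)\in\operatorname{sqri}\left(\prod_{i=1}^m(\operatorname{dom}g_i+\operatorname{dom}l_i)-\{(L_1x,\dots,L_mx):x\in\operatorname{dom}f\}\right)$$ is fulfilled. Set $$\beta=\max\{\mu,\nu_1,\dots,\nu_m\}+\sqrt{\sum_{i=1}^m\|L_i\|^2}.$$ Let $\lambda,\sigma>0$ and $\alpha_1,\alpha_2\geq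 0$ be such that $$12\alpha_2^2+9(\alpha_1+\alpha_2)+4\sigma<1,$$ let $(\lambda_n)_{n\geq 1}$ be a sequence of real numbers such that $$\lambda\leq\lambda_n\leq\frac{1}{\beta}\sqrt{\frac{1-12\alpha_2^2-9(\alpha_1+\alpha_2)-4\sigma}{12\alpha_2^2+8(\alpha_1+\alpha_2)+4\sigma+2}}\quad\text{for all } n\geq 1,$$ and, for $j=1,2$, let $(\alpha_{j,n})_{n\geq 1}$ be a nondecreasing sequence with $\alpha_{j,1}=0$ and $0\leq\alpha_{j,n}\leq\alpha_j$ for all $n\geq 1$. Let $x_0,x_1\in\mathcal{H}$ and $v_{i,0},v_{i,1}\in\mathcal{G}_i$, $i=1,\dots,m$, be arbitrary and define, for all $n\geq 1$, $$\begin{aligned} p_{1,n}&=\operatorname{prox}_{\lambda_nf}\Big[x_n-\lambda_n\Big(\nabla h(x_n)+\sum_{i=1}^mL_i^*v_{i,n}-z\Big)+\alpha_{1,n}(x_n-x_{n-1})\Big],\\ p_{2,i,n}&=\operatorname{prox}_{\lambda_ng_i^*}\big[v_{i,n}+\lambda_n(L_ix_n-\nabla l_i^*(v_{i,n})-r_i)+\alpha_{1,n}(v_{i,n}-v_{i,n-1})\big],\quad i=1,\dots,m,\\ v_{i,n+1}&=\lambda_nL_i(p_{1,n}-x_n)+\lambda_n(\nabla l_i^*(v_{i,n})-\nabla l_i^*(p_{2,i,n}))+p_{2,i,n}+\alpha_{2,n}(v_{i,n}-v_{i,n-1}),\quad i=1,\dots,m,\\ x_{n+1}&=\lambda_n\sum_{i=1}^mL_i^*(v_{i,n}-p_{2,i,n})+\lambda_n(\nabla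 h(x_n)-\nabla h(p_{1,n}))+p_{1,n}+\alpha_{2,n}(x_n-x_{n-1}). \end{aligned}$$ Then the following statements are true: (a) $\sum_{n\in\mathbb{N}}\|x_{n+1}-x_n\|^2<+\infty$, $\sum_{n\geq 1}\|x_n-p_{1,n}\|^2<+\infty$ and, for $i=1,\dots,m$, $\sum_{n\in\mathbb{N}}\|v_{i,n+1}-v_{i,n}\|^2<+\infty$ and $\sum_{n\geq 1}\|v_{i,n}-p_{2,i,n}\|^2<+\infty$; (b) there exists $(\overline{x},\overline{v}_1,\dots,\overline{v}_m)\in\mathcal{H}\times\mathcal{G}_1\times\dots\times\mathcal{G}_m$ satisfying the optimality conditions $$z-\sum_{i=1}^mL_i^*\overline{v}_i\in\partial f(\overline{x})+\nabla h(\overline{x})\quad\text{and}\quad\overline{v}_i\in(\partial g_i\Box\partial l_i)(L_i\overline{x}-r_i),\ i=1,\dots,m,$$ hence $\overline{x}$ is an optimal solution of $(P)$, $(\overline{v}_1,\dots,\overline{v}_m)$ is an optimal solution of $(D)$ and the optimal objective values of the two problems coincide, such that the following hold: (i) $x_n\rightharpoonup\overline{x}$, $p_{1,n}\rightharpoonup\overline{x}$ and, for $i=1,\dots,m$, $v_{i,n}\rightharpoonup\overline{v}_i$ and $p_{2,i,n}\rightharpoonup\overline{v}_i$ (weakly) as $n\rightarrow+\infty$; (ii) if $f+h$ is uniformly convex, then $x_n\rightarrow\overline{x}$ and $p_{1,n}\rightarrow\overline{x}$ (strongly) as $n\rightarrow+\infty$; (iii) if $g_i^*+l_i^*$ is uniformly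 convex for some $i\in\{1,\dots,m\}$, then $v_{i,n}\rightarrow\overline{v}_i$ and $p_{2,i,n}\rightarrow\overline{v}_i$ (strongly) as $n\rightarrow+\infty$.
   Context: $\mathbb{N}=\{0,1,2,\dots\}$ and $\overline{\mathbb{R}}=\mathbb{R}\cup\{\pm\infty\}$. The symbols $\rightharpoonup$ and $\rightarrow$ denote weak and strong convergence. For a real Hilbert space $\mathcal{H}$ and $f:\mathcal{H}\to\overline{\mathbb{R}}$: $\operatorname{dom}f=\{x:f(x)<+\infty\}$; $f$ is proper if $\operatorname{dom}f\neq\emptyset$ and $f(x)\neq-\infty$ for all $x$; $\Gamma(\mathcal{H})$ is the family of proper, convex, lower semicontinuous functions $\mathcal{H}\to\overline{\mathbb{R}}$; $f^*(u)=\sup_{x\in\mathcal{H}}\{\langle u,x\rangle-f(x)\}$ is the conjugate of $f$. The subdifferential is $\partial f(x)=\{v\in\mathcal{H}:f(y)\geq f(x)+\langle v,y-x\rangle\ \forall y\in\mathcal{H}\}$ if $f(x)\in\mathbb{R}$, and $\partial f(x)=\emptyset$ otherwise. For proper functions $f,g$, the infimal convolution is $(f\Box g)(x)=\inf_{y\in\mathcal{H}}\{f(y)+g(x-y)\}$. For set-valued operators $S,T:\mathcal{H}\rightrightarrows\mathcal{H}$ the parallel sum is $S\Box T=(S^{-1}+T^{-1})^{-1}$, where $T^{-1}$ is defined by $x\in T^{-1}u$ iff $u\in Tx$. For $f\in\Gamma(\mathcal{H})$ and $\gamma>0$, $\operatorname{prox}_{\gamma f}(x)$ is the unique minimizer over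 $y\in\mathcal{H}$ of $f(y)+\frac{1}{2\gamma}\|y-x\|^2$. A proper function $f$ is uniformly convex if there exists an increasing function $\phi:[0,+\infty)\to[0,+\infty]$ which vanishes only at $0$ such that $f(tx+(1-t)y)+t(1-t)\phi(\|x-y\|)\leq tf(x)+(1-t)f(y)$ for all $x,y\in\operatorname{dom}f$ and $t\in(0,1)$; it is $\rho$-strongly convex ($\rho>0$) if this holds with $\phi(s)=(\rho/2)s^2$. Since $l_i\in\Gamma(\mathcal{G}_i)$ is $\nu_i^{-1}$-strongly convex, $l_i^*$ is everywhere differentiable with $\nu_i$-Lipschitzian gradient $\nabla l_i^*$. An operator $T$ is $\gamma$-Lipschitzian if $\|Tx-Ty\|\leq\gamma\|x-y\|$ for all $x,y$. $L_i^*$ is the adjoint of $L_i$ and $\|L_i\|$ its operator norm. For a convex subset $S$ of a real Hilbert space, the strong quasi-relative interior is $\operatorname{sqri}S=\{x\in S:\bigcup_{\lambda>0}\lambda(S-x)\text{ is a closed linear subspace}\}$. In the regularity condition it is taken in the product Hilbert space $\mathcal{G}_1\times\dots\times\mathcal{G}_m$.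
   Formalization: The regularity condition is taken at (-r_1,...,-r_m) instead of (r_1,...,r_m), matching g_i□l_i evaluated at L_i x - r_i; as printed it fails, e.g. f(x) = -sqrt(x+1), g the indicator of (-∞,0], l the indicator of {0}, L = Id, h = 0, z = 0, r = -1. *)

(* Defs.v *)
From HB Require Import structures.
From mathcomp Require Import all_boot all_order all_algebra.
From mathcomp Require Import all_classical all_reals all_analysis.
From mathcomp Require Import sesquilinear ring lra.

Set Implicit Arguments.
Unset Strict Implicit.
Unset Printing Implicit Defensive.

Import Order.TTheory GRing.Theory Num.Theory.
Import numFieldNormedType.Exports.

Local Open Scope classical_set_scope.
Local Open Scope ring_scope.

Section DotTheory.
Context {R : realType} {V : lmodType R} (f : {dot V for idfun}).
Implicit Types u v w : V.

Lemma dotC u v : f u v = f v u.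
Proof. by rewrite [LHS]hermitian_subproof expr0 mul1r. Qed.

Lemma dotDl u v w : f (u + v) w = f u w + f v w.
Proof. exact: linearDl. Qed.

Lemma dotZl (a : R) u v : f (a *: u) v = a * f u v.
Proof. exact: linearZl_LR. Qed.

Lemma dotDr u v w : f u (v + w) = f u v + f u w.
Proof. exact: linearDr. Qed.

Lemma dotZr (a : R) u v : f u (a *: v) = a * f u v.
Proof. exact: linearZr_LR. Qed.

Lemma dot_ge0 u : 0 <= f u u.
Proof.
have [->|u0] := eqVneq u 0; last exact/ltW/neq0_dnorm_gt0.
by rewrite -(scale0r (0 : V)) dotZl mul0r.
Qed.

Lemma dot_CauchySchwarz u v : f u v ^+ 2 <= f u u * f v v.
Proof.
have [->|v0] := eqVneq v 0.
  by rewrite -(scale0r (0 : V)) !dotZr !mul0r expr0n mulr0.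
have a0 : 0 < f v v by exact: neq0_dnorm_gt0.
have := dot_ge0 (f v v *: u + - f u v *: v).
rewrite !(dotDl, dotDr, dotZl, dotZr) (dotC v u).
set a := f v v in a0 *; set c := f u v; set b := f u u => h.
rewrite -subr_ge0 -(pmulr_rge0 _ a0).
by rewrite (le_trans h)// le_eqVlt; apply/orP; left; apply/eqP; ring.
Qed.

Definition dot_norm u := Num.sqrt (f u u).

Lemma dot_normD u v : dot_norm (u + v) <= dot_norm u + dot_norm v.
Proof.
rewrite -(@ler_pXn2r _ 2) ?nnegrE ?addr_ge0 ?sqrtr_ge0//.
rewrite sqrrD !sqr_sqrtr ?dot_ge0// !(dotDl, dotDr) (dotC v u).
have : f u v <= dot_norm u * dot_norm v.
  rewrite -sqrtrM ?dot_ge0// (le_trans (ler_norm _))// -sqrtr_sqr.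
  by rewrite ler_wsqrtr// dot_CauchySchwarz.
lra.
Qed.

Lemma dot_normZ (a : R) u : dot_norm (a *: u) = `|a| * dot_norm u.
Proof.
by rewrite /dot_norm dotZl dotZr mulrA -expr2 sqrtrM ?sqr_ge0// sqrtr_sqr.
Qed.

Lemma dot_norm_eq0 u : dot_norm u = 0 -> u = 0.
Proof.
move=> /eqP; rewrite sqrtr_eq0 => u0; apply/eqP/negPn/negP => u1.
have : 0 < f u u by exact: neq0_dnorm_gt0.
by rewrite ltNge u0.
Qed.

End DotTheory.

HB.mixin Record CompleteNormedModule_isHilbert (R : realType) V
    of CompleteNormedModule R V := {
  inner : {dot V for idfun} ;
  inner_norm : forall x : V, inner x x = `|x| ^+ 2 }.

#[short(type="hilbertType")]
HB.structure Definition Hilbert (R : realType) :=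
  {V of CompleteNormedModule_isHilbert R V & CompleteNormedModule R V}.


Section HilbertProduct.
Context {R : realType} (I : finType) (G : I -> hilbertType R).

Definition hprod : Type := forall i, G i.

HB.instance Definition _ := gen_eqMixin hprod.
HB.instance Definition _ := gen_choiceMixin hprod.

Implicit Types x y z : hprod.

Let hprod_add x y : hprod := fun i => x i + y i.
Let hprod_opp x : hprod := fun i => - x i.
Let hprod_scale (a : R) x : hprod := fun i => a *: x i.

Let hprod_addA : associative hprod_add.
Proof. by move=> x y z; apply: functional_extensionality_dep => i; exact: addrA. Qed.
Let hprod_addC : commutative hprod_add.
Proof. by move=> x y; apply: functional_extensionality_dep => i; exact: addrC. Qed.
Let hprod_add0 : left_id ((fun i => 0) : hprod) hprod_add.
Proof. by move=> x; apply: functional_extensionality_dep => i; exact: add0r. Qed.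
Let hprod_addN : left_inverse ((fun i => 0) : hprod) hprod_opp hprod_add.
Proof. by move=> x; apply: functional_extensionality_dep => i; exact: addNr. Qed.

HB.instance Definition _ :=
  GRing.isZmodule.Build hprod hprod_addA hprod_addC hprod_add0 hprod_addN.

Let hprod_scaleA (a b : R) x : hprod_scale a (hprod_scale b x) = hprod_scale (a * b) x.
Proof. by apply: functional_extensionality_dep => i; exact: scalerA. Qed.
Let hprod_scale1 : left_id 1 hprod_scale.
Proof. by move=> x; apply: functional_extensionality_dep => i; exact: scale1r. Qed.
Let hprod_scaleDr : right_distributive hprod_scale +%R.
Proof. by move=> a x y; apply: functional_extensionality_dep => i; exact: scalerDr. Qed.
Let hprod_scaleDl x : {morph hprod_scale^~ x : a b / a + b}.
Proof. by move=> a b; apply: functional_extensionality_dep => i; exact: scalerDl. Qed.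

HB.instance Definition _ := GRing.Zmodule_isLmodule.Build R hprod
  hprod_scaleA hprod_scale1 hprod_scaleDr hprod_scaleDl.

Definition hprod_dot x y : R := \sum_i inner (x i) (y i).

Let hprod_dotC x y : hprod_dot x y = (-1) ^+ false * idfun (hprod_dot y x).
Proof. by rewrite expr0 mul1r; apply: eq_bigr => i _; exact: dotC. Qed.

Let hprod_dotl y : GRing.linear_for *%R (hprod_dot^~ y).
Proof.
move=> a u v; rewrite /hprod_dot mulr_sumr -big_split/=.
by apply: eq_bigr => i _; rewrite dotDl dotZl.
Qed.

Let hprod_dot_bilinear : bilinear_for *%R (idfun \; *%R) hprod_dot.
Proof.
split=> y; first exact: hprod_dotl.
move=> a u v /=; rewrite !(hprod_dotC y) !expr0 !mul1r/=; exact: hprod_dotl.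
Qed.

HB.instance Definition _ := bilinear_isBilinear.Build R hprod hprod R
  *%R (idfun \; *%R) hprod_dot hprod_dot_bilinear.
HB.instance Definition _ :=
  isHermitianSesquilinear.Build R hprod false idfun hprod_dot hprod_dotC.

Let hprod_dot_gt0 x : x != 0 -> 0 < hprod_dot x x.
Proof.
move=> /eqP x0; have [i xi] : exists i, x i != 0.
  apply: contra_notP x0 => /forallNP x0; apply: functional_extensionality_dep.
  by move=> i; apply/eqP/negPn/negP; exact: x0.
rewrite /hprod_dot (bigD1 i)//= ltr_wpDr ?sumr_ge0// => [j _|].
  exact: dot_ge0.
exact: neq0_dnorm_gt0.
Qed.

HB.instance Definition _ := isDotProduct.Build R hprod hprod_dot hprod_dot_gt0.

HB.instance Definition _ := @Lmodule_isNormed.Build R hprod (dot_norm hprod_dot)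
  (dot_normD hprod_dot) (dot_normZ hprod_dot) (@dot_norm_eq0 _ _ hprod_dot).

Lemma hprod_norm_sqr x : `|x| ^+ 2 = \sum_i `|x i| ^+ 2.
Proof.
rewrite [LHS]sqr_sqrtr ?dot_ge0//.
by apply: eq_bigr => i _; rewrite inner_norm.
Qed.

Lemma hprod_norm_coord x i : `|x i| <= `|x|.
Proof.
rewrite -(@ler_pXn2r _ 2) ?nnegrE// hprod_norm_sqr (bigD1 i)//= lerDl.
by rewrite sumr_ge0// => j _; rewrite exprn_ge0.
Qed.

Let hprod_complete (F : set_system hprod) : ProperFilter F -> cauchy F -> cvg F.
Proof.
move=> FF /cauchy_ballP Fc.
have Fi i : cvg ((fun x : hprod => x i) @ F).
  apply: cauchy_cvg; apply/cauchy_ballP => e e0.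
  have [[A B] /= [FA FB] AB] := Fc _ e0.
  exists ([set y | exists2 x, A x & y = x i], [set y | exists2 x, B x & y = x i]).
    by split; [apply: filterS FA|apply: filterS FB] => x ?; exists x.
  move=> [_ _] [/= [x Ax ->] [y By ->]].
  have := AB (x, y) (conj Ax By).
  rewrite -!ball_normE /ball_/= => /le_lt_trans; apply.
  exact: (hprod_norm_coord (x - y)).
pose l : hprod := fun i => lim ((fun x : hprod => x i) @ F).
apply/cvg_ex; exists l; apply/cvgrPdist_lt => e e0.
pose d := e / (#|I|.+1)%:R.
have d0 : 0 < d by rewrite divr_gt0.
have : \forall x \near F, forall i, `|l i - x i| < d.
  apply: filter_forall => i.
  by have /cvgrPdist_lt/(_ _ d0) := Fi i.
apply: filterS => x lx.
rewrite -(@ltr_pXn2r _ 2) ?nnegrE ?(ltW e0)//.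
have -> : e = d * #|I|.+1%:R by rewrite divfK// pnatr_eq0.
rewrite hprod_norm_sqr exprMn.
apply: (@le_lt_trans _ _ (\sum_(i : I) d ^+ 2)).
  by apply: ler_sum => i _; rewrite ler_pXn2r ?nnegrE ?(ltW d0)// ltW.
rewrite sumr_const -[ltLHS]mulr_natr ltr_pM2l ?exprn_gt0// -natrX ltr_nat.
by apply: (@leq_trans (#|I|.+1 ^ 1)); rewrite ?leq_pexp2l// expn1 ltnS.
Qed.

HB.instance Definition _ := Uniform_isComplete.Build hprod hprod_complete.

Let hprod_inner_norm x : hprod_dot x x = `|x| ^+ 2.
Proof. by rewrite [RHS]sqr_sqrtr ?dot_ge0. Qed.

HB.instance Definition _ :=
  @CompleteNormedModule_isHilbert.Build R hprod hprod_dot hprod_inner_norm.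

End HilbertProduct.

Section ConvexAnalysis.
Context {R : realType} {H : hilbertType R}.
Implicit Types (f g : H -> \bar R) (x y u v : H) (S T : H -> set H).
Local Open Scope ereal_scope.

Definition edom f : set H := [set x | f x < +oo].

Definition eproper f := edom f !=set0 /\ forall x, f x != -oo.

(* Only meaningful for functions that do not take the value -oo, since
   +oo + -oo = -oo in \bar R; it is only used together with eproper. *)
Definition econvex f := forall x y (t : R), (0 < t < 1)%R ->
  f (t *: x + (1 - t) *: y)%R <= t%:E * f x + (1 - t)%:E * f y.

Definition Gamma f := [/\ eproper f, econvex f & lower_semicontinuous f].

Definition conjugate f u : \bar R :=
  ereal_sup (range (fun x => (inner u x)%:E - f x)).

Definition subdiff f x : set H := [set v | f x \is a fin_num /\
  forall y, f x + (inner v (y - x)%R)%:E <= f y].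

Definition infconv f g x : \bar R :=
  ereal_inf (range (fun y => f y + g (x - y)%R)).

Definition set_inverse T : H -> set H := fun u => [set x | T x u].

Definition parallel_sum S T : H -> set H :=
  set_inverse (fun u =>
    [set (a + b)%R | a in set_inverse S u & b in set_inverse T u]).

Definition minimizer {X : Type} (F : X -> \bar R) (x : X) :=
  forall y : X, F x <= F y.

Definition maximizer {X : Type} (F : X -> \bar R) (x : X) :=
  forall y : X, F y <= F x.

Definition prox (gamma : R) f x : H :=
  xget 0%R (minimizer
    (fun y => f y + ((2 * gamma)^-1 * `|(y - x)%R| ^+ 2)%:E)).

(* phi stands for a function [0, +oo[ -> [0, +oo]; its values at negative
   arguments are irrelevant. *)
Definition convex_with_modulus f (phi : R -> \bar R) :=
  forall x y (t : R), edom f x -> edom f y -> (0 < t < 1)%R ->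
  f (t *: x + (1 - t) *: y)%R + (t * (1 - t))%:E * phi `|x - y|%R
    <= t%:E * f x + (1 - t)%:E * f y.

Definition uniformly_convex f := eproper f /\
  exists phi : R -> \bar R,
    [/\ forall s, (0 <= s)%R -> 0 <= phi s,
        forall s t, (0 <= s)%R -> (s <= t)%R -> phi s <= phi t,
        forall s, (0 <= s)%R -> (phi s = 0 <-> s = 0%R) &
        convex_with_modulus f phi].

Definition strongly_convex (rho : R) f := eproper f /\
  convex_with_modulus f (fun s => (rho / 2 * s ^+ 2)%:E).

(* The Riesz representative of the Frechet differential; meaningful at points
   where h is differentiable. *)
Definition grad (h : H -> R) x : H :=
  xget 0%R [set d | forall y, 'd h x y = inner d y].

Definition sqri (A : set H) : set H := [set x | A x /\
  let C := \bigcup_(t in [set t : R | (0 < t)%R])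
             [set t *: (s - x)%R | s in A] in
  closed C /\ submod_closed (mem C)].

Definition weakly_cvg (x_ : nat -> H) x :=
  forall u, (fun n => inner (x_ n) u) @ \oo --> inner x u.

End ConvexAnalysis.

Section Operators.
Context {R : realType} {H K : hilbertType R}.

Definition opnorm (L : H -> K) : R := sup [set `|L x| | x in [set x | `|x| <= 1]].

Definition adjoint (L : H -> K) (v : K) : H :=
  xget 0 [set y | forall x, inner (L x) v = inner x y].

End Operators.

Section Problems.
Context {R : realType} {H : hilbertType R} {m : nat} {G : 'I_m -> hilbertType R}.
Variables (f : H -> \bar R) (h : H -> R) (z : H).
Variables (g l : forall i, G i -> \bar R) (r : forall i, G i).
Variable L : forall i, {linear H -> G i}.
Arguments g : clear implicits.
Arguments l : clear implicits.
Local Open Scope ereal_scope.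

Definition primal_objective (x : H) : \bar R :=
  f x + \sum_(i < m) infconv (g i) (l i) (L i x - r i)%R
  + (h x)%:E - (inner x z)%:E.

Definition dual_objective (v : forall i, G i) : \bar R :=
  - infconv (conjugate f) (conjugate (EFin \o h))
      (z - \sum_(i < m) adjoint (L i) (v i))%R
  - \sum_(i < m) (conjugate (g i) (v i) + conjugate (l i) (v i)
                  + (inner (v i) (r i))%:E).

(* The point tested is -r = (-r_i)_i, because the functions g_i [] l_i are
   evaluated at L_i x - r_i. The condition is not sufficient with r in place
   of -r: take H = G = R, L = id, h = 0, z = 0, f(x) = - sqrt (x + 1) on
   [-1, +oo[, g the indicator of ]-oo, 0], l the indicator of {0}, r = -1;
   the only minimizer is -1, where f has no subgradient, although -1 is
   interior to (dom g + dom l) - dom f = ]-oo, 1]. *)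
Definition regular : Prop :=
  sqri [set (a - b)%R | a in [set y : hprod G | forall i,
            [set (c + d)%R | c in edom (g i) & d in edom (l i)] (y i)]
          & b in [set ((fun i => L i x) : hprod G) | x in edom f]]
       (- (r : hprod G))%R.

Definition optimality_conditions (x : H) (v : forall i, G i) : Prop :=
  [set (w + grad h x)%R | w in subdiff f x]
    (z - \sum_(i < m) adjoint (L i) (v i))%R /\
  forall i, parallel_sum (subdiff (g i)) (subdiff (l i)) (L i x - r i)%R (v i).

End Problems.

(* Main.v *)
Require Import Defs.
From mathcomp Require Import all_boot all_order all_algebra.
From mathcomp Require Import all_classical all_reals all_analysis.
From mathcomp Require Import ring lra.

Set Implicit Arguments.
Unset Strict Implicit.
Unset Printing Implicit Defensive.

Import Order.TTheory GRing.Theory Num.Theory.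
Import numFieldNormedType.Exports.

Local Open Scope classical_set_scope.
Local Open Scope ring_scope.

(** In the product space H x G_1 x ... x G_m the iteration is an inertial
    forward-backward-forward method for 0 \in A s + B s, where A is the product
    of the subdifferentials of f and of the g_i^*, and B (x, v) has components
    grad h x + sum_i L_i^* v_i - z and grad l_i^* v_i - L_i x + r_i; the
    operator B is monotone and beta-Lipschitz, and the zeros of A + B are the
    solutions of the optimality conditions.

    Zeros exist: write (P) as a minimization over (x, c, d) under the constraint
    c_i + d_i = L_i x - r_i and penalize the constraint.  By the regularity
    condition the multipliers of the penalized problems are pointwise bounded,
    hence bounded by the Banach-Steinhaus theorem, and any weak limit of them
    is a multiplier for (P).

    For a zero s, a Lyapunov function built on |z_n - s|^2 decreases along the
    iteration; this gives the summability statements and the convergence of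
    |z_n - s|.  Weak limit points are zeros by Minty's trick, and Opial's lemma
    concludes.  Weak compactness of bounded sequences is used in the form of
    convergence along ultrafilters on nat.  Strong convergence holds since the
    inner product of the residual with p_n - s, which tends to 0, bounds each
    of the monotonicity gaps. *)

(** * Geometry of Hilbert spaces *)

(** The two summands of beta have separate origins: the gradients contribute the maximum of the
    Lipschitz constants, and the coupling through the L_i and their adjoints is a skew linear
    operator, which adds nothing to monotonicity and has norm at most sqrt(sum |L_i|^2). A skew
    operator is not cocoercive, hence the second evaluation of B at p_n in each step.

    The obstacle to the existence of multipliers is that the regularity condition provides no
    interior point: it only says that the cone generated by the constraint values over the domain is
    a closed subspace. The multipliers 2 n T(w_n) of the penalized problems lie in this subspace, so
    testing them on a vector amounts to testing them on its projection e. Feasible directions give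
    lower bounds only, but both e and -e belong to the subspace, which makes the bounds two-sided. A
    proximal term |w - w0|^2 around the chosen solution w0 is added to each penalized problem; it
    forces strong convergence of the minimizers to w0, so that in the limit only the multiplier
    survives. *)

Section HilbertGeometry.
Context {R : realType} {H : hilbertType R}.
Implicit Types (x y u v : H) (a t : R).

Lemma innerC x y : inner x y = inner y x. Proof. exact: dotC. Qed.

Lemma innerDl x y u : inner (x + y) u = inner x u + inner y u.
Proof. exact: dotDl. Qed.

Lemma innerDr x y u : inner u (x + y) = inner u x + inner u y.
Proof. exact: dotDr. Qed.

Lemma innerZl a x u : inner (a *: x) u = a * inner x u.
Proof. exact: dotZl. Qed.

Lemma innerZr a x u : inner u (a *: x) = a * inner u x.
Proof. exact: dotZr. Qed.

Lemma innerNl x u : inner (- x) u = - inner x u.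
Proof. by rewrite -scaleN1r innerZl mulN1r. Qed.

Lemma innerNr x u : inner u (- x) = - inner u x.
Proof. by rewrite innerC innerNl innerC. Qed.

Lemma inner0l u : inner 0 u = 0 :> R.
Proof. by rewrite -(scale0r (0 : H)) innerZl mul0r. Qed.

Lemma inner0r u : inner u 0 = 0 :> R.
Proof. by rewrite innerC inner0l. Qed.

Definition innerE := (innerDl, innerDr, innerNl, innerNr, innerZl, innerZr).

Lemma inner_sumr (I : Type) (s : seq I) (F : I -> H) u :
  inner u (\sum_(i <- s) F i) = \sum_(i <- s) inner u (F i).
Proof. by apply: (big_morph (inner u)) => [x y|]; rewrite ?innerDr ?inner0r. Qed.

Lemma inner_ge0 x : 0 <= inner x x. Proof. exact: dot_ge0. Qed.

Lemma normr_sqD x y : `|x + y| ^+ 2 = `|x| ^+ 2 + 2 * inner x y + `|y| ^+ 2.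
Proof. rewrite -!inner_norm !innerE (innerC y x); ring. Qed.

Lemma normr_sqB x y : `|x - y| ^+ 2 = `|x| ^+ 2 - 2 * inner x y + `|y| ^+ 2.
Proof. rewrite -!inner_norm !innerE (innerC y x); ring. Qed.

Lemma inner_norm_le x y : `|inner x y| <= `|x| * `|y|.
Proof.
rewrite -(@ler_pXn2r _ 2) ?nnegrE ?mulr_ge0// real_normK ?num_real//.
by rewrite exprMn -!inner_norm; exact: dot_CauchySchwarz.
Qed.

Lemma inner_le x y : inner x y <= `|x| * `|y|.
Proof. exact: le_trans (ler_norm _) (inner_norm_le _ _). Qed.

Lemma inner_eq0 x : (forall u, inner x u = 0) -> x = 0.
Proof.
move=> /(_ x) /eqP; rewrite inner_norm expf_eq0/= normr_eq0.
by move=> /eqP.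
Qed.

(** Turns vector identities into identities between real numbers, which [ring] and [field] decide;
    most rearrangements of linear combinations below are proved this way. *)
Lemma inner_inj x y : (forall u, inner x u = inner y u) -> x = y.
Proof.
move=> xy; apply/eqP; rewrite -subr_eq0; apply/eqP/inner_eq0 => u.
by rewrite innerDl innerNl xy subrr.
Qed.

Lemma normr_sq_conv t x y : `|t *: x + (1 - t) *: y| ^+ 2 =
  t * `|x| ^+ 2 + (1 - t) * `|y| ^+ 2 - t * (1 - t) * `|x - y| ^+ 2.
Proof. rewrite -!inner_norm !innerE (innerC y x); ring. Qed.

(** Polarization writes the inner product in terms of norms, whose limits are known. *)
Lemma cvg_inner {T : Type} (F : set_system T) {FF : Filter F}
    (u v : T -> H) x y :
  u @ F --> x -> v @ F --> y -> (fun n => inner (u n) (v n)) @ F --> inner x y.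
Proof.
move=> ux vy.
suff E : (fun n => inner (u n) (v n)) =
         (fun n => (`|u n + v n| ^+ 2 - `|u n - v n| ^+ 2) / 4).
  rewrite E (_ : inner x y = (`|x + y| ^+ 2 - `|x - y| ^+ 2) / 4); last first.
    by rewrite normr_sqD normr_sqB; field.
  apply: cvgMl; apply: cvgB; rewrite !expr2; apply: cvgM;
    apply: cvg_norm; by [apply: cvgD|apply: cvgB].
by apply: funext => n; rewrite normr_sqD normr_sqB; field.
Qed.

Lemma cvg0_inner {T : Type} (F : set_system T) {FF : Filter F}
    (w p : T -> H) (M : R) : w @ F --> (0 : H) ->
  (\forall n \near F, `|p n| <= M) -> (fun n => inner (w n) (p n)) @ F --> (0 : R).
Proof.
move=> w0 pM; apply/cvgr0Pnorm_le => e e0.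
have c0 : 0 < `|M| + 1 by rewrite ltr_wpDl.
near=> n; apply: le_trans (inner_norm_le _ _) _.
apply: (@le_trans _ _ (`|w n| * (`|M| + 1))).
  rewrite ler_wpM2l//; have : `|p n| <= M by near: n.
  have := ler_norm M; lra.
rewrite -ler_pdivlMr//; near: n.
by apply: cvgr0_norm_le; [exact: w0|rewrite divr_gt0].
Unshelve. all: by end_near. Qed.

Lemma cvg_normr_sq {T : Type} (F : set_system T) {FF : Filter F}
    (u : T -> H) x :
  u @ F --> x -> (fun n => `|u n| ^+ 2) @ F --> `|x| ^+ 2.
Proof.
by move=> ux; rewrite expr2; under eq_fun do rewrite expr2; apply: cvgM;
   apply: cvg_norm.
Qed.

Lemma continuous_inner u : continuous (fun x => inner u x).
Proof. by move=> x; apply: cvg_inner; [exact: cvg_cst|exact: cvg_id]. Qed.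

Lemma sq_cvg0 {T : Type} (F : set_system T) {FF : Filter F} (u : T -> H) :
  (fun n => `|u n| ^+ 2) @ F --> (0 : R) -> u @ F --> (0 : H).
Proof.
move=> /cvgr0Pnorm_lt u0; apply/cvgr0Pnorm_lt => e e0.
near=> n; rewrite -(@ltr_pXn2r _ 2) ?nnegrE ?(ltW e0)//.
rewrite -[ltLHS]ger0_norm ?exprn_ge0//; near: n.
by apply: u0; rewrite exprn_gt0.
Unshelve. all: by end_near. Qed.

Lemma bounded_continuous (K : normedModType R) (F : H -> K) (c : R) :
  (forall x y, `|F x - F y| <= c * `|x - y|) -> continuous F.
Proof.
move=> Fc x; apply/cvgrPdist_lt => e e0.
have /cvgrPdist_lt idx : (id : H -> H) @ x --> x by exact: cvg_id.
have c0 : 0 < `|c| + 1 by rewrite ltr_wpDl.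
near=> y; apply: le_lt_trans (Fc _ _) _.
apply: (@le_lt_trans _ _ ((`|c| + 1) * `|x - y|)).
  by rewrite ler_wpM2r// (le_trans (ler_norm c))// lerDl.
rewrite mulrC -ltr_pdivlMr//; near: y.
by apply: idx; rewrite divr_gt0.
Unshelve. all: by end_near. Qed.

Lemma cauchy_sq_cvg (u : nat -> H) (e : nat -> R) :
  (forall n k, (n <= k)%N -> `|u n - u k| ^+ 2 <= e n) ->
  e @ \oo --> (0 : R) -> cvg (u @ \oo).
Proof.
move=> ue /cvgr0Pnorm_lt e0; apply: cauchy_cvg; apply: cauchy_exP => d d0.
have [N _ /(_ N) /= eN] := e0 _ (exprn_gt0 2 d0).
exists (u N); exists N => // k /= Nk.
rewrite -ball_normE /ball_/= -(@ltr_pXn2r _ 2) ?nnegrE ?(ltW d0)//.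
exact: le_lt_trans (ue _ _ Nk) (le_lt_trans (ler_norm _) (eN _)).
Qed.

(* Almost minimal-norm points of the sets form a Cauchy sequence by the
   parallelogram law. *)
Lemma nested_closed_convex (C : nat -> set H) (M : R) :
  (forall n, C n !=set0) -> (forall n, closed (C n)) ->
  (forall n x y, C n x -> C n y -> C n (2^-1 *: (x + y))) ->
  (forall n, C n.+1 `<=` C n) -> (forall x, C 0%N x -> `|x| <= M) ->
  exists x, forall n, C n x.
Proof.
move=> C0 Ccl Cmid CS CM.
have Cle n k : (n <= k)%N -> C k `<=` C n.
  move=> /subnK <-; elim: (k - n)%N => [|i IH]; first by rewrite add0n.
  by rewrite addSn => x /CS /IH.
pose N n := inf [set `|x| ^+ 2 | x in C n].
have Nlb n : has_lbound [set `|x| ^+ 2 | x in C n].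
  by exists 0 => _ [x _ <-]; rewrite exprn_ge0.
have Ninf n : has_inf [set `|x| ^+ 2 | x in C n].
  by split => //; have [x Cx] := C0 n; exists (`|x| ^+ 2), x.
have N_le n x : C n x -> N n <= `|x| ^+ 2.
  by move=> Cx; apply: ge_inf => //; exists x.
have /choice[x xP] n : exists x, C n x /\ `|x| ^+ 2 < N n + n.+1%:R^-1.
  have n0 : 0 < n.+1%:R^-1 :> R by rewrite invr_gt0.
  by have [_ [x Cx <-] xN] := inf_adherent n0 (Ninf n); exists x.
have Nnd : {homo N : n k / (n <= k)%N >-> n <= k}.
  move=> n k nk; apply: lb_le_inf; first by case: (Ninf k).
  by move=> _ [y /(Cle _ _ nk) Cy <-]; exact: N_le.
have Nub : has_ubound (range N).
  exists (M ^+ 2) => _ [n _ <-]; have [y Cy] := C0 n.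
  apply: le_trans (N_le _ _ Cy) _; have yM := CM _ (Cle _ _ (leq0n n) _ Cy).
  by rewrite ler_pXn2r ?nnegrE// (le_trans _ yM).
have Ncv := nondecreasing_is_cvgn Nnd Nub.
have NL n : N n <= limn N by exact: nondecreasing_cvgn_le.
have xc : cvg (x @ \oo).
  (* The midpoint of [x n] and [x k] lies in [C n], so four times its squared norm is at least
     [4 * N n]; the slacks of [x n] and [x k] enter with factor 2 each. *)
  apply: (@cauchy_sq_cvg _ (fun n => 2 * (limn N - N n) + 4 * n.+1%:R^-1)).
    move=> n k nk; have [Cn xn] := xP n; have [Ck xk] := xP k.
    have := N_le _ _ (Cmid _ _ _ Cn (Cle _ _ nk _ Ck)).
    have kn : k.+1%:R^-1 <= n.+1%:R^-1 :> R by rewrite lef_pV2 ?posrE// ler_nat.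
    have := NL k; rewrite normr_sqB normrZ exprMn normr_sqD.
    rewrite ger0_norm ?invr_ge0//.
    move: xn xk kn; move: (n.+1%:R^-1) (k.+1%:R^-1) => a b.
    lra.
  rewrite [X in _ --> X](_ : _ = 2 * (limn N - limn N) + 4 * 0); last by lra.
  apply: cvgD; last by apply: cvgMr; exact: cvg_harmonic.
  by apply: cvgMr; apply: cvgB => //; exact: cvg_cst.
exists (limn x) => n; apply: (closed_cvg _ (Ccl n) _ _ xc).
by exists n => // k /= nk; apply: (Cle _ _ nk); case: (xP k).
Qed.

End HilbertGeometry.

(** * Convex lower semicontinuous functions *)

Section ConvexFunctions.
Context {R : realType}.
Implicit Types (H K : hilbertType R).

Lemma ereal_fin (e : \bar R) : e != -oo%E -> (e < +oo)%E ->
  exists r : R, e = r%:E.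
Proof. by case: e => // r _ _; exists r. Qed.

Lemma ereal_le_fin (e : \bar R) (a : R) : e != -oo%E -> (e <= a%:E)%E ->
  exists2 r : R, e = r%:E & r <= a.
Proof. by case: e => // r _ ra; exists r. Qed.

(** Real upper bounds of the values keep products with infinite values out of all later convexity
    arguments. *)
Lemma econvexP H (f : H -> \bar R) : (forall x, f x != -oo%E) ->
  econvex f <-> forall x y (a b t : R), 0 < t < 1 ->
    (f x <= a%:E)%E -> (f y <= b%:E)%E ->
    (f (t *: x + (1 - t) *: y)%R <= (t * a + (1 - t) * b)%:E)%E.
Proof.
move=> fN; split=> [fc x y a b t t01 fa fb|fc x y t t01].
  apply: le_trans (fc _ _ _ t01) _; have /andP[t0 t1] := t01.
  rewrite [leRHS]EFinD !EFinM; apply: leeD; apply: lee_wpmul2l => //.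
    by rewrite lee_fin ltW.
  by rewrite lee_fin subr_ge0 ltW.
have /andP[t0 t1] := t01; have := fN x; have := fN y.
have t1' : 0 < 1 - t by rewrite subr_gt0.
case fx : (f x) => [a| |]//; case fy : (f y) => [b| |]// _ _.
- by apply: fc => //; rewrite ?fx ?fy.
- by rewrite gt0_muley ?lte_fin// addey ?leey.
- by rewrite gt0_muley ?lte_fin// addye ?leey.
- by rewrite !gt0_muley ?lte_fin// addye ?leey.
Qed.

Lemma lscP H (f : H -> \bar R) :
  lower_semicontinuous f <-> forall a : R, closed [set x | (f x <= a%:E)%E].
Proof.
have E a : [set x | (a%:E < f x)%E] = ~` [set x | (f x <= a%:E)%E].
  by apply/seteqP; split=> x /=; [move=> /lt_geF ->|move/negP; rewrite -ltNge].
split=> [/lower_semicontinuousP fo a|fc]; first by rewrite -openC -E.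
by apply/lower_semicontinuousP => a; rewrite E openC.
Qed.

Lemma lscD H (f g : H -> \bar R) :
  (forall x, f x != -oo%E) -> (forall x, g x != -oo%E) ->
  lower_semicontinuous f -> lower_semicontinuous g ->
  lower_semicontinuous (fun x => f x + g x)%E.
Proof.
move=> fN gN fl gl x a afg.
(* When both values are finite, each gives up half of the gap [r + s - a]; an infinite value leaves
   room for any split. *)
have [a1 [a2 [fa1 ga2 a12]]] : exists a1 a2 : R,
    [/\ (a1%:E < f x)%E, (a2%:E < g x)%E & a1 + a2 = a].
  have := fN x; have := gN x; case: (f x) (g x) afg => [r| |] [s| |]//.
  - rewrite -EFinD lte_fin => ars _ _; pose d := (r + s - a) / 2.
    exists (r - d), (s - d); rewrite /d !lte_fin; split; lra.
  - by move=> _ _ _; exists (r - 1), (a - (r - 1)); rewrite lte_fin ltry; split => //; lra.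
  - by move=> _ _ _; exists (a - (s - 1)), (s - 1); rewrite lte_fin ltry; split => //; lra.
  - by move=> _ _ _; exists a, 0; rewrite !ltry addr0; split.
have [V Vx fV] := fl _ _ fa1; have [W Wx gW] := gl _ _ ga2.
exists (V `&` W); first exact: filterI.
by move=> y [/fV fy /gW gy]; rewrite -a12 EFinD; exact: lteD.
Qed.

Lemma lsc_real H (q : H -> R) : continuous q ->
  lower_semicontinuous (EFin \o q).
Proof.
move=> qc; apply/lscP => a; rewrite (_ : mkset _ = q @^-1` [set r | r <= a]).
  by move/continuous_closedP: qc; apply; exact: closed_le.
by apply/seteqP; split=> x /=; rewrite lee_fin.
Qed.

Lemma GammaI H (f : H -> \bar R) :
  (exists x, edom f x) -> (forall x, f x != -oo%E) ->
  (forall x y (a b t : R), 0 < t < 1 ->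
    (f x <= a%:E)%E -> (f y <= b%:E)%E ->
    (f (t *: x + (1 - t) *: y)%R <= (t * a + (1 - t) * b)%:E)%E) ->
  (forall a : R, closed [set x | (f x <= a%:E)%E]) -> Gamma f.
Proof. by move=> fd fN fc fl; split; [|apply/econvexP|apply/lscP]. Qed.

Lemma Gamma_Nninfty H (f : H -> \bar R) x : Gamma f -> f x != -oo%E.
Proof. by move=> [[]]. Qed.

Lemma Gamma_dom H (f : H -> \bar R) : Gamma f -> exists x (r : R), f x = r%:E.
Proof.
by move=> [[[x xf] fN] _ _]; have [r fr] := ereal_fin (fN x) xf; exists x, r.
Qed.

Lemma Gamma_conv H (f : H -> \bar R) x y (a b t : R) : Gamma f -> 0 < t < 1 ->
  (f x <= a%:E)%E -> (f y <= b%:E)%E ->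
  (f (t *: x + (1 - t) *: y)%R <= (t * a + (1 - t) * b)%:E)%E.
Proof. by move=> [[_ fN] /(econvexP fN) fc _]; exact: fc. Qed.

Lemma Gamma_mid H (f : H -> \bar R) x y (a b : R) : Gamma f ->
  (f x <= a%:E)%E -> (f y <= b%:E)%E ->
  (f (2^-1 *: (x + y))%R <= (2^-1 * (a + b))%:E)%E.
Proof.
move=> Gf fa fb; have h01 : (0 < (2^-1 : R)) && ((2^-1 : R) < 1).
  by apply/andP; split; lra.
have E : 1 - 2^-1 = 2^-1 :> R by lra.
by have := Gamma_conv Gf h01 fa fb; rewrite E -scalerDr -mulrDr.
Qed.

Lemma Gamma_closed H (f : H -> \bar R) (a : R) :
  Gamma f -> closed [set x | (f x <= a%:E)%E].
Proof. by move=> [_ _ /lscP]. Qed.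

Lemma GammaD H (f g : H -> \bar R) : Gamma f -> Gamma g ->
  (exists x, edom f x /\ edom g x) -> Gamma (fun x => f x + g x)%E.
Proof.
move=> Gf Gg [x0 [fx0 gx0]].
have N x : (f x + g x != -oo)%E.
  by rewrite adde_eq_ninfty negb_or (Gamma_Nninfty _ Gf) (Gamma_Nninfty _ Gg).
split; first by split => //; exists x0; exact: lte_add_pinfty.
  apply/econvexP => // x y a b t t01.
  have fin z c : (f z + g z <= c%:E)%E ->
      exists r s, [/\ f z = r%:E, g z = s%:E & r + s <= c].
    move=> h; have := N z; have := Gamma_Nninfty z Gf; have := Gamma_Nninfty z Gg.
    by case: (f z) (g z) h => [r| |] [s| |]// ? _ _ _; exists r, s.
  move=> /fin[r [s [fr gs rs]]] /fin[r' [s' [fr' gs' rs']]].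
  apply: (@le_trans _ _ ((t * r + (1 - t) * r') + (t * s + (1 - t) * s'))%:E).
    by rewrite [leRHS]EFinD; apply: leeD; apply: Gamma_conv => //;
      rewrite ?fr ?fr' ?gs ?gs'.
  have /andP[t0 t1] := t01; rewrite lee_fin.
  have : t * (r + s) <= t * a by rewrite ler_pM2l.
  have : (1 - t) * (r' + s') <= (1 - t) * b by rewrite ler_pM2l ?subr_gt0.
  lra.
have [_ _ fl] := Gf; have [_ _ gl] := Gg; apply: lscD => // x.
  exact: Gamma_Nninfty.
exact: Gamma_Nninfty.
Qed.

Lemma Gamma_real H (q : H -> R) : continuous q ->
  (forall x y t, 0 < t < 1 ->
    q (t *: x + (1 - t) *: y) <= t * q x + (1 - t) * q y) ->
  Gamma (EFin \o q).
Proof.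
move=> qc qconv; split; last exact: lsc_real.
  by split => //; exists 0; rewrite /edom/= ltry.
apply/econvexP => // x y a b t t01; rewrite !lee_fin => qa qb.
have /andP[t0 t1] := t01; apply: le_trans (qconv _ _ _ t01) _.
by apply: lerD; rewrite ler_pM2l// subr_gt0.
Qed.

Lemma GammaDr H (f : H -> \bar R) (q : H -> R) : Gamma f -> continuous q ->
  (forall x y t, 0 < t < 1 ->
    q (t *: x + (1 - t) *: y) <= t * q x + (1 - t) * q y) ->
  Gamma (fun x => f x + (q x)%:E)%E.
Proof.
move=> Gf qc qconv; apply: GammaD => //; first exact: Gamma_real.
have [x [r fx]] := Gamma_dom Gf.
by exists x; rewrite /edom /= fx !ltry.
Qed.

Lemma Gamma_comp H K (f : K -> \bar R) (a : H -> K) : Gamma f ->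
  continuous a ->
  (forall x y t, a (t *: x + (1 - t) *: y) = t *: a x + (1 - t) *: a y) ->
  (exists x, edom f (a x)) -> Gamma (f \o a).
Proof.
move=> Gf ac aconv ad; apply: GammaI => //.
- by move=> x; exact: (Gamma_Nninfty (a x) Gf).
- by move=> x y c d t t01 /= fc fd; rewrite aconv; exact: (Gamma_conv Gf).
- move=> c; rewrite (_ : mkset _ = a @^-1` [set x | (f x <= c%:E)%E])//.
  by move/continuous_closedP: ac; apply; exact: Gamma_closed.
Qed.

(** Lower semicontinuity bounds [f] below on a ball of radius [d] around a point [x0] of its domain;
    convexity along the segment from [x0] to [x] extends this to linear decay of slope 1/d. Proximal
    points cannot be used here, since their existence rests on this bound. *)
Lemma Gamma_minorant H (f : H -> \bar R) : Gamma f ->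
  exists a b : R, 0 <= a /\ forall x, ((b - a * `|x|)%:E <= f x)%E.
Proof.
move=> Gf; have [x0 [r0 fx0]] := Gamma_dom Gf; have [_ _ fl] := Gf.
have [V /nbhs_ballP[e /= e0 eV] Vf] : exists2 V : set H, nbhs x0 V &
    forall y, V y -> ((r0 - 1)%:E < f y)%E.
  by apply: fl; rewrite fx0 lte_fin ltrBlDr ltrDl.
pose d := e / 2; have d0 : 0 < d by rewrite divr_gt0.
have dV y : `|y - x0| <= d -> ((r0 - 1)%:E < f y)%E.
  move=> yd; apply/Vf/eV; rewrite -ball_normE/= distrC.
  by apply: le_lt_trans yd _; rewrite /d; lra.
have low x : ((r0 - 1 - d^-1 * `|x - x0|)%:E <= f x)%E.
  have [xd|xd] := leP `|x - x0| d.
    apply: le_trans (ltW (dV _ xd)); rewrite lee_fin gerBl.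
    by rewrite mulr_ge0// invr_ge0 ltW.
  have := Gamma_Nninfty x Gf; case fx : (f x) => [s| |]// _; last exact: leey.
  have n0 : 0 < `|x - x0| by exact: lt_trans xd.
  (* This [t] puts the point of the segment on the sphere of radius [d] around [x0]. *)
  pose t := d / `|x - x0|.
  have t0 : 0 < t by rewrite divr_gt0.
  have t1 : t < 1 by rewrite ltr_pdivrMr// mul1r.
  have := @Gamma_conv _ f x x0 s r0 t Gf; rewrite t0 t1 fx fx0.
  move=> /(_ isT (lexx _) (lexx _)) le1.
  have /lt_le_trans /(_ le1) : ((r0 - 1)%:E < f (t *: x + (1 - t) *: x0)%R)%E.
    apply: dV; rewrite scalerBl scale1r addrA [_ - _ - _]addrAC addrK.
    rewrite -scalerBr normrZ gtr0_norm// /t divfK//.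
    by rewrite gt_eqF.
  rewrite lte_fin => lt1.
  have tE : d^-1 * `|x - x0| = t^-1 by rewrite /t [RHS]invf_div mulrC.
  have : - t^-1 < s - r0.
    have : - 1 < t * (s - r0) by lra.
    by rewrite -(mulrN1 t^-1) ltr_pdivrMl.
  rewrite tE lee_fin; lra.
exists d^-1, (r0 - 1 - d^-1 * `|x0|); split; first by rewrite invr_ge0 ltW.
move=> x; apply: le_trans (low x); rewrite lee_fin.
have : d^-1 * `|x - x0| <= d^-1 * (`|x| + `|x0|).
  by rewrite ler_pM2l ?invr_gt0// ler_normB.
lra.
Qed.

Lemma Gamma_argmin H (f : H -> \bar R) : Gamma f ->
  (forall c : R, exists M : R, forall x, (f x <= c%:E)%E -> `|x| <= M) ->
  exists x, minimizer f x.
Proof.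
move=> Gf fb.
pose i := ereal_inf (range f).
have i_le x : (i <= f x)%E by apply: ereal_inf_lbound; exists x.
have [x0 [r0 fx0]] := Gamma_dom Gf.
(* Real levels decreasing to the infimum. The infimum may still be -oo at this stage; then the
   levels are -n and the third property is vacuous because of [y != -oo]. *)
have [c [cnd ci cl]] : exists c : nat -> R, [/\ forall n, c n.+1 <= c n,
    forall n, (i < (c n)%:E)%E &
    forall y : \bar R, y != -oo%E -> (forall n, (y <= (c n)%:E)%E) -> (y <= i)%E].
  have : (i < +oo)%E by apply: le_lt_trans (i_le x0) _; rewrite fx0 ltry.
  case: (i) => [r| |]// _.
    exists (fun n => r + n.+1%:R^-1); split.
    - by move=> n; rewrite lerD2l lef_pV2 ?posrE// ler_nat.
    - by move=> n; rewrite lte_fin ltrDl invr_gt0.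
    - case=> [y| |]// _; last by move=> /(_ 0%N).
      move=> yr; rewrite lee_fin; apply/ler_addgt0Pr => e e0.
      have [n ne] : exists n, n.+1%:R^-1 < e.
        by have [n _ /(_ n (leqnn n))] := near_infty_natSinv_lt (PosNum e0); exists n.
      apply: (@le_trans _ _ (r + n.+1%:R^-1)); last by rewrite lerD2l ltW.
      by have := yr n; rewrite lee_fin.
  exists (fun n => - n%:R); split.
  - by move=> n; rewrite lerN2 ler_nat.
  - by move=> n; rewrite ltNyr.
  - case=> [y| |]// _; last by move=> /(_ 0%N).
    move=> yn; exfalso; have := yn (Num.trunc `|y|).+1; rewrite lee_fin.
    have := truncnS_gt `|y|; have := ler_norm (- y); rewrite normrN; lra.
have [M fM] := fb (c 0%N).
have [||||//|x xC] := @nested_closed_convex _ _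
    (fun n => [set x | (f x <= (c n)%:E)%E]) M.
- move=> n; apply: contrapT => /forallNP fn.
  suff : ((c n)%:E <= i)%E by rewrite leNgt ci.
  apply: le_ereal_inf_tmp => _ [x _ <-]; have /negP := fn x.
  by rewrite -ltNge => /ltW.
- by move=> n; exact: Gamma_closed.
- move=> n x y /= fx fy; have := Gamma_mid Gf fx fy.
  by rewrite (_ : 2^-1 * (c n + c n) = c n)//; lra.
- by move=> n x /= /le_trans; apply; rewrite lee_fin.
exists x => y; apply: le_trans (i_le y); apply: cl => //.
exact: Gamma_Nninfty.
Qed.

End ConvexFunctions.

(** * Subdifferentials and proximal points *)

Section Subdifferential.
Context {R : realType} {H : hilbertType R}.
Implicit Types (f : H -> \bar R) (x y u v w : H).

Lemma subdiff_le f x w : subdiff f x w ->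
  exists2 r : R, f x = r%:E &
    forall y (s : R), (f y <= s%:E)%E -> r + inner w (y - x) <= s.
Proof.
move=> [/fineK fx fw]; exists (fine (f x)) => // y s fy.
by rewrite -lee_fin EFinD fx (le_trans (fw y)).
Qed.

Lemma subdiffI f x w (r : R) : f x = r%:E ->
  (forall y (s : R), (f y <= s%:E)%E -> r + inner w (y - x) <= s) ->
  subdiff f x w.
Proof.
move=> fx fw; split=> [|y]; rewrite fx// -EFinD.
case fy : (f y) => [s| |]; last 1 first.
(* If [f y] were -oo, every real would be an upper bound of it, in particular one that is too small
   by 1. *)
- have := fw y (r + inner w (y - x) - 1); rewrite fy leNye => /(_ isT).
  by rewrite lerDl oppr_ge0 ler10.
- by rewrite lee_fin; apply: fw; rewrite fy.
- exact: leey.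
Qed.

Lemma subdiff_monotone f x y u v : subdiff f x u -> subdiff f y v ->
  0 <= inner (u - v) (x - y).
Proof.
move=> /subdiff_le[r fx fu] /subdiff_le[s fy fv].
have : r + inner u (y - x) <= s by apply: fu; rewrite fy.
have : s + inner v (x - y) <= r by apply: fv; rewrite fx.
by rewrite !innerE; lra.
Qed.

(** The limit t -> 0 of an inequality along a segment that has been divided by t. *)
Lemma le_of_slope (a b c : R) : (forall t : R, 0 < t < 1 -> a <= b + t * c) ->
  a <= b.
Proof.
move=> abc; rewrite leNgt; apply/negP => ba.
pose d := a - b; have d0 : 0 < d by rewrite subr_gt0.
(* With this [e] the slope parameter [d / e] is below 1 and the remainder [d / e * c] is at most
   half of the gap [d]. *)
pose e := 2 * (`|c| + d); have e0 : 0 < e by rewrite mulr_gt0// ltr_wpDl.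
have t0 : 0 < d / e by rewrite divr_gt0.
have t1 : d / e < 1.
  by rewrite ltr_pdivrMr// mul1r /e; have := normr_ge0 c; lra.
have := abc (d / e); rewrite t0 t1 => /(_ isT) le1.
have : d / e * c <= d / e * `|c| by rewrite ler_pM2l// ler_norm.
have : d / e * `|c| <= d / 2.
  rewrite -mulrA ler_pM2l// mulrC ler_pdivrMr// /e.
  by have := normr_ge0 c; lra.
by move: le1; rewrite /d => ? ? ?; lra.
Qed.

(* The quadratic term is of second order along segments issued from x, so
   convexity removes it. *)
Lemma subdiff_quad f x w (r C : R) : Gamma f -> f x = r%:E ->
  (forall y (s : R), (f y <= s%:E)%E ->
     r + inner w (y - x) <= s + C * `|y - x| ^+ 2) ->
  subdiff f x w.
Proof.
move=> Gf fx fw; apply: (subdiffI fx) => y s fy.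
rewrite -lerBrDl; apply: (@le_of_slope _ _ (C * `|y - x| ^+ 2)) => t t01.
have fx' : (f x <= r%:E)%E by rewrite fx.
have /andP[t0 t1] := t01.
have := fw _ _ (Gamma_conv Gf t01 fy fx').
have -> : t *: y + (1 - t) *: x - x = t *: (y - x).
  by rewrite scalerBl scale1r addrA [_ - _ - _]addrAC addrK -scalerBr.
rewrite innerZr normrZ exprMn (gtr0_norm t0) => le1.
rewrite -(ler_pM2l t0); move: le1.
set q := `|y - x| ^+ 2; set i := inner w (y - x); rewrite expr2; lra.
Qed.

Let quad (c : R) x : H -> R := fun y => c * `|y - x| ^+ 2.

Lemma quad_continuous c x : continuous (quad c x).
Proof.
move=> y; apply: cvgMr; apply: cvg_normr_sq.
by apply: cvgB; [exact: cvg_id|exact: cvg_cst].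
Qed.

Lemma quad_convex c x : 0 <= c -> forall y y' t, 0 < t < 1 ->
  quad c x (t *: y + (1 - t) *: y') <= t * quad c x y + (1 - t) * quad c x y'.
Proof.
move=> c0 y y' t /andP[t0 t1]; rewrite /quad.
have -> : t *: y + (1 - t) *: y' - x = t *: (y - x) + (1 - t) *: (y' - x).
  by rewrite !scalerBr addrACA -opprD -scalerDl [t + _]addrC subrK scale1r.
rewrite normr_sq_conv.
have : 0 <= c * (t * (1 - t) * `|y - x - (y' - x)| ^+ 2).
  by rewrite !mulr_ge0// ?exprn_ge0// ltW// subr_gt0.
lra.
Qed.

Lemma Gamma_quad f c x : Gamma f -> 0 <= c ->
  Gamma (fun y => f y + (c * `|y - x| ^+ 2)%:E)%E.
Proof.
move=> Gf c0; apply: (@GammaDr _ _ f (quad c x)) => //.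
  exact: quad_continuous.
exact: quad_convex.
Qed.

(** The quadratic term dominates the at most linear decay of [f] given by [Gamma_minorant]. *)
Lemma coercive_quad f c x (d : R) : Gamma f -> 0 < c ->
  exists M : R, forall y,
    (f y + (c * `|(y - x)%R| ^+ 2)%:E <= d%:E)%E -> `|y| <= M.
Proof.
move=> Gf c0; have [a [b [a0 fab]]] := Gamma_minorant Gf.
pose D := d - b + a * `|x|; exists ((`|D| + a) / c + 1 + `|x|) => y fy.
have yD : c * `|y - x| ^+ 2 <= D + a * `|y - x|.
  have : ((b - a * `|y|)%:E + (c * `|(y - x)%R| ^+ 2)%:E <= d%:E)%E.
    by apply: le_trans fy; apply: leeD.
  rewrite -EFinD lee_fin.
  have : a * `|y| <= a * (`|y - x| + `|x|).
    by rewrite ler_wpM2l// -{1}(subrK x y) ler_normD.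
  by rewrite /D; lra.
suff : `|y - x| <= (`|D| + a) / c + 1.
  by move=> yx; have := ler_normD (y - x) x; rewrite subrK; lra.
have Dac : 0 <= (`|D| + a) / c by rewrite divr_ge0 ?addr_ge0// ltW.
have [|yx1] := leP `|y - x| 1; first lra.
suff : `|y - x| <= (`|D| + a) / c by lra.
rewrite ler_pdivlMr// -(@ler_pM2r _ `|y - x|) ?(lt_trans _ yx1)//.
have : `|D| <= `|D| * `|y - x| by rewrite ler_peMr// ltW.
have := ler_norm D; move: yD; rewrite expr2; lra.
Qed.

Lemma argmin_quad f c x : Gamma f -> 0 < c ->
  exists p, minimizer (fun y => f y + (c * `|(y - x)%R| ^+ 2)%:E)%E p.
Proof.
move=> Gf c0; apply: Gamma_argmin; first exact/Gamma_quad/ltW.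
by move=> d; exact: coercive_quad.
Qed.

(** Expanding the quadratic around [p] yields the linear term of the claimed subgradient and a
    remainder [c * |y - p|^2], which [subdiff_quad] removes. *)
Lemma minimizer_quad_subdiff f c x p : Gamma f ->
  minimizer (fun y => f y + (c * `|(y - x)%R| ^+ 2)%:E)%E p ->
  subdiff f p ((2 * c) *: (x - p)).
Proof.
move=> Gf pm; have [x0 [r0 fx0]] := Gamma_dom Gf.
have [r fp] : exists r : R, f p = r%:E.
  apply: ereal_fin; first exact: Gamma_Nninfty.
  rewrite ltNge; apply/negP; rewrite leye_eq => /eqP fp.
  by have := pm x0; rewrite fp fx0 addye// -EFinD leye_eq.
apply: (@subdiff_quad _ _ _ r c Gf fp) => y s fy.
have : (f p + (c * `|(p - x)%R| ^+ 2)%:E <= (s + c * `|(y - x)%R| ^+ 2)%:E)%E.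
  by apply: le_trans (pm y) _; rewrite EFinD leeD2r.
rewrite fp -EFinD lee_fin.
rewrite -!inner_norm !innerE (innerC y x) (innerC y p) (innerC p x); lra.
Qed.

Lemma prox_minimizer (gamma : R) f x : Gamma f -> 0 < gamma ->
  minimizer (fun y => f y + ((2 * gamma)^-1 * `|(y - x)%R| ^+ 2)%:E)%E
    (prox gamma f x).
Proof.
move=> Gf g0; apply: (@xgetPex _ 0); apply: argmin_quad => //.
by rewrite invr_gt0 mulr_gt0.
Qed.

Lemma prox_subdiff (gamma : R) f x : Gamma f -> 0 < gamma ->
  subdiff f (prox gamma f x) (gamma^-1 *: (x - prox gamma f x)).
Proof.
move=> Gf g0; have := minimizer_quad_subdiff Gf (prox_minimizer x Gf g0).
by rewrite invfM mulVKf// pnatr_eq0.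
Qed.

Lemma prox_unique (gamma : R) f x p : Gamma f -> 0 < gamma ->
  subdiff f p (gamma^-1 *: (x - p)) -> p = prox gamma f x.
Proof.
move=> Gf g0 fp; have := subdiff_monotone fp (prox_subdiff x Gf g0).
set q := prox gamma f x.
rewrite -scalerBr innerZl pmulr_rge0 ?invr_gt0//.
have -> : x - p - (x - q) = - (p - q) by rewrite !opprB addrC addrA subrK.
rewrite innerNl oppr_ge0 inner_norm => pq; apply/eqP.
rewrite -subr_eq0 -normr_eq0 -sqrf_eq0.
by rewrite eq_le pq exprn_ge0.
Qed.

(** Monotonicity is assumed only for the one pair of points, so that the lemma serves both proximal
    maps and the resolvents of an abstract monotone operator. *)
Lemma resolvent_nonexpansive (gamma : R) x y p q : 0 < gamma ->
  0 <= inner (gamma^-1 *: (x - p) - gamma^-1 *: (y - q)) (p - q) ->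
  `|p - q| <= `|x - y|.
Proof.
move=> g0; rewrite -scalerBr innerZl pmulr_rge0 ?invr_gt0//.
have -> : x - p - (y - q) = (x - y) - (p - q).
  by rewrite !opprD !opprK addrACA.
rewrite innerDl innerNl subr_ge0 inner_norm => pq.
have [->|pq0] := eqVneq (p - q) 0; first by rewrite normr0.
rewrite -(@ler_pM2r _ `|p - q|) ?normr_gt0// -expr2.
exact: le_trans pq (inner_le _ _).
Qed.

Lemma prox_nonexpansive (gamma : R) f x y : Gamma f -> 0 < gamma ->
  `|prox gamma f x - prox gamma f y| <= `|x - y|.
Proof.
move=> Gf g0; apply: (resolvent_nonexpansive g0); apply: subdiff_monotone;
  exact: prox_subdiff.
Qed.

End Subdifferential.

(** * Riesz representation, adjoints and gradients *)

Section RieszGradient.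
Context {R : realType}.
Implicit Types H K : hilbertType R.

(* The representative is the proximal point of - phi at 0. *)
Lemma riesz H (phi : H -> R) :
  (forall a u v, phi (a *: u + v) = a * phi u + phi v) -> continuous phi ->
  exists d, forall y, phi y = inner d y.
Proof.
move=> phil phic.
have phi0 : phi 0 = 0.
  by have := phil 1 0 0; rewrite scale1r addr0 mul1r => /eqP;
    rewrite -subr_eq0 opprD addNKr oppr_eq0 => /eqP.
have phiD u v : phi (u + v) = phi u + phi v.
  by rewrite -[u]scale1r phil mul1r scale1r.
have phiZ a u : phi (a *: u) = a * phi u by rewrite -[a *: u]addr0 phil phi0 addr0.
have Gphi : Gamma (EFin \o (fun y => - phi y)).
  apply: Gamma_real; first by move=> y; apply: cvgN; exact: phic.
  by move=> x y t _; rewrite phiD !phiZ; lra.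
have [r /= [pr] pd] := subdiff_le (@prox_subdiff _ _ 1 _ 0 Gphi ltr01).
set p := prox _ _ _ in pr pd; exists p => y.
have le1 u : phi u <= inner p u.
  have := pd (p + u) (- phi (p + u)) (lexx _).
  rewrite [p + u - p]addrC addKr invr1 scale1r sub0r innerNl phiD -pr; lra.
by apply/eqP; rewrite eq_le le1 -lerN2 -innerNr -mulN1r -phiZ scaleN1r le1.
Qed.

Section AdjointOperator.
Context {H K : hilbertType R} (L : {linear H -> K}).
Hypothesis Lc : continuous L.

Lemma adjointP x v : inner (L x) v = inner x (adjoint L v).
Proof.
move: x; apply: (@xgetPex _ 0 [set y | forall x, inner (L x) v = inner x y]).
have [||d dP] := @riesz H (fun x => inner (L x) v).
- by move=> a u w; rewrite linearP innerDl innerZl.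
- by move=> x; apply: cvg_inner; [exact: Lc|exact: cvg_cst].
- by exists d => x; rewrite dP innerC.
Qed.

Lemma adjointD u v : adjoint L (u + v) = adjoint L u + adjoint L v.
Proof.
by apply: inner_inj => x; rewrite !(innerC _ x) innerDr -!adjointP innerDr.
Qed.

Lemma adjointN v : adjoint L (- v) = - adjoint L v.
Proof.
by apply: inner_inj => x; rewrite !(innerC _ x) innerNr -!adjointP innerNr.
Qed.

Lemma opnorm_has_sup : has_sup [set `|L x| | x in [set x | `|x| <= 1]].
Proof.
split; first by exists `|L 0|, 0 => //=; rewrite normr0.
have /linear_bounded_continuous/linear_boundedP := Lc.
move=> [M [_ /(_ (`|M| + 1))]]; have := ler_norm M => M0 /(_ ltac:(lra)) LM.
exists (`|M| + 1) => _ [x /= x1 <-]; apply: le_trans (LM x) _.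
by rewrite ler_piMr// addr_ge0.
Qed.

Lemma opnorm_le x : `|L x| <= opnorm L * `|x|.
Proof.
have [->|x0] := eqVneq x 0; first by rewrite linear0 !normr0 mulr0.
rewrite -ler_pdivrMr ?normr_gt0// mulrC.
have := ub_le_sup (proj2 opnorm_has_sup); apply; exists (`|x|^-1 *: x) => /=.
  by rewrite normrZ normfV normr_id mulVf// normr_eq0.
by rewrite linearZ normrZ normfV normr_id.
Qed.

Lemma opnorm_ge0 : 0 <= opnorm L.
Proof.
apply: (ub_le_sup (proj2 opnorm_has_sup)).
by exists 0 => /=; rewrite ?normr0// linear0 normr0.
Qed.

End AdjointOperator.

Lemma grad_diff H (h : H -> R) x y : differentiable h x ->
  'd h x y = inner (grad h x) y.
Proof.
move=> hx; move: y.
apply: (@xgetPex _ 0 [set d | forall y, 'd h x y = inner d y]).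
apply: riesz; first by move=> a u v; rewrite linearP.
by apply: (diff_continuous hx).
Qed.

(** [grad] is a choice, so it has to be identified through the differential; a quadratic remainder
    determines the latter. The gradients of the conjugates are found in this way. *)
Lemma grad_unique H (h : H -> R) x d (C : R) :
  (forall y, `|h y - h x - inner d (y - x)| <= C * `|y - x| ^+ 2) ->
  grad h x = d.
Proof.
move=> hd; have dE : 'd h x = inner d :> (H -> R).
  have dc : continuous (inner d) by exact: continuous_inner.
  rewrite (@diff_unique R H R h (inner d) x dc)//.
  apply/eqaddoP => e e0 /=; near=> y.
  have := hd (y + x); rewrite addrK => hy.
  rewrite /= !fctE /cst/=.
  rewrite [X in `|X|](_ : _ = h (y + x) - h x - inner d y); last by rewrite opprD addrA.
  apply: le_trans hy _; rewrite expr2 mulrA ler_wpM2r//.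
  apply: (@le_trans _ _ ((`|C| + 1) * `|y|)).
    by rewrite ler_wpM2r// (le_trans (ler_norm _))// lerDl.
  have C0 : 0 < `|C| + 1 by rewrite ltr_wpDl.
  rewrite mulrC -ler_pdivlMr//; near: y.
  apply: (@cvgr0_norm_le _ _ _ (nbhs (0 : H)) _ id) => //.
  by rewrite divr_gt0.
rewrite /grad; case: xgetP => [d' _ /= d'P|/(_ d) /= []]; last by rewrite dE.
by apply: inner_inj => u; rewrite -d'P dE.
Unshelve. all: by end_near. Qed.

Lemma convex_grad_le H (h : H -> R) x y :
  (forall x y t, 0 < t < 1 ->
    h (t *: x + (1 - t) *: y) <= t * h x + (1 - t) * h y) ->
  differentiable h x -> h x + inner (grad h x) (y - x) <= h y.
Proof.
move=> hconv hx; rewrite -grad_diff//.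
have /diff_locallyP[_ /eqaddoP hd] := hx.
have [->|yx0] := eqVneq y x; first by rewrite subrr linear0 addr0.
have n0 : 0 < `|y - x| by rewrite normr_gt0 subr_eq0.
apply/ler_addgt0Pr => e e0.
(* With this relative error the remainder at [t *: (y - x)] is at most [e * t], which leaves [e]
   after division by [t]. *)
have /hd : 0 < e / `|y - x| by rewrite divr_gt0.
move=> /nbhs_ballP[d /= d0 hd'].
pose t := Num.min (2^-1) (d / 2 / `|y - x|).
have t0 : 0 < t by rewrite lt_min invr_gt0 ltr0n/= !divr_gt0.
have t1 : t < 1 by rewrite gt_min; apply/orP; left; lra.
have t01 : 0 < t < 1 by rewrite t0.
have td : t * `|y - x| < d.
  have : t <= d / 2 / `|y - x| by rewrite ge_min lexx orbT.
  by rewrite ler_pdivlMr// => /le_lt_trans; apply; lra.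
have := hd' (t *: (y - x)); rewrite -ball_normE/= sub0r normrN normrZ gtr0_norm//.
have dZ : 'd h x (t *: (y - x)) = t * 'd h x (y - x) by rewrite linearZ.
move=> /(_ td); rewrite !fctE /cst /= dZ.
have -> : t *: (y - x) + x = t *: y + (1 - t) *: x.
  by rewrite scalerBr scalerBl scale1r -addrA [_ + x]addrC.
have := hconv y x t t01; set k := h (_ + _); set D := 'd h x _ => hk.
have -> : e / `|y - x| * (t * `|y - x|) = e * t.
  by field; rewrite gt_eqF.
rewrite ler_norml => /andP[hD _].
rewrite -(ler_pM2l t0); move: hD; lra.
Qed.

End RieszGradient.

(** * Conjugates and strongly convex functions *)

Section Conjugate.
Context {R : realType} {H : hilbertType R}.
Implicit Types (f g l : H -> \bar R) (x y u v w : H).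

Lemma conjugate_leP f u (c : R) : (forall x, f x != -oo%E) ->
  (conjugate f u <= c%:E)%E <->
  (forall x r, f x = r%:E -> inner u x - r <= c).
Proof.
move=> fN; split=> [/ereal_supP fc x r fx|fc].
  by have := fc _ (imageT _ x); rewrite fx -EFinB lee_fin.
apply/ereal_supP => _ [x _ <-]; have := fN x.
case fx : (f x) => [r| |]// _; last by rewrite leNye.
by rewrite -EFinB lee_fin; exact: fc.
Qed.

Lemma conjugate_ge f u x (r : R) : f x = r%:E ->
  ((inner u x - r)%:E <= conjugate f u)%E.
Proof. by move=> fx; apply: ereal_sup_ubound; exists x => //; rewrite fx. Qed.

Lemma conjugate_subdiff f x u (r : R) : f x = r%:E -> subdiff f x u ->
  conjugate f u = (inner u x - r)%:E.
Proof.
move=> fx /subdiff_le[r']; rewrite fx => -[<-] fu.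
apply/eqP; rewrite eq_le conjugate_ge// andbT.
apply/conjugate_leP => [y|y s fy].
  have := fu y; case: (f y) => // /(_ (r + inner u (y - x) - 1)).
  by rewrite leNye => /(_ isT); rewrite lerDl oppr_ge0 ler10.
have := fu y s; rewrite fy => /(_ (lexx _)); rewrite !innerE; lra.
Qed.

Lemma subdiff_conjugate f x u : subdiff f x u -> subdiff (conjugate f) u x.
Proof.
move=> fu; have [r fx _] := subdiff_le fu.
have E := conjugate_subdiff fx fu; apply: (subdiffI E) => w s fw.
have : inner w x - r <= s by rewrite -lee_fin (le_trans (conjugate_ge w fx)).
by rewrite !innerE (innerC x w) (innerC x u); lra.
Qed.

Lemma Gamma_conjugate f : Gamma f -> Gamma (conjugate f).
Proof.
move=> Gf; have fN x := Gamma_Nninfty x Gf.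
have cN u : conjugate f u != -oo%E.
  have [x [r fx]] := Gamma_dom Gf; have := conjugate_ge u fx.
  by case: (conjugate f u).
have ple u (c : R) : (conjugate f u <= c%:E)%E <->
    (forall x r, f x = r%:E -> inner u x - r <= c) by exact: conjugate_leP.
apply: GammaI => //.
(* A subgradient of [f], here at a proximal point, lies in the domain of the conjugate. *)
- have ps := prox_subdiff 0 Gf ltr01; have [r fp _] := subdiff_le ps.
  exists (1^-1 *: (0 - prox 1 f 0)).
  by rewrite /edom/mkset (conjugate_subdiff fp ps) ltry.
- move=> u v a b t /andP[t0 t1] /ple fa /ple fb; apply/ple => x r fx.
  have : t * (inner u x - r) <= t * a by rewrite ler_pM2l// fa.
  have : (1 - t) * (inner v x - r) <= (1 - t) * b.
    by rewrite ler_pM2l ?subr_gt0// fb.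
  rewrite !innerE; lra.
(* A sublevel set of the conjugate is an intersection of closed half-spaces, one for each point of
   the graph of [f]. *)
- move=> a; rewrite (_ : mkset _ = \bigcap_(p in [set p : H * R | f p.1 = p.2%:E])
      (inner p.1 @^-1` [set s | s <= a + p.2])).
    apply: closed_bigI => -[x r] _ /=.
    have /continuous_closedP := @continuous_inner R H x.
    by apply; exact: closed_le.
  apply/seteqP; split=> u /=.
    by move=> /ple fa [x r] /= /fa; rewrite innerC lerBlDr.
  move=> fa; apply/ple => x r fx; rewrite lerBlDr innerC.
  exact: (fa (x, r)).
Qed.

(* Moreau's decomposition: p = prox f (u + x) satisfies u + x - p in the
   subdifferential of f at p, and monotonicity of the subdifferential of the
   conjugate forces p = x. *)
Lemma subdiff_conjugateK f x u : Gamma f -> subdiff (conjugate f) u x ->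
  subdiff f x u.
Proof.
move=> Gf fx; have := prox_subdiff (u + x) Gf ltr01.
set p := prox _ _ _; rewrite invr1 scale1r => fp.
have := subdiff_monotone fx (subdiff_conjugate fp).
have -> : u - (u + x - p) = - (x - p).
  by rewrite -addrA opprD addNKr.
rewrite innerNr oppr_ge0 inner_norm => xp.
have : x - p == 0.
  by rewrite -normr_eq0 -sqrf_eq0 eq_le xp exprn_ge0.
by rewrite subr_eq0 => /eqP xE; move: fp; rewrite -xE addrK.
Qed.

Section StronglyConvex.
Variables (l : H -> \bar R) (rho : R).
Hypotheses (Gl : Gamma l) (rho0 : 0 < rho) (lstrong : strongly_convex rho l).

(* Subtracting the quadratic part reduces strongly convex functions to
   proximal points: grad l^* u = prox (1/rho) unquad (u / rho). *)
Definition unquad : H -> \bar R := fun x => (l x + (- (rho / 2) * `|x| ^+ 2)%:E)%E.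

Let unquad_le x (a : R) : (unquad x <= a%:E)%E <->
  (l x <= (a + rho / 2 * `|x| ^+ 2)%:E)%E.
Proof.
have := Gamma_Nninfty x Gl; rewrite /unquad; case: (l x) => [r| |]//= _.
by rewrite -EFinD !lee_fin mulNr lerBlDr.
Qed.

(** By the identity [normr_sq_conv], the modulus of strong convexity is exactly the convexity defect
    of the quadratic that is subtracted. *)
Lemma Gamma_unquad : Gamma unquad.
Proof.
have lN x := Gamma_Nninfty x Gl.
have uN x : unquad x != -oo%E by rewrite adde_eq_ninfty negb_or lN.
split; first split => //.
- have [x [r lx]] := Gamma_dom Gl; exists x.
  by rewrite /edom /= /unquad lx -EFinD ltry.
- apply/econvexP => // x y a b t t01 /unquad_le lxa /unquad_le lyb.
  apply/unquad_le.
  have [r lx ra] := ereal_le_fin (lN x) lxa.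
  have [s ly sb] := ereal_le_fin (lN y) lyb.
  have [_ /(_ x y t)] := lstrong; rewrite /edom /= lx ly !ltry.
  move=> /(_ isT isT t01); have := lN (t *: x + (1 - t) *: y).
  case: (l (t *: x + _)) => [q| |]//= _; rewrite -!EFinM -!EFinD !lee_fin => h.
  rewrite normr_sq_conv.
  have /andP[t0 t1] := t01.
  have : t * r <= t * (a + rho / 2 * `|x| ^+ 2) by rewrite ler_pM2l.
  have : (1 - t) * s <= (1 - t) * (b + rho / 2 * `|y| ^+ 2).
    by rewrite ler_pM2l// subr_gt0.
  lra.
have [_ _ ll] := Gl; apply: lscD => //.
apply: lsc_real => x; apply: cvgMr.
by apply: cvg_normr_sq; exact: cvg_id.
Qed.

(** From left to right the two inequalities differ by the second-order term [rho / 2 * |y - x|^2],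
    which [subdiff_quad] removes; in the other direction this term has the favourable sign. *)
Lemma subdiff_unquad x u : subdiff l x u <-> subdiff unquad x (u - rho *: x).
Proof.
split=> [/subdiff_le[r lx lu]|/subdiff_le[r lx lu]].
  have ux : unquad x = (r + - (rho / 2) * `|x| ^+ 2)%:E.
    by rewrite /unquad lx.
  apply: (@subdiff_quad _ _ _ _ _ _ (rho / 2) Gamma_unquad ux) => y s.
  move=> /unquad_le /lu; rewrite -!inner_norm !innerE (innerC y x); lra.
have lxr : l x = (r + rho / 2 * `|x| ^+ 2)%:E.
  have := Gamma_Nninfty x Gl; move: lx; rewrite /unquad.
  by case: (l x) => //= q [<-] _; congr EFin; lra.
apply: (subdiffI lxr) => y s ly.
have : (unquad y <= (s - rho / 2 * `|y| ^+ 2)%:E)%E.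
  by apply/unquad_le; rewrite subrK.
move=> /lu; have := mulr_ge0 (ltW rho0) (inner_ge0 (y - x)).
rewrite -!inner_norm !innerE (innerC y x); lra.
Qed.

Let P u := prox rho^-1 unquad (rho^-1 *: u).

Let rhoV0 : 0 < rho^-1. Proof. by rewrite invr_gt0. Qed.

Let P_subdiff u : subdiff l (P u) u.
Proof.
apply/subdiff_unquad; have := prox_subdiff (rho^-1 *: u) Gamma_unquad rhoV0.
by rewrite invrK scalerBr scalerA divff ?gt_eqF// scale1r.
Qed.

Let P_unique x u : subdiff l x u -> x = P u.
Proof.
move=> /subdiff_unquad lx; apply: prox_unique => //; first exact: Gamma_unquad.
by rewrite invrK scalerBr scalerA divff ?gt_eqF// scale1r.
Qed.

Let P_lip u v : `|P u - P v| <= rho^-1 * `|u - v|.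
Proof.
apply: le_trans (prox_nonexpansive _ _ Gamma_unquad rhoV0) _.
by rewrite -scalerBr normrZ gtr0_norm.
Qed.

Let P_grad u : grad (fine \o conjugate l) u = P u.
Proof.
have cE w : exists2 r : R, l (P w) = r%:E &
    fine (conjugate l w) = inner w (P w) - r.
  have [r lP _] := subdiff_le (P_subdiff w).
  by exists r => //; rewrite (conjugate_subdiff lP (P_subdiff w)).
have cle w w' : fine (conjugate l w) + inner (P w) (w' - w)
    <= fine (conjugate l w').
  have [r lP ->] := cE w; have [r' lP' E'] := cE w'.
  have := conjugate_ge w' lP; rewrite (conjugate_subdiff lP' (P_subdiff w')).
  rewrite lee_fin -E' !innerE (innerC (P w)) (innerC (P w)); lra.
apply: (@grad_unique _ _ _ _ _ rho^-1) => w /=.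
have le1 := cle u w; have le2 := cle w u.
(* The subgradient inequalities at [u] and at [w] enclose the remainder of the linearization at [u]
   between 0 and this inner product. *)
have : inner (P w - P u) (w - u) <= rho^-1 * `|w - u| ^+ 2.
  apply: le_trans (inner_le _ _) _.
  by rewrite expr2 mulrA ler_wpM2r// P_lip.
move: le1 le2; rewrite ler_norml !innerE => *; apply/andP; split; last lra.
have : 0 <= rho^-1 * `|w - u| ^+ 2 by rewrite mulr_ge0 ?exprn_ge0// ltW.
lra.
Qed.

Lemma conjugate_grad_subdiff u : subdiff l (grad (fine \o conjugate l) u) u.
Proof. by rewrite P_grad. Qed.

Lemma conjugate_grad_unique x u : subdiff l x u ->
  x = grad (fine \o conjugate l) u.
Proof. by rewrite P_grad; exact: P_unique. Qed.

Lemma conjugate_grad_lipschitz u v :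
  `|grad (fine \o conjugate l) u - grad (fine \o conjugate l) v|
    <= rho^-1 * `|u - v|.
Proof. by rewrite !P_grad. Qed.

(** Strong convexity of [l] makes the function minimized in the infimal convolution a member of
    [Gamma] plus a quadratic, so [argmin_quad] applies as soon as some value is finite. *)
Lemma infconv_attained g y : Gamma g ->
  infconv g l y = +oo%E \/
  exists c (r s : R), [/\ g c = r%:E, l (y - c) = s%:E &
                         infconv g l y = (r + s)%:E].
Proof.
move=> Gg; have gN x := Gamma_Nninfty x Gg; have lN x := Gamma_Nninfty x Gl.
have [[c0 [gc0 lc0]]|/forallNP gl] :=
    pselect (exists c, edom g c /\ edom l (y - c)); last first.
  left; apply/eqP; rewrite -leye_eq; apply: le_ereal_inf_tmp => _ [c _ <-].
  have := gl c; have := gN c; have := lN (y - c); rewrite /edom/=.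
  case: (g c) (l (y - c)) => [r| |] [s| |]// _ _ ncl.
  by exfalso; apply: ncl; rewrite !ltry.
have aconv x x' (t : R) :
    y - (t *: x + (1 - t) *: x') = t *: (y - x) + (1 - t) *: (y - x').
  by rewrite !scalerBr addrACA -scalerDl [t + _]addrC subrK scale1r opprD.
have Gc : Gamma (unquad \o (fun c => y - c)).
  apply: Gamma_comp => //; first exact: Gamma_unquad.
    by move=> x; apply: cvgB; [exact: cvg_cst|exact: cvg_id].
  exists c0; move: lc0; rewrite /edom /= /unquad; have := lN (y - c0).
  by case: (l _) => // r _ _; rewrite -EFinD ltry.
have GF : Gamma (fun c => g c + unquad (y - c)%R)%E.
  apply: (GammaD Gg Gc); exists c0; split => //.
  move: lc0; rewrite /edom /= /unquad; have := lN (y - c0).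
  by case: (l _) => // r _ _; rewrite -EFinD ltry.
have rho20 : 0 < rho / 2 by rewrite divr_gt0.
have [c cmin] := argmin_quad y GF rho20.
have E c' : (g c' + unquad (y - c')%R + (rho / 2 * `|(c' - y)%R| ^+ 2)%:E =
    g c' + l (y - c')%R)%E.
  rewrite /unquad distrC; have := gN c'; have := lN (y - c').
  case: (g c') (l (y - c')) => [r| |] [s| |]//= _ _.
  by rewrite -!EFinD; congr EFin; lra.
have cm c' : (g c + l (y - c)%R <= g c' + l (y - c')%R)%E by rewrite -!E; exact: cmin.
right; have := gN c; have := lN (y - c); have := cm c0.
have : (g c0 + l (y - c0)%R < +oo)%E by exact: lte_add_pinfty.
case gc : (g c) => [r| |]//; case lc : (l (y - c)) => [s| |]//.
- move=> _ _ _ _; exists c, r, s; split => //; apply/eqP; rewrite eq_le.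
  apply/andP; split.
    by apply: ereal_inf_lbound; exists c => //; rewrite gc lc.
  by apply: le_ereal_inf_tmp => _ [c' _ <-]; have := cm c'; rewrite gc lc.
- by move=> /lt_geF h; rewrite addey// h.
- by move=> /lt_geF h; rewrite addye// h.
- by move=> /lt_geF h; rewrite addye// h.
Qed.

End StronglyConvex.

End Conjugate.

(** * Weak limits along ultrafilters *)

Section WeakLimits.
Context {R : realType}.

Lemma fmap_ultra {T U : Type} (f : T -> U) (F : set_system T) :
  UltraFilter F -> UltraFilter (f @ F).
Proof.
move=> FU; split; first exact: fmap_proper_filter.
move=> G GF FG; apply/seteqP; split => // A GA.
have [//|FA] := in_ultra_setVsetC (f @^-1` A) FU.
have /FG GA' : (f @ F) (~` A) by exact: FA.
have [] : (set0 : set U) !=set0 by apply: (@filter_ex _ G); rewrite -(setICr A); exact: filterI.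
by [].
Qed.

Lemma ultra_bounded_cvg {T : Type} (U : set_system T) (a : T -> R) (M : R) :
  UltraFilter U -> (\forall n \near U, `|a n| <= M) ->
  exists2 l : R, a @ U --> l & `|l| <= M.
Proof.
move=> UU aM; have := @segment_compact R (- M) M; rewrite compact_ultra.
have aU := fmap_ultra a UU => /(_ _ aU) []; last first.
  move=> l [lM al]; exists l => //.
  by move: lM; rewrite /= in_itv/= ler_norml.
rewrite /nbhs/=; apply: filterS aM => n.
by rewrite /= in_itv/= ler_norml.
Qed.

(** If the preimage of a neighbourhood were not in [F], its complement would be compatible with [F],
    and an ultrafilter containing both would contradict the hypothesis. *)
Lemma cvg_ultraP {T : Type} (F : set_system T) (a : T -> R) (l : R) :
  ProperFilter F ->
  (forall U, UltraFilter U -> F `<=` U -> a @ U --> l) -> a @ F --> l.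
Proof.
move=> FF aU A Al; apply: contrapT => nFA.
have GF : ProperFilter (within (~` (a @^-1` A)) F).
  apply: Build_ProperFilter_ex => B FB.
  apply: contrapT => /forallNP nB; apply: nFA; rewrite /nbhs/=.
  have {}FB : F (fun n => (~` (a @^-1` A)) n -> B n) by exact: FB.
  apply: filterS FB => n Bn.
  by apply: contrapT => /Bn /nB.
have [U [UU GU]] := ultraFilterLemma GF.
have FU : F `<=` U by move=> B FB; apply: GU; exact: (@cvg_within _ F _ _ B FB).
have UA : U (a @^-1` A) by exact: aU FU _ Al.
have UnA : U (~` (a @^-1` A)) by apply: GU; exact: withinT.
have [n [An]] := @filter_ex _ U _ _ (filterI UA UnA).
by apply.
Qed.

Context {H : hilbertType R}.
Implicit Types (z : nat -> H) (U : set_system nat).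

(** The limits of the inner products along [U] form a bounded linear functional, and [x] is its
    Riesz representative. *)
Lemma ultra_weak_limit U z (M : R) : UltraFilter U ->
  (\forall n \near U, `|z n| <= M) ->
  exists x, forall u, (fun n => inner (z n) u) @ U --> inner x u.
Proof.
move=> UU zM.
have bnd u : \forall n \near U, `|inner (z n) u| <= M * `|u|.
  apply: filterS zM => n zn; apply: le_trans (inner_norm_le _ _) _.
  by rewrite ler_wpM2r.
have /choice[phi phiP] u : exists l : R,
    (fun n => inner (z n) u) @ U --> l /\ `|l| <= M * `|u|.
  by have [l zl lM] := ultra_bounded_cvg UU (bnd u); exists l.
have phil a u v : phi (a *: u + v) = a * phi u + phi v.
  have [c _] := phiP (a *: u + v); have [cu _] := phiP u.
  have [cv _] := phiP v; apply: (norm_cvg_unique c) => /=.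
  rewrite (_ : (fun n => _) = (fun n => a * inner (z n) u + inner (z n) v)).
    by apply: cvgD => //; exact: cvgMr.
  by apply: funext => n; rewrite innerDr innerZr.
have phic : continuous phi.
  apply: (@bounded_continuous _ _ _ _ M) => u v.
  have -> : phi u - phi v = phi ((-1) *: v + u) by rewrite phil; lra.
  by have [_ /le_trans] := phiP ((-1) *: v + u); apply; rewrite scaleN1r addrC.
have [x xP] := riesz phil phic.
by exists x => u; rewrite -xP; have [] := phiP u.
Qed.

(* Two ultrafilter limits x and y agree because <z_n, x - y> converges along
   the whole sequence. *)
Lemma opial z (S : set H) : S !=set0 ->
  (forall s, S s -> cvg ((fun n => `|z n - s| ^+ 2) @ \oo)) ->
  (forall U x, UltraFilter U -> \oo `<=` U ->
     (forall u, (fun n => inner (z n) u) @ U --> inner x u) -> S x) ->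
  exists2 x, S x & weakly_cvg z x.
Proof.
move=> [s0 Ss0] zS zU.
have [M zM] : exists M : R, \forall n \near \oo, `|z n| <= M.
  exists (Num.sqrt (limn (fun n => `|z n - s0| ^+ 2) + 1) + `|s0|).
  near=> n; rewrite -{1}(subrK s0 (z n)); apply: le_trans (ler_normD _ _) _.
  rewrite lerD2r -(ger0_norm (normr_ge0 (z n - s0))) -sqrtr_sqr.
  apply: ler_wsqrtr; near: n.
  by apply: (cvgr_le _ (zS _ Ss0)); rewrite ltrDl.
have limU U : UltraFilter U -> \oo `<=` U -> exists2 x, S x &
    forall u, (fun n => inner (z n) u) @ U --> inner x u.
  move=> UU ooU; have [x xP] := ultra_weak_limit UU (ooU _ zM).
  by exists x => //; exact: zU xP.
have [U0 [UU0 ooU0]] := @ultraFilterLemma nat \oo _.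
have [x Sx xP] := limU _ UU0 ooU0.
exists x => // u; apply: cvg_ultraP => U UU ooU.
have [y Sy yP] := limU _ UU ooU.
suff -> : x = y by exact: yP.
pose c := (`|x| ^+ 2 - `|y| ^+ 2) / 2.
have /cvg_ex[l lP] : cvg ((fun n => inner (z n) (x - y)) @ \oo).
  rewrite (_ : (fun n => _) = (fun n =>
      ((`|z n - y| ^+ 2 - `|z n - x| ^+ 2) / 2 + c))); last first.
    by apply: funext => n; rewrite /c !normr_sqB innerDr innerNr; field.
  apply: is_cvgD; last exact: is_cvg_cst.
  by apply: is_cvgMl; apply: is_cvgB; apply: zS.
have xl : inner x (x - y) = l.
  by apply: (norm_cvg_unique (xP _)) => A /lP; exact: ooU0.
have yl : inner y (x - y) = l.
  by apply: (norm_cvg_unique (yP _)) => A /lP; exact: ooU.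
apply/eqP; rewrite -subr_eq0 -normr_eq0 -sqrf_eq0 -inner_norm.
by rewrite innerDl innerNl xl yl subrr.
Unshelve. all: by end_near. Qed.

End WeakLimits.

(** * Inertial forward-backward-forward iterations *)

Section RealSequences.
Context {R : realType}.
Implicit Types u a : nat -> R.

Lemma bounded_series_cvg0 u (C : R) : (forall n, 0 <= u n) ->
  (forall n, \sum_(0 <= k < n) u k <= C) -> u @ \oo --> (0 : R).
Proof.
move=> u0 uC; apply: cvg_series_cvg_0; apply: nondecreasing_is_cvgn.
  apply/nondecreasing_seqP => n; rewrite /series/= big_nat_recr//= lerDl.
  exact: u0.
by exists C => _ [n _ <-]; exact: uC.
Qed.

Lemma sum_nat_telescope_le u a n : (forall k, u k <= a k - a k.+1) ->
  \sum_(0 <= k < n) u k <= a 0%N - a n.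
Proof.
move=> ua; elim: n => [|n IH]; first by rewrite big_nil subrr.
by rewrite big_nat_recr//=; have := ua n; lra.
Qed.

(* The Lyapunov function of the inertial iteration is
   phi_(n+1) - a_n phi_n + kappa d_n with kappa = 2 al + 3 al2^2: the constants
   are such that it decreases by at least sigma d_(n+1), where phi_n, d_n and
   e_n stand for |z_n - s|^2, |z_(n+1) - z_n|^2 and |p_(n+1) - z_(n+1)|^2. *)
Lemma inertial_descent (phi d e a a2 L : nat -> R) (al al2 sigma : R) :
  0 < sigma -> 0 <= al2 -> 12 * al2 ^+ 2 + 9 * al + 4 * sigma < 1 ->
  (forall n, 0 <= phi n) -> (forall n, 0 <= d n) -> (forall n, 0 <= e n) ->
  a 0%N = 0 -> (forall n, a n <= a n.+1) -> (forall n, 0 <= a n <= al) ->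
  (forall n, 0 <= a2 n <= al2) ->
  (forall n, 0 <= L n) ->
  (forall n, L n * (12 * al2 ^+ 2 + 8 * al + 4 * sigma + 2) <=
     1 - 12 * al2 ^+ 2 - 9 * al - 4 * sigma) ->
  (forall n, phi n.+2 <= phi n.+1 + a n * (phi n.+1 - phi n)
     + (2 * a n + 2 * a2 n ^+ 2) * d n - (1 - a n - 2 * L n) * e n) ->
  (forall n, d n.+1 <= 4 * (1 + L n) * e n + 2 * a2 n ^+ 2 * d n) ->
  [/\ exists C, forall n, \sum_(0 <= k < n) d k <= C,
      exists C, forall n, \sum_(0 <= k < n) e k <= C,
      exists C, forall n, phi n <= C &
      cvg ((fun n => phi n.+1 - a n * phi n) @ \oo)].
Proof.
move=> sigma0 al20 alsig phi0 d0 e0 a0 a_nd a_le a2_le L0 Lle Hphi Hd.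
pose kappa := 2 * al + 3 * al2 ^+ 2.
have al0 : 0 <= al by have /andP[h1 h2] := a_le 0%N; exact: le_trans h2.
have q0 : 0 <= al2 ^+ 2 by rewrite exprn_ge0.
have kappa0 : 0 <= kappa by rewrite /kappa; lra.
have a2q n : 0 <= a2 n ^+ 2 <= al2 ^+ 2.
  have /andP[h0 h1] := a2_le n; rewrite exprn_ge0//=.
  by rewrite ler_pXn2r// nnegrE.
(* This inequality is the origin of the constants: solved for [L n], with
   [4 * kappa = 8 * al + 12 * al2 ^+ 2] and [a n] replaced by its bound [al], it is the hypothesis
   on [L]. *)
have coef n : 4 * (kappa + sigma) * (1 + L n) <= 1 - a n - 2 * L n.
  have /andP[_ h1] := a_le n; have := Lle n; rewrite /kappa; lra.
have low n : 4 * sigma <= 1 - a n - 2 * L n.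
  apply: le_trans (coef n).
  have : 0 <= (kappa + sigma) * L n by rewrite mulr_ge0// addr_ge0// ltW.
  lra.
have drift n : (2 * a n + 2 * a2 n ^+ 2) * d n <= kappa * d n.
  apply: ler_wpM2r => //; have /andP[_ h1] := a_le n; have /andP[_ h2] := a2q n.
  by rewrite /kappa; lra.
pose nu n := phi n.+1 - a n * phi n + kappa * d n.
have a_phi n : a n * phi n.+1 <= a n.+1 * phi n.+1 by rewrite ler_wpM2r.
have nuS n : nu n.+1 + sigma * d n.+1 <= nu n.
  have ks : 0 <= kappa + sigma by rewrite addr_ge0// ltW.
  have c1 : 4 * (kappa + sigma) * (1 + L n) * e n <= (1 - a n - 2 * L n) * e n.
    by rewrite ler_wpM2r.
  have c2 : (kappa + sigma) * d n.+1 <=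
      (kappa + sigma) * (4 * (1 + L n) * e n + 2 * a2 n ^+ 2 * d n).
    by rewrite ler_wpM2l.
  (* Since [2 * (kappa + sigma) <= 1], the last summand costs at most one further [al2 ^+ 2]; hence
     the coefficient 3 in [kappa]. *)
  have c3 : (2 * a n + 2 * a2 n ^+ 2 + 2 * (kappa + sigma) * a2 n ^+ 2) * d n
      <= kappa * d n.
    apply: ler_wpM2r => //; have /andP[_ h1] := a_le n.
    have /andP[g0 g1] := a2q n.
    have : 2 * (kappa + sigma) * a2 n ^+ 2 <= a2 n ^+ 2.
      rewrite -[leRHS]mul1r ler_wpM2r//; rewrite /kappa; lra.
    have kE : kappa = 2 * al + 3 * al2 ^+ 2 by [].
    lra.
  have := Hphi n; have := a_phi n; rewrite /nu; lra.
have nu_dec n : nu n.+1 <= nu n.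
  apply: le_trans (nuS n); rewrite lerDl mulr_ge0// ltW//.
have nu_le n : nu n <= nu 0%N.
  by elim: n => // n IH; exact: le_trans (nu_dec n) IH.
have al1 : al <= 2^-1 by lra.
(* As [a n <= 1/2], a bound [M] on [phi n] gives [phi n.+1 <= nu 0 + M / 2], and this is at most [M]
   for the present choice. *)
pose M := phi 0%N + 2 * nu 0%N.
have nu0 : 0 <= nu 0%N.
  by rewrite /nu a0 mul0r subr0 addr_ge0// mulr_ge0.
have phiM n : phi n <= M.
  elim: n => [|n IH]; first by rewrite lerDl mulr_ge0.
  have : kappa * d n >= 0 by rewrite mulr_ge0.
  have : a n * phi n <= 2^-1 * M.
    have /andP[h0 h1] := a_le n.
    by apply: ler_pM => //; exact: le_trans h1 al1.
  have := nu_le n; rewrite {1}/nu; have := phi0 0%N; rewrite /M; lra.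
have aphiM n : a n * phi n <= M.
  have /andP[h0 h1] := a_le n; apply: le_trans (phiM n).
  rewrite -[leRHS]mul1r ler_wpM2r//; lra.
have nuM n : - M <= nu n.
  rewrite /nu; have := aphiM n; have := phi0 n.+1.
  have : kappa * d n >= 0 by rewrite mulr_ge0.
  lra.
have dS n : \sum_(0 <= k < n) d k.+1 <= sigma^-1 * (nu 0%N + M).
  have : \sum_(0 <= k < n) sigma * d k.+1 <= nu 0%N - nu n.
    by apply: sum_nat_telescope_le => k; have := nuS k; lra.
  rewrite -mulr_sumr => h; rewrite mulrC ler_pdivlMr// mulrC.
  by apply: le_trans h _; rewrite lerD2l lerNl.
have dC n : \sum_(0 <= k < n) d k <= d 0%N + sigma^-1 * (nu 0%N + M).
  apply: (@le_trans _ _ (\sum_(0 <= k < n.+1) d k)).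
    by rewrite big_nat_recr//= lerDl.
  by rewrite big_nat_recl//= lerD2l.
set Cd := d 0%N + _ in dC.
split; first by exists Cd.
- exists ((4 * sigma)^-1 * (phi 1%N + M + kappa * Cd)) => n.
  have s4 : 0 < 4 * sigma by rewrite mulr_gt0.
  rewrite mulrC ler_pdivlMr// mulr_suml.
  have : \sum_(0 <= k < n) (e k * (4 * sigma) - kappa * d k) <=
      (phi 1%N - a 0%N * phi 0%N) - (phi n.+1 - a n * phi n).
    apply: (@sum_nat_telescope_le _ (fun n => phi n.+1 - a n * phi n)) => k.
    have := Hphi k; have := drift k; have := a_phi k.
    have : 4 * sigma * e k <= (1 - a k - 2 * L k) * e k by rewrite ler_wpM2r.
    lra.
  rewrite sumrB -mulr_sumr a0 mul0r subr0.
  have : kappa * (\sum_(0 <= k < n) d k) <= kappa * Cd by rewrite ler_wpM2l.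
  have := aphiM n; have := phi0 n.+1; lra.
- by exists M.
have dcvg : d @ \oo --> (0 : R) by exact: bounded_series_cvg0 dC.
have nucvg : cvg (nu @ \oo).
  apply: nonincreasing_is_cvgn; first exact/nonincreasing_seqP.
  by exists (- M) => _ [n _ <-].
rewrite (_ : (fun n => _) = (fun n => nu n - kappa * d n)).
  apply: is_cvgB => //; apply: is_cvgMr; apply/cvg_ex; by exists 0.
by apply: funext => n; rewrite /nu addrK.
Qed.

End RealSequences.

(** * Energy estimates for one step of the iteration *)

Section InertialForwardBackwardForward.
Context {R : realType} {K : hilbertType R}.
Variables (A : K -> set K) (B : K -> K) (beta : R).
Hypothesis A_mono : forall x y u v, A x u -> A y v -> 0 <= inner (u - v) (x - y).
Hypothesis B_mono : forall x y, 0 <= inner (B x - B y) (x - y).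
Hypothesis beta0 : 0 < beta.
Hypothesis B_lip : forall x y, `|B x - B y| <= beta * `|x - y|.

(** Everything is written in P = p - z, Z = z - s, D = z - zm and E = lam (B z - B p). Monotonicity
    of A + B between [p] and [s] controls the cross terms, the Lipschitz bound controls E, and 2 <Z,
    D> produces the difference of squared distances to [s]; what remains is linear in the entries of
    the Gram matrix. *)
Lemma inertial_step (lam a1 a2 : R) (zm z p zp s : K) :
  0 < lam -> 0 <= a1 -> 0 <= a2 ->
  A p (lam^-1 *: (z - lam *: B z + a1 *: (z - zm) - p)) ->
  zp = p + lam *: (B z - B p) + a2 *: (z - zm) ->
  A s (- B s) ->
  let L := (lam * beta) ^+ 2 in
  `|zp - s| ^+ 2 <= `|z - s| ^+ 2
    + (a1 + a2) * (`|z - s| ^+ 2 - `|zm - s| ^+ 2)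
    + (2 * (a1 + a2) + 2 * a2 ^+ 2) * `|z - zm| ^+ 2
    - (1 - (a1 + a2) - 2 * L) * `|p - z| ^+ 2 /\
  `|zp - z| ^+ 2 <= 4 * (1 + L) * `|p - z| ^+ 2 + 2 * a2 ^+ 2 * `|z - zm| ^+ 2.
Proof.
move=> lam0 a10 a20 Ap zpE As L.
pose P := p - z; pose Z := z - s; pose D := z - zm; pose E := lam *: (B z - B p).
have F1 : 0 <= inner (- P + a1 *: D - E) (P + Z).
  have h1 := A_mono Ap As; have h2 := B_mono p s.
  have PZ : P + Z = p - s by rewrite /P /Z addrA subrK.
  have -> : - P + a1 *: D - E =
      lam *: (lam^-1 *: (z - lam *: B z + a1 *: (z - zm) - p) - - B s)
      + lam *: (B p - B s).
    apply: inner_inj => u; rewrite /P /E /D !innerE; field.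
    by rewrite gt_eqF.
  rewrite PZ innerDl !innerZl addr_ge0// mulr_ge0// ltW//.
have F2 : inner E E <= L * inner P P.
  have EP : `|E| <= lam * beta * `|P|.
    by rewrite normrZ gtr0_norm// -mulrA ler_wpM2l ?(ltW lam0)// /P distrC.
  rewrite !inner_norm /L -exprMn ler_pXn2r ?nnegrE//.
  by rewrite !mulr_ge0// ltW.
(* Young's inequalities as nonnegative squares: the first two bound <P, D> and a2 <E, D> in the
   distance estimate, the last two split the square of P + E + a2 D in the step estimate. *)
have Y1 := inner_ge0 (P - D); have Y2 := inner_ge0 (E - a2 *: D).
have Y3 := inner_ge0 (P - E); have Y4 := inner_ge0 (P + E - a2 *: D).
have a12 : 0 <= (a1 + a2) * inner (P - D) (P - D).
  by rewrite mulr_ge0// addr_ge0.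
have -> : zp - s = Z + P + E + a2 *: D.
  by apply: inner_inj => u; rewrite zpE /Z /P /E /D !innerE; ring.
have -> : zp - z = P + E + a2 *: D.
  by apply: inner_inj => u; rewrite zpE /P /E /D !innerE; ring.
have -> : zm - s = Z - D.
  by apply: inner_inj => u; rewrite /Z /D !innerE; ring.
rewrite -/P -/Z -/D -!inner_norm.
clearbody P Z D E; move: F1 F2 Y1 Y2 Y3 Y4 a12; rewrite !innerE.
rewrite (innerC Z P) (innerC E P) (innerC D P) (innerC E Z) (innerC D Z) (innerC D E).
move: (inner P P) (inner P Z) (inner P E) (inner P D) (inner Z Z) (inner Z E)
  (inner Z D) (inner E E) (inner E D) (inner D D) => PP PZ PE PD ZZ ZE ZD EE ED DD.
move=> F1 F2 Y1 Y2 Y3 Y4 a12; split; lra.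
Qed.

End InertialForwardBackwardForward.

(** * Summability, weak limits and the residual of the iteration *)

Section InertialConvergence.
Context {R : realType} {K : hilbertType R}.
Variables (A : K -> set K) (B : K -> K) (beta : R).
Hypothesis A_mono : forall x y u v, A x u -> A y v -> 0 <= inner (u - v) (x - y).
Hypothesis A_res : forall (gamma : R) x, 0 < gamma ->
  exists p, A p (gamma^-1 *: (x - p)).
Hypothesis B_mono : forall x y, 0 <= inner (B x - B y) (x - y).
Hypothesis beta0 : 0 < beta.
Hypothesis B_lip : forall x y, `|B x - B y| <= beta * `|x - y|.

(** Surjectivity of id + gamma (A + B) for gamma = 1/(2 beta), the form in which maximal
    monotonicity enters. With this gamma the map y -> J (x - gamma B y), where J is the resolvent of
    gamma A, is a contraction of factor 1/2. *)
Lemma shifted_resolvent x : exists y,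
  A y ((2 * beta)^-1^-1 *: (x - (2 * beta)^-1 *: B y - y)).
Proof.
pose gamma := (2 * beta)^-1; have g0 : 0 < gamma by rewrite invr_gt0 mulr_gt0.
have /choice[J JP] u : exists p, A p (gamma^-1 *: (u - p)) by exact: A_res.
pose F y := J (x - gamma *: B y).
have F_lip y y' : `|F y - F y'| <= 2^-1 * `|y - y'|.
  apply: le_trans (resolvent_nonexpansive g0 (A_mono (JP _) (JP _))) _.
  have -> : x - gamma *: B y - (x - gamma *: B y') = gamma *: (B y' - B y).
    by apply: inner_inj => u; rewrite !innerE; ring.
  rewrite normrZ gtr0_norm//.
  have -> : 2^-1 * `|y - y'| = gamma * (beta * `|y' - y|).
    by rewrite distrC /gamma; field; rewrite gt_eqF.
  by rewrite ler_wpM2l// ltW.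
have h0 : 0 <= (2^-1 : R) by rewrite invr_ge0.
have FT : {homo F : u / [set: K] u >-> [set: K] u} by [].
have Fctr : is_contraction (mkfun_fun FT).
  exists (NngNum h0); split => /=; first by lra.
  by move=> [y y'] _ /=; exact: F_lip.
have [y _ yE] := banach_fixed_point Fctr closedT (ex_intro _ x I).
have yJ : y = J (x - gamma *: B y) by exact: yE.
by exists y; have := JP (x - gamma *: B y); rewrite -yJ.
Qed.

(* Minty's trick: test monotonicity against y with x - y proportional to an
   element of (A + B) y. *)
Lemma zero_of_weak_limit (U : set_system nat) (p w : nat -> K) (M : R) x :
  ProperFilter U -> (forall n, A (p n) (w n - B (p n))) ->
  (\forall n \near U, `|p n| <= M) -> w @ U --> (0 : K) ->
  (forall u, (fun n => inner (p n) u) @ U --> inner x u) -> A x (- B x).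
Proof.
move=> UU Ap pM w0 px; have [y Ay] := shifted_resolvent x.
set gamma := (2 * beta)^-1 in Ay; have g0 : 0 < gamma by rewrite invr_gt0 mulr_gt0.
have mono n : 0 <= inner (w n) (p n - y)
    - gamma^-1 * (inner (p n) (x - y) - inner y (x - y)).
  have h1 := A_mono (Ap n) Ay; have h2 := B_mono (p n) y.
  have -> : inner (w n) (p n - y) - gamma^-1 *
      (inner (p n) (x - y) - inner y (x - y)) =
      inner (w n - B (p n) - gamma^-1 *: (x - gamma *: B y - y)) (p n - y)
      + inner (B (p n) - B y) (p n - y).
    rewrite !innerE (innerC x (p n)) (innerC y (p n)) (innerC x y).
    by field; rewrite gt_eqF.
  exact: addr_ge0.
have wp0 : (fun n => inner (w n) (p n - y)) @ U --> (0 : R).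
  apply: (cvg0_inner (M := M + `|y|)) => //; apply: filterS pM => n pn.
  by apply: le_trans (ler_normB _ _) _; rewrite lerD2r.
have lim : (fun n => inner (w n) (p n - y)
    - gamma^-1 * (inner (p n) (x - y) - inner y (x - y))) @ U -->
    0 - gamma^-1 * (inner x (x - y) - inner y (x - y)).
  apply: cvgB => //; apply: cvgMr; apply: cvgB; first exact: px.
  exact: cvg_cst.
(* In the limit monotonicity reads [0 <= - gamma^-1 * |x - y|^2], so [x = y]. *)
have : 0 <= 0 - gamma^-1 * (inner x (x - y) - inner y (x - y)).
  by apply: (closed_cvg _ (@closed_ge R 0) _ _ lim); exact: nearW.
have gV0 : 0 < gamma^-1 by rewrite invr_gt0.
rewrite sub0r oppr_ge0 pmulr_rle0// -innerNl -innerDl inner_norm => xy.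
have /eqP xE : x == y by rewrite -subr_eq0 -normr_eq0 -sqrf_eq0 eq_le xy exprn_ge0.
move: Ay; rewrite -xE [x - _ - x]addrAC subrr sub0r scalerN scalerA mulVf ?gt_eqF//.
by rewrite scale1r.
Qed.

Variables (z p : nat -> K) (lambda al1 al2 sigma : R) (lam a1 a2 : nat -> R).
Hypotheses (lambda0 : 0 < lambda) (sigma0 : 0 < sigma).
Hypothesis al20 : 0 <= al2.
Hypothesis al_sigma : 12 * al2 ^+ 2 + 9 * (al1 + al2) + 4 * sigma < 1.
Hypothesis lam_ge : forall n, lambda <= lam n.+1.
Hypothesis lam_le : forall n,
  (lam n.+1 * beta) ^+ 2 * (12 * al2 ^+ 2 + 8 * (al1 + al2) + 4 * sigma + 2) <=
  1 - 12 * al2 ^+ 2 - 9 * (al1 + al2) - 4 * sigma.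
Hypotheses (a11 : a1 1%N = 0) (a21 : a2 1%N = 0).
Hypotheses (a1_nd : forall n, a1 n.+1 <= a1 n.+2)
           (a2_nd : forall n, a2 n.+1 <= a2 n.+2).
Hypotheses (a1_le : forall n, 0 <= a1 n.+1 <= al1)
           (a2_le : forall n, 0 <= a2 n.+1 <= al2).
Hypothesis Hp : forall n, A (p n.+1) ((lam n.+1)^-1 *: (z n.+1
  - lam n.+1 *: B (z n.+1) + a1 n.+1 *: (z n.+1 - z n) - p n.+1)).
Hypothesis Hz : forall n, z n.+2 = p n.+1 + lam n.+1 *: (B (z n.+1) - B (p n.+1))
  + a2 n.+1 *: (z n.+1 - z n).

Let lam0 n : 0 < lam n.+1. Proof. exact: lt_le_trans (lam_ge n). Qed.

Lemma inertial_fejer s : A s (- B s) ->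
  [/\ exists C, forall n, \sum_(0 <= k < n) `|z k.+1 - z k| ^+ 2 <= C,
      exists C, forall n, \sum_(0 <= k < n) `|p k.+1 - z k.+1| ^+ 2 <= C &
      cvg ((fun n => `|z n - s| ^+ 2) @ \oo)].
Proof.
move=> As; pose phi n := `|z n - s| ^+ 2; pose a n := a1 n.+1 + a2 n.+1.
have step n := inertial_step A_mono B_mono beta0 B_lip (lam0 n)
  (proj1 (andP (a1_le n))) (proj1 (andP (a2_le n))) (Hp n) (Hz n) As.
have a_le n : 0 <= a n <= al1 + al2.
  have /andP[h1 h2] := a1_le n; have /andP[h3 h4] := a2_le n.
  by rewrite addr_ge0//= lerD.
have a_nd n : a n <= a n.+1 by rewrite lerD.
have [||||||||||||||dC eC [C phiC] phic] := @inertial_descent R phi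
    (fun n => `|z n.+1 - z n| ^+ 2) (fun n => `|p n.+1 - z n.+1| ^+ 2)
    a (fun n => a2 n.+1) (fun n => (lam n.+1 * beta) ^+ 2)
    (al1 + al2) al2 sigma => //; try by move=> n; exact: sqr_ge0.
- by rewrite /a a11 a21 addr0.
- by move=> n; have [h1 _] := step n.
- by move=> n; have [_ h2] := step n.
split => //; rewrite -/phi.
have [a8 aP] : exists2 a8 : R, a @ \oo --> a8 & a8 <= al1 + al2.
  have aub : has_ubound (range a).
    by exists (al1 + al2) => _ [n _ <-]; case/andP: (a_le n).
  have ac : cvg (a @ \oo).
    by apply: nondecreasing_is_cvgn => //; exact/nondecreasing_seqP.
  exists (limn a) => //; apply: limr_le => //.
  by apply: nearW => n; case/andP: (a_le n).
move=> a8_le; have a8_lt : 0 < 1 - a8.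
  have : 0 <= al2 ^+ 2 by rewrite exprn_ge0.
  by move: al_sigma sigma0; lra.
have dphi : (fun n => phi n.+1 - phi n) @ \oo --> (0 : R).
  have d0 : (fun n => `|z n.+1 - z n|) @ \oo --> (0 : R).
    have [Cd dCd] := dC; rewrite -(@normr0 _ K); apply: cvg_norm.
    by apply: sq_cvg0; exact: bounded_series_cvg0 dCd.
  have rC n : `|z n - s| <= Num.sqrt C.
    by rewrite -(ger0_norm (normr_ge0 (z n - s))) -sqrtr_sqr ler_wsqrtr//;
      exact: phiC.
  apply/cvgr0Pnorm_le => e e0; near=> n.
  apply: (@le_trans _ _ (`|z n.+1 - z n| * (2 * Num.sqrt C + 1))).
    have -> : phi n.+1 - phi n = inner (z n.+1 - z n) ((z n.+1 - s) + (z n - s)).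
      rewrite /phi -!inner_norm !innerE (innerC (z n) (z n.+1)).
      by rewrite (innerC s (z n)) (innerC s (z n.+1)); ring.
    apply: le_trans (inner_norm_le _ _) _; rewrite ler_wpM2l//.
    have := ler_normD (z n.+1 - s) (z n - s); have := rC n; have := rC n.+1; lra.
  rewrite -ler_pdivlMr ?ltr_wpDl ?mulr_ge0 ?sqrtr_ge0//.
  rewrite -[leLHS]normr_id; near: n; apply: cvgr0_norm_le => //.
  by rewrite divr_gt0// ltr_wpDl ?mulr_ge0 ?sqrtr_ge0.
(* Both differences in the numerator converge, the second one to 0, and the denominators [1 - a n]
   tend to [1 - a8], which is positive. *)
rewrite (_ : phi = (fun n => ((phi n.+1 - a n * phi n) - (phi n.+1 - phi n))
    * (1 - a n)^-1)); last first.
  apply: funext => n; have /andP[h1 h2] := a_le n.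
  have : 0 <= al2 ^+ 2 by rewrite exprn_ge0.
  move: al_sigma sigma0 => h3 h4 h5.
  have [e|] := eqVneq (1 - a n) 0; first by exfalso; lra.
  by move=> h *; field.
apply: is_cvgM.
  by apply: is_cvgB => //; apply/cvg_ex; exists 0.
apply/cvg_ex; exists (1 - a8)^-1; apply: cvgV; first by rewrite gt_eqF.
by apply: cvgB => //; exact: cvg_cst.
Unshelve. all: by end_near. Qed.

(** The element of (A + B) at [p n.+1] produced by the proximal step. As the step sizes are at least
    [lambda], it is controlled by the two vanishing differences p - z and z_(n+1) - z_n. *)
Definition residual n : K := (lam n.+1)^-1 *: (z n.+1 - p n.+1
  + a1 n.+1 *: (z n.+1 - z n)) - (B (z n.+1) - B (p n.+1)).

Lemma residual_in n : A (p n.+1) (residual n - B (p n.+1)).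
Proof.
have := Hp n; congr (A _ _); apply: inner_inj => u.
by rewrite /residual !innerE; field; rewrite gt_eqF.
Qed.

Lemma inertial_convergence : (exists s, A s (- B s)) ->
  [/\ exists C, forall n, \sum_(0 <= k < n) `|z k.+1 - z k| ^+ 2 <= C,
      exists C, forall n, \sum_(0 <= k < n) `|p k.+1 - z k.+1| ^+ 2 <= C,
      (fun n => p n.+1 - z n.+1) @ \oo --> (0 : K),
      residual @ \oo --> (0 : K) &
      exists s, [/\ A s (- B s), weakly_cvg z s &
        (fun n => inner (residual n) (p n.+1 - s)) @ \oo --> (0 : R)]].
Proof.
move=> [s As]; have [dC eC zs] := inertial_fejer As.
have d0 : (fun n => z n.+1 - z n) @ \oo --> (0 : K).
  by have [C dC'] := dC; apply: sq_cvg0; exact: bounded_series_cvg0 dC'.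
have e0 : (fun n => p n.+1 - z n.+1) @ \oo --> (0 : K).
  by have [C eC'] := eC; apply: sq_cvg0; exact: bounded_series_cvg0 eC'.
have r0 : residual @ \oo --> (0 : K).
  pose c1 := lambda^-1 + beta; pose c2 := lambda^-1 * al1.
  have bnd n : `|residual n| <= c1 * `|p n.+1 - z n.+1| + c2 * `|z n.+1 - z n|.
    have lV : (lam n.+1)^-1 <= lambda^-1.
      by rewrite lef_pV2 ?posrE// (lt_le_trans lambda0).
    have h1 : `|z n.+1 - p n.+1 + a1 n.+1 *: (z n.+1 - z n)| <=
        `|p n.+1 - z n.+1| + al1 * `|z n.+1 - z n|.
      apply: le_trans (ler_normD _ _) _; rewrite distrC lerD2l normrZ.
      by have /andP[h h'] := a1_le n; rewrite ger0_norm// ler_wpM2r.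
    have h2 := B_lip (z n.+1) (p n.+1); rewrite [in leRHS]distrC in h2.
    apply: le_trans (ler_normB _ _) _; rewrite normrZ gtr0_norm ?invr_gt0//.
    have : (lam n.+1)^-1 * `|z n.+1 - p n.+1 + a1 n.+1 *: (z n.+1 - z n)| <=
        lambda^-1 * (`|p n.+1 - z n.+1| + al1 * `|z n.+1 - z n|).
      by apply: ler_pM => //; rewrite invr_ge0 ltW.
    rewrite /c1 /c2; lra.
  apply/norm_cvg0P; apply: (squeeze_cvgr (f := cst 0) (h := fun n =>
    c1 * `|p n.+1 - z n.+1| + c2 * `|z n.+1 - z n|)).
  - by apply: nearW => n; rewrite /= normr_ge0 bnd.
  - exact: cvg_cst.
  - rewrite [X in _ --> X](_ : _ = c1 * 0 + c2 * 0); last by rewrite !mulr0 addr0.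
    by apply: cvgD; apply: cvgMr; rewrite -(@normr0 _ K); exact: cvg_norm.
split => //.
have zS s' : A s' (- B s') -> cvg ((fun n => `|z n.+1 - s'| ^+ 2) @ \oo).
  move=> /inertial_fejer[_ _ /cvg_ex[c cP]]; apply/cvg_ex; exists c.
  by rewrite -cvg_shiftS in cP.
have p_bnd s' : A s' (- B s') -> exists M, \forall n \near \oo, `|p n.+1 - s'| <= M.
  move=> /zS /cvg_ex[c zc]; exists (1 + Num.sqrt (c + 1)); near=> n.
  rewrite -(subrK (z n.+1) (p n.+1)) -addrA.
  apply: le_trans (ler_normD _ _) _; apply: lerD; near: n.
    by apply: cvgr0_norm_le; [exact: e0|exact: ltr01].
  have : \forall n \near \oo, `|z n.+1 - s'| ^+ 2 <= c + 1.
    by apply: (cvgr_le _ zc); rewrite ltrDl.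
  apply: filterS => n zn.
  by rewrite -(ger0_norm (normr_ge0 (z n.+1 - s'))) -sqrtr_sqr ler_wsqrtr.
(* The shifted sequence is used because [p] is tied to the iteration only from index 1 on; since p -
   z tends to 0, both sequences have the same weak limits along [U]. *)
have [|||s1 As1 zs1] := @opial _ _ (fun n => z n.+1) [set s | A s (- B s)].
- by exists s.
- exact: zS.
- move=> U x UU ooU zx.
  have e0U : (fun n => p n.+1 - z n.+1) @ U --> (0 : K) by move=> V /e0 /ooU.
  have pz n u : inner (p n.+1) u = inner (p n.+1 - z n.+1) u + inner (z n.+1) u.
    by rewrite -innerDl subrK.
  have px u : (fun n => inner (p n.+1) u) @ U --> inner x u.
    under eq_fun do rewrite pz.
    rewrite -[inner x u]add0r -(inner0l u); apply: cvgD; last exact: zx.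
    by apply: cvg_inner => //; exact: cvg_cst.
  have [M pM] : exists M, \forall n \near U, `|p n.+1| <= M.
    have [M pM] := p_bnd _ As; exists (M + `|s|); apply: ooU.
    apply: filterS pM => n pn; rewrite -(subrK s (p n.+1)).
    by apply: le_trans (ler_normD _ _) _; rewrite lerD2r.
  apply: (zero_of_weak_limit _ residual_in pM _ px).
  by move=> V /r0 /ooU.
exists s1; split => //.
  by move=> u; have := zs1 u; rewrite (cvg_shiftS (fun n => inner (z n) u)).
by have [M pM] := p_bnd _ As1; exact: cvg0_inner r0 pM.
Unshelve. all: by end_near. Qed.

End InertialConvergence.

(** * Lagrange multipliers for affine constraints *)

Section Projection.
Context {R : realType} {H : hilbertType R}.

(** The projection is the proximal point of the indicator function of [C]. Its variational
    inequality, tested at e + c and e - c, gives orthogonality. *)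
Lemma orthogonal_projection (C : set H) (y : H) : closed C ->
  submod_closed (mem C) ->
  exists2 e, C e & forall c, C c -> inner (y - e) c = 0.
Proof.
move=> Ccl [C0m Clinm].
have C0 : C 0 by move: C0m; rewrite inE.
have Clin a u v : C u -> C v -> C (a *: u + v).
  by move=> Cu Cv; have := Clinm a u v; rewrite !inE; apply.
pose f u : \bar R := if pselect (C u) then 0%E else +oo%E.
have fP u (a : R) : (f u <= a%:E)%E <-> C u /\ 0 <= a.
  rewrite /f; case: pselect => Cu; rewrite ?lee_fin.
    by split=> [|[]].
  by split=> [|[]].
have Gf : Gamma f.
  apply: GammaI.
  - by exists 0; rewrite /edom /= /f; case: pselect => // ?; exact: ltry.
  - by move=> u; rewrite /f; case: pselect.
  - move=> u v a b t /andP[t0 t1] /fP[Cu a0] /fP[Cv b0]; apply/fP; split.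
      by apply: (Clin) => //; rewrite -[_ *: v]addr0; exact: Clin.
    by rewrite addr_ge0// mulr_ge0// ?subr_ge0 ltW.
  - move=> a; have [a0|a0] := leP 0 a.
      rewrite (_ : mkset _ = C)//; apply/seteqP; split=> u /=.
        by move=> /fP[].
      by move=> Cu; apply/fP.
    rewrite (_ : mkset _ = set0); first exact: closed0.
    by apply/seteqP; split=> u //= /fP[_]; rewrite leNgt a0.
have := prox_subdiff y Gf ltr01; set e := prox _ _ _.
move=> /subdiff_le[r fe fle]; have [Ce r0] : C e /\ 0 <= r by apply/fP; rewrite fe.
have r00 : r = 0.
  by move: fe; rewrite /f; case: pselect => // ? [<-].
have le0 c : C c -> inner (y - e) (c - e) <= 0.
  move=> Cc; have := fle c 0; rewrite r00 add0r invr1 scale1r; apply.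
  exact/fP.
exists e => // c Cc.
have h1 := le0 (1 *: c + e) (Clin 1 _ _ Cc Ce).
have h2 := le0 ((-1) *: c + e) (Clin (-1) _ _ Cc Ce).
by move: h1 h2; rewrite !addrK !innerZr => h1 h2; lra.
Qed.

End Projection.

(** * Penalization and the limit of the penalized multipliers *)

Section LagrangeMultiplier.
Context {R : realType} {W Y : hilbertType R}.
Variables (Phi : W -> \bar R) (T : W -> Y) (w0 : W) (r0 : R).
Hypothesis GPhi : Gamma Phi.
Hypothesis Tc : continuous T.
Hypothesis Taff : forall x y (t : R),
  T (t *: x + (1 - t) *: y) = t *: T x + (1 - t) *: T y.
Hypothesis Tw0 : T w0 = 0.
Hypothesis Phi0 : Phi w0 = r0%:E.
Hypothesis min0 : forall w, T w = 0 -> (r0%:E <= Phi w)%E.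

Let pen (k : R) w : \bar R := (Phi w + (k * `|T w| ^+ 2)%:E)%E.

Let Gpen k : 0 <= k -> Gamma (pen k).
Proof.
move=> k0; apply: GammaDr => //.
  by move=> w; apply: cvgMr; apply: cvg_normr_sq; exact: Tc.
move=> x y t /andP[t0 t1]; rewrite Taff normr_sq_conv.
have : 0 <= k * (t * (1 - t) * `|T x - T y| ^+ 2).
  by rewrite !mulr_ge0// ?exprn_ge0// ltW// subr_gt0.
lra.
Qed.

(** The term around [w0] makes the sublevel sets bounded and ties the minimizers to [w0]. *)
Let penalized (c k : R) w : \bar R := (pen k w + (c * `|w - w0| ^+ 2)%:E)%E.

Let penalizedE c k w (s : R) : Phi w = s%:E ->
  penalized c k w = (s + k * `|T w| ^+ 2 + c * `|w - w0| ^+ 2)%:E.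
Proof. by rewrite /penalized /pen => ->. Qed.

(* The sublevel sets at r0 - e of the penalized objectives are nested; were
   they all nonempty, a common point would be feasible with value below r0. *)
Lemma penalty_exact (c e : R) : 0 < c -> 0 < e -> exists k : nat, forall n w s,
  (k <= n)%N -> Phi w = s%:E ->
  r0 - e < s + n%:R * `|T w| ^+ 2 + c * `|w - w0| ^+ 2.
Proof.
move=> c0 e0; apply: contrapT => /forallNP Nk.
have GG (k : nat) : Gamma (penalized c k%:R).
  by apply: Gamma_quad; [exact: Gpen|exact: ltW].
have PN w : Phi w != -oo%E by exact: Gamma_Nninfty.
pose C k : set W := [set w | (penalized c k%:R w <= (r0 - e)%:E)%E].
have CP k w : C k w <-> exists2 s : R, Phi w = s%:E &
    s + k%:R * `|T w| ^+ 2 + c * `|w - w0| ^+ 2 <= r0 - e.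
  rewrite /C /=; split=> [|[s Ps]]; last by rewrite (penalizedE _ _ Ps) lee_fin.
  have := PN w; case Ps : (Phi w) => [s| |]// _.
    by rewrite (penalizedE _ _ Ps) lee_fin; exists s.
  by rewrite /penalized /pen Ps.
have Cle k n : (k <= n)%N -> C n `<=` C k.
  move=> kn w /CP[s Ps sle]; apply/CP; exists s => //; apply: le_trans sle.
  by rewrite lerD2r lerD2l ler_wpM2r ?exprn_ge0// ler_nat.
have [M CM] := coercive_quad w0 (r0 - e) GPhi c0.
have [|k|k x y|k|x|w Cw] := @nested_closed_convex _ _ C M.
- move=> k; apply: contrapT => /forallNP nC; apply: (Nk k) => n w s kn Ps.
  rewrite ltNge; apply/negP => le1; apply: (nC w); apply: (Cle k n kn).
  by apply/CP; exists s.
- exact: Gamma_closed.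
- move=> Cx Cy; have := Gamma_mid (GG k) Cx Cy.
  by rewrite (_ : 2^-1 * _ = r0 - e)//; lra.
- exact: Cle.
- move=> /CP[s Ps]; rewrite mul0r addr0 => sle; apply: CM.
  by rewrite Ps -EFinD lee_fin.
have [s Ps _] := (CP 0%N w).1 (Cw 0%N).
have Tw : T w = 0.
  apply/eqP; apply: contrapT => /negP Tn0.
  have q0 : 0 < `|T w| ^+ 2 by rewrite exprn_gt0// normr_gt0.
  (* With this weight the penalty alone exceeds [|r0 - s|], which no point of [C k] allows. *)
  pose k := (Num.trunc (`|r0 - s| / `|T w| ^+ 2)).+1.
  have : `|r0 - s| < k%:R * `|T w| ^+ 2.
    by rewrite -ltr_pdivrMr//; exact: truncnS_gt.
  have [s' Ps'] := (CP k w).1 (Cw k); move: Ps'; rewrite Ps => -[<-].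
  have : 0 <= c * `|w - w0| ^+ 2 by rewrite mulr_ge0 ?exprn_ge0// ltW.
  have := ler_norm (r0 - s); lra.
have := min0 Tw; rewrite Ps lee_fin.
have [s' Ps'] := (CP 0%N w).1 (Cw 0%N); move: Ps'; rewrite Ps => -[<-].
have : 0 <= c * `|w - w0| ^+ 2 by rewrite mulr_ge0 ?exprn_ge0// ltW.
rewrite mul0r; lra.
Qed.

(** The third clause is the first-order condition at [w] in the direction of [x]. It holds with both
    quadratic terms doubled on the left; dropping one copy leaves the optimal penalized value
    there. *)
Lemma penalty_minimizer n : exists w (s : R), [/\ Phi w = s%:E,
  s + n%:R * `|T w| ^+ 2 + `|w - w0| ^+ 2 <= r0 &
  forall x a, (Phi x <= a%:E)%E ->
    s + n%:R * `|T w| ^+ 2 + `|w - w0| ^+ 2 <=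
    a + 2 * inner (n%:R *: T w) (T x) + 2 * inner (w - w0) (x - w0)].
Proof.
have [w wmin] := argmin_quad w0 (Gpen (ler0n R n)) ltr01.
have wle x : (penalized 1 n%:R w <= penalized 1 n%:R x)%E by exact: wmin.
have [s Ps] : exists s : R, Phi w = s%:E.
  apply: ereal_fin; first exact: Gamma_Nninfty.
  rewrite ltNge leye_eq; apply/negP => /eqP Pw; have := wle w0.
  by rewrite (penalizedE _ _ Phi0) /penalized /pen Pw.
exists w, s; split => //.
  have := wle w0; rewrite (penalizedE _ _ Ps) (penalizedE _ _ Phi0) lee_fin.
  by rewrite Tw0 subrr !normr0 expr0n/= !mulr0 !addr0 mul1r.
move=> x a Pa; rewrite -subr_ge0.
suff : s <= a + 2 * n%:R * inner (T w) (T x - T w) + 2 * inner (w - w0) (x - w).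
  have : 0 <= n%:R * inner (T w) (T w) by rewrite mulr_ge0// inner_ge0.
  have := inner_ge0 (w - w0).
  rewrite -!inner_norm !innerE (innerC w w0) => h1 h2 h3; lra.
apply: (@le_of_slope _ _ _ (n%:R * `|T x - T w| ^+ 2 + `|x - w| ^+ 2)) => t t01.
have Pw : (Phi w <= s%:E)%E by rewrite Ps.
have := Gamma_conv GPhi t01 Pa Pw; have := wle (t *: x + (1 - t) *: w).
have := Gamma_Nninfty (t *: x + (1 - t) *: w) GPhi.
case Pt : (Phi (t *: x + _)) => [q| |]// _.
rewrite (penalizedE _ _ Ps) (penalizedE _ _ Pt) !lee_fin Taff.
have -> : t *: x + (1 - t) *: w - w0 = t *: (x - w) + (w - w0).
  by apply: inner_inj => u; rewrite !innerE; ring.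
have -> : t *: T x + (1 - t) *: T w = t *: (T x - T w) + T w.
  by apply: inner_inj => u; rewrite !innerE; ring.
rewrite !(normr_sqD (t *: _)) !normrZ !exprMn !innerZl.
rewrite (innerC (x - w)) (innerC (T x - T w)).
have /andP[t0 t1] := t01; rewrite (gtr0_norm t0) => h1 h2.
rewrite -(ler_pM2l t0); move: h1 h2.
move: (inner (T w) _) (inner (w - w0) _) (`|T x - T w| ^+ 2) (`|x - w| ^+ 2)
  (`|T w| ^+ 2) (`|w - w0| ^+ 2) => i1 i2 q1 q2 q3 q4; rewrite expr2; lra.
Qed.

Let C := [set y | exists t w, [/\ 0 < t, edom Phi w & y = t *: T w]].
Hypothesis Ccl : closed C.
Hypothesis Csub : submod_closed (mem C).

Lemma lagrange_multiplier : exists v, forall w (s : R), (Phi w <= s%:E)%E ->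
  r0 <= s + inner v (T w).
Proof.
have /choice[w /choice[s ws]] := penalty_minimizer.
(* The derivative of the penalty with respect to the constraint value, hence the approximate
   multiplier; [gam n] is the optimal penalized value, which approaches [r0]. *)
pose y n := (2 * n%:R) *: T (w n).
pose gam n := s n + n%:R * `|T (w n)| ^+ 2 + `|w n - w0| ^+ 2.
have gam_le n x a : (Phi x <= a%:E)%E ->
    gam n <= a + inner (y n) (T x) + 2 * inner (w n - w0) (x - w0).
  move=> Pa; have [_ _ /(_ _ _ Pa)] := ws n.
  suff <- : inner (y n) (T x) = 2 * inner (n%:R *: T (w n)) (T x) by [].
  by rewrite !innerZl mulrA.
have w_cvg : w @ \oo --> w0.
  suff : (fun n => w n - w0) @ \oo --> (0 : W).
    move=> h; rewrite -[w0]add0r (_ : w = (fun n => w n - w0 + w0)).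
      by apply: cvgD => //; exact: cvg_cst.
    by apply: funext => n; rewrite subrK.
  apply: sq_cvg0; apply/cvgr0Pnorm_lt => e e0.
  have h0 : 0 < 2^-1 :> R by rewrite invr_gt0.
  have he : 0 < e / 2 by rewrite divr_gt0.
  (* Comparing weight 1/2 with weight 1: the value with weight 1 is at most [r0], the one with
     weight 1/2 is above [r0 - e / 2], so half of the squared distance to [w0] is below [e / 2]. *)
  have [k kP] := penalty_exact h0 he; exists k => // n /= kn.
  have [Ps le1 _] := ws n; have := kP n _ _ kn Ps.
  rewrite ger0_norm ?exprn_ge0//; lra.
have gam_ge e : 0 < e -> \forall n \near \oo, r0 - e <= gam n.
  move=> e0; have [k kP] := penalty_exact ltr01 e0; exists k => // n /= kn.
  by have [Ps _ _] := ws n; have := kP n _ _ kn Ps; rewrite mul1r => /ltW.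
have yC n : C (y n).
  have [Ps _ _] := ws n; have [C0 _] := Csub; case: n Ps => [|n] Ps.
    by rewrite /y mulr0 scale0r; move: C0; rewrite inE.
  exists (2 * n.+1%:R), (w n.+1); split => //.
  by rewrite /edom /= Ps ltry.
have CN c : C c -> C (- c).
  move=> Cc; have [C0 /(_ (-1) c 0)] := Csub; rewrite !inE => h.
  rewrite -scaleN1r -[_ *: _]addr0; apply: h => //.
  by move: C0; rewrite inE.
have lower c : C c -> exists M : R, forall n, M <= inner (y n) c.
  move=> [t [x [t0 Px ->]]]; have [a Pa] := ereal_fin (Gamma_Nninfty x GPhi) Px.
  (* The bound from [gam_le] is uniform only for large [n], where [gam n] and [w n] are near their
     limits; a minimum handles the finitely many other indices. *)
  have [N NP] : exists N : nat, forall n, (N <= n)%N ->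
      r0 - 1 - a - 2 * `|x - w0| <= inner (y n) (T x).
    have [N1 _ h1] := gam_ge 1 ltr01.
    have /cvgr_dist_le/(_ _ ltr01)[N2 _ h2] := w_cvg.
    exists (maxn N1 N2) => n; rewrite geq_max => /andP[/h1 /= g1 /h2 /= g2].
    have Pa' : (Phi x <= a%:E)%E by rewrite Pa.
    have := gam_le n _ _ Pa'; have := inner_le (w n - w0) (x - w0).
    have : `|w n - w0| * `|x - w0| <= 1 * `|x - w0| by rewrite ler_wpM2r// distrC.
    lra.
  pose m := \big[Num.min/(r0 - 1 - a - 2 * `|x - w0|)]_(i < N) inner (y i) (T x).
  exists (t * m) => n; rewrite innerZr ler_pM2l//.
  have [nN|nN] := ltnP n N.
    by have := bigmin_le (r0 - 1 - a - 2 * `|x - w0|) (Ordinal nN)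
      (fun i : 'I_N => inner (y i) (T x)).
  apply: le_trans (NP _ nN); rewrite /m.
  exact: bigmin_le_id.
have [M yM] : exists M : R, forall n, `|y n| <= M.
  pose F := range (fun n u => inner (y n) u).
  have F_bnd f : F f -> bounded_fun_norm f /\ linear f.
    move=> [n _ <-]; split=> [r|a u v]; last by rewrite innerDr innerZr.
    exists (`|y n| * r) => u ur; apply: le_trans (inner_norm_le _ _) _.
    by rewrite ler_wpM2l.
  have F_pt : pointwise_bounded F.
    (* All [y n] lie in [C], so [u] may be replaced by its projection [e]; the lower bounds for [e]
       and [- e] together bound the absolute value. *)
    move=> u; have [e Ce ue] := orthogonal_projection u Ccl Csub.
    have [M1 h1] := lower _ Ce; have [M2 h2] := lower _ (CN _ Ce).
    exists (`|M1| + `|M2|) => _ [n _ <-].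
    have -> : inner (y n) u = inner (y n) e.
      have := ue _ (yC n); rewrite innerDl innerNl (innerC u) (innerC e).
      by move=> /eqP; rewrite subr_eq0 => /eqP.
    have := h1 n; have := h2 n; rewrite innerNr => k2 k1.
    have := ler_norm (- M1); have := ler_norm (- M2); rewrite !normrN => k3 k4.
    have := normr_ge0 M1; have := normr_ge0 M2 => k5 k6.
    by rewrite ler_norml; apply/andP; split; lra.
  have [M' M'P] := Banach_Steinhauss F_bnd F_pt 1.
  exists M' => n; have [->|y0] := eqVneq (y n) 0.
    rewrite normr0; have := M'P _ (imageT _ n) 0.
    by rewrite normr0 inner0r normr0; apply.
  have := M'P _ (imageT _ n) (`|y n|^-1 *: y n).
  rewrite normrZ normfV normr_id mulVf ?normr_eq0// lexx => /(_ isT).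
  rewrite innerZr inner_norm expr2 mulKf ?normr_eq0// normr_id.
  by [].
have [U [UU ooU]] := @ultraFilterLemma nat \oo _.
have [|v vP] := @ultra_weak_limit _ _ U y M UU; first exact: nearW.
exists v => x a Pa; apply/ler_addgt0Pr => e e0; rewrite -lerBlDr.
(* The multiplier converges only weakly, but it is paired with the fixed vector [T x]; the proximal
   term vanishes because [w] converges strongly. *)
have lim : (fun n => a + inner (y n) (T x) + 2 * inner (w n - w0) (x - w0)) @ U
    --> a + inner v (T x) + 2 * inner 0 (x - w0).
  apply: cvgD; first by apply: cvgD; [exact: cvg_cst|exact: vP].
  apply: cvgMr; apply: cvg_inner; last exact: cvg_cst.
  rewrite -(subrr w0); apply: cvgB; last exact: cvg_cst.
  by move=> V /w_cvg /ooU.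
have : r0 - e <= a + inner v (T x) + 2 * inner 0 (x - w0).
  apply: (closed_cvg _ (@closed_ge R (r0 - e)) _ _ lim).
  apply: filterS (ooU _ (gam_ge _ e0)) => n ge1.
  exact: le_trans ge1 (gam_le _ _ _ Pa).
by rewrite inner0l mulr0 addr0.
Qed.

End LagrangeMultiplier.

(** * Product spaces and uniform convexity *)

Section ProductSpace.
Context {R : realType}.

Lemma big_option (I : finType) (F : option I -> R) :
  \sum_o F o = F None + \sum_i F (Some i).
Proof.
rewrite (bigD1 None)//=; congr (_ + _).
rewrite (reindex_omap Some id)/=; last by case.
by apply: eq_bigl => i; rewrite eqxx.
Qed.

Lemma sum_le_point (I : finType) (F : I -> R) i : (forall j, 0 <= F j) ->
  F i <= \sum_j F j.
Proof. by move=> F0; rewrite (bigD1 i)//= lerDl sumr_ge0. Qed.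

Lemma cvg_sumr {T I : Type} (F : set_system T) {FF : Filter F} (s : seq I)
    (u : I -> T -> R) (a : I -> R) :
  (forall i, u i @ F --> a i) ->
  (fun n => \sum_(i <- s) u i n) @ F --> \sum_(i <- s) a i.
Proof.
move=> ua; elim: s => [|i s IH].
  rewrite big_nil (_ : (fun _ => _) = (fun=> 0)); first exact: cvg_cst.
  by apply: funext => n; rewrite big_nil.
rewrite big_cons (_ : (fun _ => _) = (fun n => u i n + \sum_(j <- s) u j n)).
  exact: cvgD.
by apply: funext => n; rewrite big_cons.
Qed.

Section Coordinates.
Context {I : finType} {G : I -> hilbertType R}.
Implicit Types x y : hprod G.

Lemma hprod_innerE x y : inner x y = \sum_i inner (x i) (y i).
Proof. by []. Qed.

Lemma hprod_coord_continuous i : continuous (fun x : hprod G => x i).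
Proof.
apply: (@bounded_continuous _ (hprod G) (G i) (fun x => x i) 1) => x y.
by rewrite mul1r; exact: (hprod_norm_coord (x - y)).
Qed.

Lemma cvg_hprod_coord {T : Type} (F : set_system T) {FF : Filter F}
    (u : T -> hprod G) x i :
  u @ F --> x -> (fun n => u n i) @ F --> x i.
Proof.
by move=> ux; exact: (cvg_comp u (fun x : hprod G => x i) ux
  (@hprod_coord_continuous i x)).
Qed.

Lemma cvg_hprod {T : Type} (F : set_system T) {FF : Filter F}
    (u : T -> hprod G) x :
  (forall i, (fun n => u n i) @ F --> x i) -> u @ F --> x.
Proof.
move=> ux; suff : (fun n => u n - x) @ F --> (0 : hprod G).
  move=> h; rewrite -[x]add0r (_ : u = (fun n => u n - x + x)).
    by apply: cvgD => //; exact: cvg_cst.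
  by apply: funext => n; rewrite subrK.
apply: sq_cvg0.
rewrite (_ : (fun n => _) = (fun n => \sum_i `|u n i - x i| ^+ 2)); last first.
  by apply: funext => n; rewrite hprod_norm_sqr.
rewrite [X in _ --> X](_ : _ = \sum_(i : I) (0 : R)); last by rewrite big1.
apply: (@cvg_sumr _ _ F _ _ (fun i n => `|u n i - x i| ^+ 2) (fun=> 0)) => i.
rewrite [X in _ --> X](_ : _ = `|x i - x i| ^+ 2).
  by apply: cvg_normr_sq; apply: cvgB; [exact: ux|exact: cvg_cst].
by rewrite subrr normr0 expr0n.
Qed.

Definition hprod_single i (u : G i) : hprod G := dfwith (0 : hprod G) i u.

Lemma inner_hprod_single x i (u : G i) : inner x (hprod_single u) = inner (x i) u.
Proof.
rewrite hprod_innerE (bigD1 i)//= [X in _ + X]big1 ?addr0.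
  by rewrite /hprod_single dfwithin.
by move=> j ji; rewrite /hprod_single dfwithout ?inner0r// eq_sym.
Qed.

Lemma weakly_cvg_coord (u : nat -> hprod G) x i :
  weakly_cvg u x -> weakly_cvg (fun n => u n i) (x i).
Proof.
move=> ux w; rewrite -inner_hprod_single.
under eq_fun do rewrite -inner_hprod_single.
exact: ux.
Qed.

End Coordinates.

Lemma sum_fin (I : finType) (F : I -> \bar R) : (forall i, F i != -oo%E) ->
  (\sum_i F i < +oo)%E -> exists a : I -> R, forall i, F i = (a i)%:E.
Proof.
move=> FN Foo; exists (fun i => fine (F i)) => i; rewrite fineK//.
rewrite fin_numE FN/=; apply/eqP => Fi.
suff : (\sum_j F j = +oo)%E by move=> h; rewrite h ltxx in Foo.
by apply/esum_eqyP => //; exists i; split => //; rewrite mem_index_enum.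
Qed.

Lemma sum_Nninfty (I : finType) (F : I -> \bar R) : (forall i, F i != -oo%E) ->
  (\sum_i F i != -oo)%E.
Proof.
by move=> FN; apply/eqP => /esum_eqNyP[i [_ _ /eqP]]; apply/negP.
Qed.

Lemma Gamma_sum (W : hilbertType R) (I : Type) (s : seq I) (F : I -> W -> \bar R) :
  (forall i, Gamma (F i)) -> (exists w, forall i, edom (F i) w) ->
  Gamma (fun w => \sum_(i <- s) F i w)%E.
Proof.
move=> GF [w wF]; elim: s => [|i s IH].
  rewrite (_ : (fun _ => _) = EFin \o (fun _ : W => 0 : R)); last first.
    by apply: funext => u; rewrite big_nil.
  by apply: Gamma_real => [u|u v t _]; [exact: cvg_cst|rewrite !mulr0 addr0].
rewrite (_ : (fun _ => _) = (fun u => F i u + \sum_(j <- s) F j u)%E); last first.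
  by apply: funext => u; rewrite big_cons.
apply: GammaD => //; exists w; split => //.
by rewrite /edom/=; apply: lte_sum_pinfty => j _; exact: wF.
Qed.

Lemma nneseries_bounded (u : nat -> R) (C : R) (N : nat) : (forall n, 0 <= u n) ->
  (forall n, \sum_(0 <= k < n) u (k + N)%N <= C) ->
  (\sum_(N <= n <oo) (u n)%:E < +oo)%E.
Proof.
move=> u0 uC; apply: (@le_lt_trans _ _ C%:E); last exact: ltry.
apply: lime_le.
  by apply: is_cvg_nneseries => n _ _; rewrite lee_fin.
apply: nearW => n; rewrite sumEFin lee_fin.
have [nN|/ltnW nN] := leqP n N.
  by rewrite big_geq//; have := uC 0%N; rewrite big_nil.
by rewrite -{1}[N]add0n big_addn.
Qed.

Lemma subdiff_add (W : hilbertType R) (f g : W -> \bar R) x u v :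
  subdiff f x u -> subdiff g x v -> subdiff (fun y => f y + g y)%E x (u + v).
Proof.
move=> [fx fu] [gx gv]; split => [|y]; first by rewrite fin_numD fx.
apply: le_trans (leeD (fu y) (gv y)).
by rewrite innerDl EFinD addeACA.
Qed.

Lemma subdiff_grad (W : hilbertType R) (h : W -> R) x :
  (forall x y t, 0 < t < 1 ->
    h (t *: x + (1 - t) *: y) <= t * h x + (1 - t) * h y) ->
  differentiable h x -> subdiff (EFin \o h) x (grad h x).
Proof.
move=> hc hx; split => // y; rewrite /= -EFinD lee_fin.
exact: convex_grad_le.
Qed.

(** Both subgradient inequalities are evaluated at the midpoint and compared with uniform convexity
    for t = 1/2; the factor 1/4 in front of [phi] is compensated exactly. *)
Lemma uniformly_convex_subdiff (W : hilbertType R) (f : W -> \bar R)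
    (phi : R -> \bar R) x y u v :
  (forall x, f x != -oo%E) -> (forall s, 0 <= s -> (0 <= phi s)%E) ->
  convex_with_modulus f phi ->
  subdiff f x u -> subdiff f y v ->
  (phi `|x - y|%R <= (inner (u - v) (x - y))%R%:E)%E.
Proof.
move=> fN phi0 fphi /subdiff_le[a fx fu] /subdiff_le[b fy fv].
have h01 : (0 < (2^-1 : R)) && ((2^-1 : R) < 1) by apply/andP; split; lra.
have := fphi x y 2^-1; rewrite /edom /= fx fy !ltry => /(_ isT isT h01).
have := fN (2^-1 *: x + (1 - 2^-1) *: y); have := phi0 _ (normr_ge0 (x - y)).
set q := f _; have := fu (2^-1 *: x + (1 - 2^-1) *: y).
have := fv (2^-1 *: x + (1 - 2^-1) *: y); rewrite -/q.
have c0 : (0 < 2^-1 * (1 - 2^-1) :> R) by case/andP: h01 => *; rewrite mulr_gt0// subr_gt0.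
case: q => [q| |]//; case: (phi _) => [p| |]//.
- move=> /(_ _ (lexx _)) h1 /(_ _ (lexx _)) h2 _ _.
  rewrite -!EFinM -!EFinD !lee_fin; move: h1 h2; rewrite !innerE; lra.
- by move=> _ _ _ _; rewrite gt0_muley ?lte_fin// addey.
- by move=> _ _ _ _; rewrite gt0_muley ?lte_fin// -!EFinM -!EFinD addye.
Qed.

Lemma uniformly_convex_cvg (W : hilbertType R) (f : W -> \bar R)
    (p u : nat -> W) x v (e : nat -> R) : uniformly_convex f ->
  (forall n, subdiff f (p n) (u n)) -> subdiff f x v ->
  (forall n, inner (u n - v) (p n - x) <= e n) -> e @ \oo --> (0 : R) ->
  p @ \oo --> x.
Proof.
move=> [[_ fN] [phi [phi0 phind phiE fphi]]] pu xv pe e0.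
have phi_le n : (phi `|p n - x|%R <= (e n)%:E)%E.
  apply: le_trans (uniformly_convex_subdiff fN phi0 fphi (pu n) xv) _.
  by rewrite lee_fin.
apply/cvgrPdist_lt => d d0.
(* [phi d] may be +oo, so a positive real below it is used as threshold. *)
have [c c0 cphi] : exists2 c : R, 0 < c & (c%:E <= phi d)%E.
  have : (0 < phi d)%E.
    rewrite lt_neqAle phi0 ?ltW// andbT eq_sym; apply/eqP.
    by move=> /(phiE d (ltW d0)) de; rewrite de ltxx in d0.
  by case: (phi d) => [r| |]// r0; [exists r|exists 1; rewrite ?leey].
have /cvgr_lt/(_ _ c0) := e0; apply: filterS => n enc.
rewrite distrC ltNge; apply/negP => dn.
have := phind _ _ (ltW d0) dn; apply/negP; rewrite -ltNge.
by apply: le_lt_trans (phi_le n) (lt_le_trans _ cphi); rewrite lte_fin.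
Qed.

End ProductSpace.

(** * Optimality conditions and duality *)

Section Optimality.
Context {R : realType} {H : hilbertType R} {m : nat} {G : 'I_m -> hilbertType R}.
Variables (f : H -> \bar R) (h : H -> R) (z : H) (mu : R).
Variables (g l : forall i, G i -> \bar R) (r : forall i, G i) (nu : 'I_m -> R).
Variable L : forall i, {linear H -> G i}.
Arguments g : clear implicits.
Arguments l : clear implicits.
Hypothesis Gf : Gamma f.
Hypothesis hconv : forall x y (t : R), 0 < t < 1 ->
  h (t *: x + (1 - t) *: y) <= t * h x + (1 - t) * h y.
Hypothesis hdiff : forall y, differentiable h y.
Hypothesis hlip : forall x y, `|grad h x - grad h y| <= mu * `|x - y|.
Hypothesis Gg : forall i, Gamma (g i).
Hypothesis Gl : forall i, Gamma (l i).
Hypothesis nu0 : forall i, 0 < nu i.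
Hypothesis lstrong : forall i, strongly_convex (nu i)^-1 (l i).
Hypothesis Lc : forall i, continuous (L i).

Let nuV0 i : 0 < (nu i)^-1. Proof. by rewrite invr_gt0. Qed.

Let dl i := grad (fine \o conjugate (l i)).

(** The decomposition required by the parallel sum is forced: strong convexity of [l i] leaves the
    gradient of its conjugate at [v i] as the only second summand. *)
Lemma optimality_conditionsP x v : optimality_conditions f h z g l r L x v <->
  subdiff f x (z - \sum_i adjoint (L i) (v i) - grad h x) /\
  forall i, subdiff (conjugate (g i)) (v i) (L i x - r i - dl (v i)).
Proof.
split=> [[[w fw wE] gl]|[fx gl]]; split.
- by rewrite -wE addrK.
- move=> i; have [c gc [d ld cd]] := gl i.
  rewrite /dl -(conjugate_grad_unique (Gl i) (nuV0 i) (lstrong i) ld) -cd addrK.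
  exact: subdiff_conjugate.
- by eexists; [exact: fx|rewrite subrK].
- move=> i; exists (L i x - r i - dl (v i)); last exists (dl (v i)).
  + exact: subdiff_conjugateK.
  + exact: (conjugate_grad_subdiff (Gl i) (nuV0 i) (lstrong i)).
  + by rewrite subrK.
Qed.

(** Convexity at [y] and the Cauchy-Schwarz inequality give this with [mu] in place of the sharp
    [mu / 2]; the constant is immaterial, since [subdiff_quad] discards the quadratic term. *)
Lemma smooth_upper x y :
  h y <= h x + inner (grad h x) (y - x) + mu * `|y - x| ^+ 2.
Proof.
have := convex_grad_le x hconv (hdiff y); rewrite -opprB innerNr.
have := inner_le (grad h y - grad h x) (y - x); rewrite innerDl innerNl.
have := ler_wpM2r (normr_ge0 (y - x)) (hlip y x); rewrite -mulrA -expr2.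
move: (inner _ _) (inner _ _) (_ * _) (mu * _) (h x) (h y) => ? ? ? ? ? ?.
by move=> *; lra.
Qed.

(** The space of the triples (x, c, d). Splitting the infimal convolutions into separate variables
    leaves an affine constraint [T w = 0] and a separable objective [Phi]. *)
Let GW (o : option ('I_m + 'I_m)) : hilbertType R :=
  match o with None => H | Some (inl i) => G i | Some (inr i) => G i end.

Let mkW (x : H) (c d : forall i, G i) : hprod GW := fun o =>
  match o return GW o with
  | None => x | Some (inl i) => c i | Some (inr i) => d i end.

Let T (w : hprod GW) : hprod G := fun i =>
  (w (Some (inl i)) : G i) + (w (Some (inr i)) : G i) - L i (w None : H) + r i.

Let Phi (w : hprod GW) : \bar R := (f (w None)
  + \sum_(i < m) (g i (w (Some (inl i))) + l i (w (Some (inr i))))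
  + (h (w None))%:E - (inner (w None : H) z)%:E)%E.

Let T_continuous : continuous T.
Proof.
move=> w; have cT (F : set_system (hprod GW)) (FF : Filter F) :
    F --> w -> T @ F --> T w.
  move=> Fw; apply: cvg_hprod => i.
  have ci o : (fun w : hprod GW => w o) @ F --> w o 
    by exact: (@cvg_hprod_coord _ _ GW _ F FF id w o Fw).
  apply: cvgD; last exact: cvg_cst.
  apply: cvgB; first by apply: cvgD; [exact: (ci (Some (inl i)))|exact: (ci (Some (inr i)))].
  exact: (cvg_comp (fun w : hprod GW => w None : H) (L i) (ci None) (@Lc i _)).
exact: (cT _ (nbhs_filter w) (@cvg_id _ (nbhs w))).
Qed.

Let T_affine x y (t : R) : T (t *: x + (1 - t) *: y) = t *: T x + (1 - t) *: T y.
Proof.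
apply: functional_extensionality_dep => i.
rewrite /T; have -> : forall a b : hprod G, (t *: a + (1 - t) *: b) i =
  t *: a i + (1 - t) *: b i by [].
have -> o : (t *: x + (1 - t) *: y) o = t *: x o + (1 - t) *: y o by [].
rewrite linearD !linearZ.
by apply: inner_inj => u; rewrite !innerE; ring.
Qed.

Let PhiP w : (Phi w < +oo)%E -> exists a (b e : 'I_m -> R),
  [/\ f (w None) = a%:E, forall i, g i (w (Some (inl i))) = (b i)%:E,
      forall i, l i (w (Some (inr i))) = (e i)%:E &
      Phi w = (a + \sum_i (b i + e i) + h (w None) - inner (w None : H) z)%:E].
Proof.
have fN := Gamma_Nninfty (w None) Gf.
have gN i := Gamma_Nninfty (w (Some (inl i))) (Gg i).
have lN i := Gamma_Nninfty (w (Some (inr i))) (Gl i).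
have glN i : (g i (w (Some (inl i))) + l i (w (Some (inr i))) != -oo)%E.
  by rewrite adde_eq_ninfty negb_or gN lN.
have sN := sum_Nninfty glN.
move=> Pw; have [fS] : (f (w None) < +oo)%E /\
    (\sum_(i < m) (g i (w (Some (inl i))) + l i (w (Some (inr i)))) < +oo)%E.
  move: Pw; rewrite /Phi; move: fN sN.
  by case: (f _) (\sum_(i < m) _)%E => [a| |] [b| |]// _ _; rewrite ?ltry.
move=> /(sum_fin glN)[be beE].
have glfin i : exists be : R * R, g i (w (Some (inl i))) = (be.1)%:E /\
    l i (w (Some (inr i))) = (be.2)%:E.
  have := beE i; have := gN i; have := lN i.
  by case: (g i _) (l i _) => [b| |] [e| |]// _ _ _; exists (b, e).
have [q qE] := choice glfin; have [a fa] := ereal_fin fN fS.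
exists a, (fun i => (q i).1), (fun i => (q i).2); split => //.
- by move=> i; case: (qE i).
- by move=> i; case: (qE i).
rewrite /Phi fa; under eq_bigr => i _ do rewrite (qE i).1 (qE i).2 -EFinD.
by rewrite sumEFin.
Qed.

Let PhiE x c d a (b e : 'I_m -> R) : f x = a%:E ->
  (forall i, g i (c i) = (b i)%:E) -> (forall i, l i (d i) = (e i)%:E) ->
  Phi (mkW x c d) = (a + \sum_i (b i + e i) + h x - inner x z)%:E.
Proof.
move=> fa gb le; rewrite /Phi /= fa.
by under eq_bigr => i _ do rewrite gb le -EFinD; rewrite sumEFin.
Qed.

Let Gamma_Phi w : (Phi w < +oo)%E -> Gamma Phi.
Proof.
move=> /PhiP[a [b [e [fa gb le _]]]].
have coord_aff o (x y : hprod GW) (t : R) :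
  (t *: x + (1 - t) *: y) o = t *: x o + (1 - t) *: y o by [].
have cc o := @hprod_coord_continuous R _ GW o.
have Gf' : Gamma (f \o (fun w : hprod GW => w None : H)).
  apply: Gamma_comp => //; first exact: (cc None).
  by exists w; rewrite /edom/= fa ltry.
have Gg' i : Gamma (g i \o (fun w : hprod GW => w (Some (inl i)) : G i)).
  apply: Gamma_comp => //; first exact: (cc (Some (inl i))).
  by exists w; rewrite /edom/= gb ltry.
have Gl' i : Gamma (l i \o (fun w : hprod GW => w (Some (inr i)) : G i)).
  apply: Gamma_comp => //; first exact: (cc (Some (inr i))).
  by exists w; rewrite /edom/= le ltry.
have Ggl i := GammaD (Gg' i) (Gl' i).
have {}Ggl i : Gamma (fun w : hprod GW =>
    g i (w (Some (inl i))) + l i (w (Some (inr i))))%E.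
  by apply: Ggl; exists w; rewrite /edom/= gb le !ltry.
have glw i : (g i (w (Some (inl i))) + l i (w (Some (inr i))) < +oo)%E.
  by rewrite gb le -EFinD ltry.
have Gs := Gamma_sum (index_enum 'I_m) Ggl (ex_intro _ w glw).
have Gfs : Gamma (fun w : hprod GW => f (w None)
    + \sum_(i < m) (g i (w (Some (inl i))) + l i (w (Some (inr i)))))%E.
  apply: (GammaD Gf' Gs); exists w; split; first by rewrite /edom/= fa ltry.
  by rewrite /edom/=; apply: lte_sum_pinfty => i _; exact: glw.
have hc : continuous (fun w : hprod GW => h (w None)).
  move=> w'; apply: (cvg_comp (fun w : hprod GW => w None : H) h (cc None w')).
  exact: differentiable_continuous.
have zc : continuous (fun w : hprod GW => - inner (w None : H) z).
  move=> w'; apply: (cvg_comp (fun w : hprod GW => w None : H)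
    (fun x => - inner x z) (cc None w')).
  by apply: cvgN; apply: cvg_inner; [exact: cvg_id|exact: cvg_cst].
apply: (GammaDr (GammaDr Gfs hc _) zc) => x y t t01; rewrite coord_aff.
  exact: hconv.
by rewrite !innerE; lra.
Qed.

Hypothesis primal_min : exists y, minimizer (primal_objective f h z g l r L) y.
Hypothesis reg : regular f g l r L.

Let infN i y : infconv (g i) (l i) y != -oo%E.
Proof.
have [->//|[c [b [e [_ _ ->]]]]//] := infconv_attained (Gl i) (nuV0 i) (lstrong i) y (Gg i).
Qed.

Lemma primal_attained : exists x c d a (b e : 'I_m -> R),
  [/\ f x = a%:E, forall i, g i (c i) = (b i)%:E,
      forall i, l i (d i) = (e i)%:E, forall i, c i + d i = L i x - r i &
      forall y, ((a + \sum_i (b i + e i) + h x - inner x z)%:E <=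
                 primal_objective f h z g l r L y)%E].
Proof.
have [x xmin] := primal_min.
have Poo : (primal_objective f h z g l r L x < +oo)%E.
  (* Membership of -r in the set says that some [x0] in the domain of [f] has every [L i x0 - r i]
     in dom g_i + dom l_i, so the primal value is not +oo. *)
  have [[a aD [_ [x0 fx0 <-] aE]] _] : sqri _ _ := reg.
  apply: le_lt_trans (xmin x0) _; rewrite /primal_objective.
  have i1 : (\sum_(i < m) infconv (g i) (l i) (L i x0 - r i)%R < +oo)%E.
    apply: lte_sum_pinfty => i _; have [c gc [d ld cd]] := aD i.
    apply: (@le_lt_trans _ _ (g i c + l i d)%E); last exact: lte_add_pinfty.
    apply: ereal_inf_lbound; exists c => //; congr (g i c + l i _)%E.
    have := congr1 (fun y : hprod G => y i) aE.
    have -> : (- (r : hprod G)) i = - r i by [].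
    have -> : (a - ((fun i => L i x0) : hprod G)) i = a i - L i x0 by [].
    rewrite -cd => E; apply/eqP; rewrite -subr_eq0; apply/eqP.
    transitivity (L i x0 + (c + d - L i x0) - c - d); last first.
      by apply: inner_inj => u; rewrite !innerE inner0l; ring.
    by rewrite E.
  by rewrite -EFinN; apply: lte_add_pinfty => //; rewrite ?ltry//;
     apply: lte_add_pinfty => //; rewrite ?ltry//; apply: lte_add_pinfty.
have sN := sum_Nninfty (fun i : 'I_m => infN (L i x - r i)).
have fN := Gamma_Nninfty x Gf.
have [fS] : (f x < +oo)%E /\
    (\sum_(i < m) infconv (g i) (l i) (L i x - r i)%R < +oo)%E.
  move: Poo; rewrite /primal_objective; move: fN sN.
  by case: (f _) (\sum_(i < m) _)%E => [a| |] [b| |]// _ _; rewrite ?ltry.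
move=> /(sum_fin (fun i : 'I_m => infN (L i x - r i)))[q qE].
have [a fa] := ereal_fin fN fS.
have att i : exists p : G i * (R * R), [/\ g i p.1 = (p.2.1)%:E,
    l i (L i x - r i - p.1) = (p.2.2)%:E &
    infconv (g i) (l i) (L i x - r i) = (p.2.1 + p.2.2)%:E].
  have [E|[c [b [e [gc lc E]]]]] :=
      infconv_attained (Gl i) (nuV0 i) (lstrong i) (L i x - r i) (Gg i).
    by have := qE i; rewrite E.
  by exists (c, (b, e)).
pose p i := projT1 (cid (att i)).
have pP i : [/\ g i (p i).1 = ((p i).2.1)%:E,
    l i (L i x - r i - (p i).1) = ((p i).2.2)%:E &
    infconv (g i) (l i) (L i x - r i) = ((p i).2.1 + (p i).2.2)%:E].
  exact: (projT2 (cid (att i))).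
exists x, (fun i => (p i).1), (fun i => L i x - r i - (p i).1), a.
exists (fun i => (p i).2.1), (fun i => (p i).2.2); split => //.
- by move=> i; case: (pP i).
- by move=> i; case: (pP i).
- by move=> i; rewrite addrC subrK.
move=> y; apply: le_trans (xmin y); rewrite /primal_objective fa.
rewrite [in leRHS](eq_bigr (fun i => ((p i).2.1 + (p i).2.2)%:E)).
  by rewrite sumEFin.
by move=> i _; case: (pP i).
Qed.

Lemma optimality_exists : exists x v, optimality_conditions f h z g l r L x v.
Proof.
have [x [c [d [a [b [e [fa gb le cd pmin]]]]]]] := primal_attained.
pose w0 := mkW x c d; pose r0 := a + \sum_i (b i + e i) + h x - inner x z.
have P0 : Phi w0 = r0%:E by exact: PhiE.
have GP : Gamma Phi by apply: (@Gamma_Phi w0); rewrite P0 ltry.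
have T0 : T w0 = 0.
  apply: functional_extensionality_dep => i; rewrite /T /= cd.
  by rewrite [L i x - r i]addrC addrK addNr.
have Pmin w : T w = 0 -> (r0%:E <= Phi w)%E.
  move=> Tw; apply: le_trans (pmin (w None)) _.
  rewrite /primal_objective /Phi; do 3 (apply: leeD => //).
  apply: lee_sum => i _; apply: ereal_inf_lbound.
  exists (w (Some (inl i))) => //; congr (_ + l i _)%E.
  have := congr1 (fun y : hprod G => y i) Tw; rewrite /T => E.
  apply/eqP; rewrite -subr_eq0; apply/eqP.
  transitivity (- ((w (Some (inl i)) : G i) + w (Some (inr i)) - L i (w None) + r i)).
    by apply: inner_inj => u; rewrite !innerE; ring.
  by rewrite E oppr0.
have [_ [regC regS]] : sqri _ _ := reg.
set C1 := (X in closed X) in regC; rewrite -/C1 in regS.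
(* Subtracting the base point -r turns a - L x into the constraint value a - L x + r, so the cone of
   the regularity condition is the one generated by [T] on the domain of [Phi]. *)
have CE : C1 = [set y | exists t w, [/\ 0 < t, edom Phi w & y = t *: T w]].
  apply/seteqP; split => [y [t t0 [s [a' a'D [_ [x' fx' <-] <-]] <-]]|].
    have ex i : exists p : G i * G i,
        [/\ edom (g i) p.1, edom (l i) p.2 & p.1 + p.2 = a' i].
      by have [c' gc' [d' ld' cd']] := a'D i; exists (c', d').
    pose p i := projT1 (cid (ex i)).
    have pP i : [/\ edom (g i) (p i).1, edom (l i) (p i).2 &
      (p i).1 + (p i).2 = a' i] by exact: (projT2 (cid (ex i))).
    exists t, (mkW x' (fun i => (p i).1) (fun i => (p i).2)); split => //.
      rewrite /edom/= /Phi/=.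
      apply: lte_add_pinfty; last exact: ltry.
      apply: lte_add_pinfty; last exact: ltry.
      apply: lte_add_pinfty => //; apply: lte_sum_pinfty => i _.
      by have [h1 h2 _] := pP i; exact: lte_add_pinfty.
    congr (t *: _); apply: functional_extensionality_dep => i.
    by rewrite /T /=; have [_ _ ->] := pP i; rewrite -[r i]opprK.
  move=> y [t [w [t0 Pw ->]]]; have [a' [b' [e' [fa' gb' le' _]]]] := PhiP Pw.
  exists t => //.
  pose a1 : hprod G := fun i => (w (Some (inl i)) : G i) + w (Some (inr i)).
  pose b1 : hprod G := fun i => L i (w None).
  exists (a1 - b1).
    exists a1.
      move=> i; exists (w (Some (inl i))); first by rewrite /edom/= gb' ltry.
      by exists (w (Some (inr i))) => //; rewrite /edom/= le' ltry.
    exists b1 => //.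
    by exists (w None) => //; rewrite /edom/= fa' ltry.
  congr (t *: _); apply: functional_extensionality_dep => i.
  by rewrite /T /= -[r i in RHS]opprK.
rewrite CE in regC regS.
have [v vP] := lagrange_multiplier GP T_continuous T_affine T0 P0 Pmin regC regS.
have slack x' c' d' a' (b' e' : 'I_m -> R) : f x' = a'%:E ->
    (forall i, g i (c' i) = (b' i)%:E) -> (forall i, l i (d' i) = (e' i)%:E) ->
    r0 <= a' + \sum_i (b' i + e' i) + h x' - inner x' z
      + \sum_i inner (v i) (c' i + d' i - L i x' + r i).
  move=> fa' gb' le'.
  have le1 : (Phi (mkW x' c' d') <=
    (a' + \sum_i (b' i + e' i) + h x' - inner x' z)%:E)%E.
    by rewrite (PhiE fa' gb' le').
  exact: (vP _ _ le1).
(* Only the i-th pair is changed: the other constraint residuals stay 0 and the other values cancel,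
   which separates the Lagrange inequality into coordinates. *)
have slack1 i c1 d1 (s1 t1 : R) : g i c1 = s1%:E -> l i d1 = t1%:E ->
    b i + e i <= s1 + t1 + inner (v i) (c1 - c i + (d1 - d i)).
  move=> gs lt.
  have := @slack x (dfwith c i c1) (dfwith d i d1) a (fun j => if j == i then s1 else b j)
    (fun j => if j == i then t1 else e j) fa.
  have /[swap]/[apply] : forall j, g j (dfwith c i c1 j) =
      (if j == i then s1 else b j)%:E.
    by move=> j; case: eqVneq => [->|ji]; rewrite ?dfwithin// dfwithout// eq_sym.
  have /[swap]/[apply] : forall j, l j (dfwith d i d1 j) =
      (if j == i then t1 else e j)%:E.
    by move=> j; case: eqVneq => [->|ji]; rewrite ?dfwithin// dfwithout// eq_sym.
  set S := \sum_j ((if _ then _ else _) + _); set S' := \sum_j inner _ _.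
  have -> : S = s1 + t1 + \sum_(j | j != i) (b j + e j).
    rewrite /S (bigD1 i)//= eqxx; congr (_ + _).
    by apply: eq_bigr => j /negPf ->.
  have -> : S' = inner (v i) (c1 - c i + (d1 - d i)).
    rewrite /S' (bigD1 i)//= !dfwithin big1 ?addr0 => [|j ji].
      congr (inner _ _); have -> : L i x = c i + d i + r i by rewrite cd subrK.
      by apply: inner_inj => u; rewrite !innerE; ring.
    rewrite !dfwithout ?(eq_sym i)// cd.
    by rewrite [L j x - r j]addrC addrK addNr inner0r.
  rewrite /r0 (bigD1 i)//=; lra.
(* The sign changes because the multiplier enters the Lagrange inequality with a plus on the side of
   the competitor, whereas a subgradient stands on the side of the minimum. *)
exists x, (fun i => - v i); split; last first.
  move=> i; exists (c i); last exists (d i); last exact: cd.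
    apply: (subdiffI (gb i)) => c1 s gs.
    have [s1 gs1 s1s] := ereal_le_fin (Gamma_Nninfty c1 (Gg i)) gs.
    have := slack1 i c1 (d i) s1 (e i) gs1 (le i).
    by rewrite subrr addr0 innerNl; lra.
  apply: (subdiffI (le i)) => d1 s ls.
  have [s1 ls1 s1s] := ereal_le_fin (Gamma_Nninfty d1 (Gl i)) ls.
  have := slack1 i (c i) d1 (b i) s1 (gb i) ls1.
  by rewrite subrr add0r innerNl; lra.
exists (z - \sum_i adjoint (L i) (- v i) - grad h x); last by rewrite subrK.
(* Replacing [h] by its linearization at [x] costs a quadratic error, which does not affect the
   subgradient of [f]. *)
apply: (subdiff_quad (C := mu) Gf fa) => x' s fs.
have [s1 fs1 s1s] := ereal_le_fin (Gamma_Nninfty x' Gf) fs.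
have := slack x' c d s1 b e fs1 gb le; have := smooth_upper x x'.
have -> : \sum_i inner (v i) (c i + d i - L i x' + r i) =
    inner (\sum_i adjoint (L i) (- v i)) (x' - x).
  rewrite innerC inner_sumr; apply: eq_bigr => i _.
  rewrite -(adjointP (@Lc i)) cd linearB innerNr innerC -innerNl.
  by congr (inner _ _); apply: inner_inj => u; rewrite !innerE; ring.
rewrite /r0 !innerE (innerC x z) (innerC x' z); lra.
Qed.

End Optimality.

(** * Equality of the primal and dual values *)

Section Duality.
Context {R : realType} {H : hilbertType R} {m : nat} {G : 'I_m -> hilbertType R}.
Variables (f : H -> \bar R) (h : H -> R) (z : H).
Variables (g l : forall i, G i -> \bar R) (r : forall i, G i).
Variable L : forall i, {linear H -> G i}.
Arguments g : clear implicits.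
Arguments l : clear implicits.
Hypothesis hconv : forall x y (t : R), 0 < t < 1 ->
  h (t *: x + (1 - t) *: y) <= t * h x + (1 - t) * h y.
Hypothesis hdiff : forall y, differentiable h y.
Hypothesis Lc : forall i, continuous (L i).

Lemma inner_adjoint_sum (v : forall i, G i) y :
  inner (\sum_i adjoint (L i) (v i)) y = \sum_i inner (v i) (L i y).
Proof.
rewrite innerC inner_sumr; apply: eq_bigr => i _.
by rewrite -(adjointP (@Lc i)) innerC.
Qed.

(** All four comparisons are made with one real number [p], the primal value at [x] with the infimal
    convolutions split as the optimality conditions prescribe; equality in Fenchel-Young makes the
    dual value at [v] agree with it. *)
Lemma strong_duality x v : optimality_conditions f h z g l r L x v ->
  [/\ minimizer (primal_objective f h z g l r L) x,
      maximizer (dual_objective f h z g l r L) v &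
      ereal_inf (range (primal_objective f h z g l r L)) =
      ereal_sup (range (dual_objective f h z g l r L))].
Proof.
move=> [[w fw wE] gl].
have ex i : exists q : G i * G i, [/\ subdiff (g i) q.1 (v i),
    subdiff (l i) q.2 (v i) & q.1 + q.2 = L i x - r i].
  by have [c gc [d ld cd]] := gl i; exists (c, d).
pose c i := (projT1 (cid (ex i))).1; pose d i := (projT1 (cid (ex i))).2.
have cdP i : [/\ subdiff (g i) (c i) (v i), subdiff (l i) (d i) (v i) &
    c i + d i = L i x - r i] by exact: (projT2 (cid (ex i))).
have [a fa _] := subdiff_le fw.
pose b i := fine (g i (c i)); pose e i := fine (l i (d i)).
have gb i : g i (c i) = (b i)%:E.
  by have [gc _ _] := cdP i; have [q gq _] := subdiff_le gc; rewrite /b gq.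
have le i : l i (d i) = (e i)%:E.
  by have [_ ld _] := cdP i; have [q lq _] := subdiff_le ld; rewrite /e lq.
have cd i : c i + d i = L i x - r i by case: (cdP i).
have hsub := subdiff_grad hconv (hdiff x).
pose p := a + \sum_i (b i + e i) + h x - inner x z.
have Px : (primal_objective f h z g l r L x <= p%:E)%E.
  rewrite /primal_objective fa /p EFinB !EFinD.
  apply: leeD => //; apply: leeD => //; apply: leeD => //.
  rewrite -sumEFin; apply: lee_sum => i _; rewrite EFinD -gb -le.
  apply: ereal_inf_lbound; exists (c i) => //.
  by rewrite -cd [(c i + d i)%R]addrC addrK.
have Py y : (p%:E <= primal_objective f h z g l r L y)%E.
  have [_ /(_ y) fy] := fw; rewrite fa -EFinD in fy.
  have sy : ((\sum_i (b i + e i + inner (v i) (L i (y - x))))%:E <=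
      \sum_(i < m) infconv (g i) (l i) (L i y - r i)%R)%E.
    rewrite -sumEFin; apply: lee_sum => i _.
    apply: le_ereal_inf_tmp => _ [c' _ <-].
    have [[_ /(_ c') gc] [_ /(_ (L i y - r i - c')) ld] _] := cdP i.
    apply: le_trans (leeD gc ld); rewrite gb le -!EFinD lee_fin.
    rewrite -addrACA lerD2l -innerDr linearB.
    rewrite (_ : L i y - L i x = c' - c i + (L i y - r i - c' - d i))//.
    have -> : L i x = c i + d i + r i by rewrite cd subrK.
    by apply: inner_inj => u; rewrite !innerE; ring.
  apply: (@le_trans _ _ ((a + inner w (y - x)
      + \sum_i (b i + e i + inner (v i) (L i (y - x))) + h y - inner y z)%:E)).
    rewrite lee_fin /p [X in _ <= _ + X + _ - _](_ : _ = \sum_i (b i + e i) +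
      inner (\sum_i adjoint (L i) (v i)) (y - x)); last first.
      by rewrite inner_adjoint_sum -big_split.
    have -> : \sum_i adjoint (L i) (v i) = z - (w + grad h x).
      by rewrite wE opprB addrC subrK.
    have := convex_grad_le y hconv (hdiff x).
    rewrite !innerE (innerC x z) (innerC y z); lra.
  rewrite /primal_objective EFinB !EFinD.
  by apply: leeD => //; apply: leeD => //; apply: leeD.
(* Weak duality, by testing each conjugate at the fixed points [x], [c i] and [d i]. *)
have Du u : (dual_objective f h z g l r L u <= p%:E)%E.
  pose s := z - \sum_i adjoint (L i) (u i).
  have I1 : ((inner s x - a - h x)%:E <=
      infconv (conjugate f) (conjugate (EFin \o h)) s)%E.
    apply: le_ereal_inf_tmp => _ [y _ <-].
    apply: le_trans (leeD (conjugate_ge y fa)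
      (conjugate_ge (s - y) (erefl ((EFin \o h) x)))).
    by rewrite -EFinD lee_fin !innerE; lra.
  have I2 : ((\sum_i (inner (u i) (L i x) - (b i + e i)))%:E <=
      \sum_(i < m) (conjugate (g i) (u i) + conjugate (l i) (u i)
                    + (inner (u i) (r i))%:E))%E.
    rewrite -sumEFin; apply: lee_sum => i _.
    have h1 := conjugate_ge (u i) (gb i); have h2 := conjugate_ge (u i) (le i).
    apply: le_trans (leeD (leeD h1 h2) (lexx _)).
    rewrite -!EFinD lee_fin.
    have -> : L i x = c i + d i + r i by rewrite cd subrK.
    by rewrite !innerE; lra.
  apply: (@le_trans _ _ (- (inner s x - a - h x)
      - \sum_i (inner (u i) (L i x) - (b i + e i)))%:E); last first.
    rewrite lee_fin sumrB -inner_adjoint_sum /p /s !innerE (innerC x z); lra.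
  by rewrite EFinB EFinN; apply: leeB; rewrite ?leeN2.
have Dv : (p%:E <= dual_objective f h z g l r L v)%E.
  pose s := z - \sum_i adjoint (L i) (v i).
  have I1 : (infconv (conjugate f) (conjugate (EFin \o h)) s <=
      (inner s x - a - h x)%:E)%E.
    apply: (@le_trans _ _ (conjugate f w + conjugate (EFin \o h) (s - w)%R)%E).
      by apply: ereal_inf_lbound; exists w.
    have sw : s - w = grad h x by rewrite /s -wE [w + _]addrC addrK.
    rewrite sw (conjugate_subdiff fa fw).
    rewrite (conjugate_subdiff (erefl ((EFin \o h) x)) hsub).
    by rewrite -EFinD lee_fin -sw !innerE; lra.
  have I2 : (\sum_(i < m) (conjugate (g i) (v i) + conjugate (l i) (v i)
      + (inner (v i) (r i))%:E) <= (\sum_i (inner (v i) (L i x) - (b i + e i)))%:E)%E.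
    rewrite -sumEFin; apply: lee_sum => i _; have [gc ld _] := cdP i.
    rewrite (conjugate_subdiff (gb i) gc) (conjugate_subdiff (le i) ld).
    rewrite -!EFinD lee_fin.
    have -> : L i x = c i + d i + r i by rewrite cd subrK.
    by rewrite !innerE; lra.
  apply: (@le_trans _ _ (- (inner s x - a - h x)
      - \sum_i (inner (v i) (L i x) - (b i + e i)))%:E).
    rewrite lee_fin sumrB -inner_adjoint_sum /p /s !innerE (innerC x z); lra.
  by rewrite EFinB EFinN; apply: leeB; rewrite ?leeN2.
split.
- by move=> y; exact: le_trans Px (Py y).
- by move=> u; exact: le_trans (Du u) Dv.
- transitivity p%:E; apply/eqP; rewrite eq_le; apply/andP; split.
  + by apply: le_trans Px; apply: ereal_inf_lbound; exists x.
  + by apply: le_ereal_inf_tmp => _ [y _ <-]; exact: Py.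
  + by apply: le_trans Dv _; apply: ereal_sup_ubound; exists v.
  + by apply: ge_ereal_sup => _ [u _ <-]; exact: Du.
Qed.

End Duality.

(** * The primal-dual operators *)

Section PrimalDualOperators.
Context {R : realType} {H : hilbertType R} {m : nat} {G : 'I_m -> hilbertType R}.
Variables (f : H -> \bar R) (h : H -> R) (z : H) (mu : R).
Variables (g l : forall i, G i -> \bar R) (r : forall i, G i) (nu : 'I_m -> R).
Variable L : forall i, {linear H -> G i}.
Arguments g : clear implicits.
Arguments l : clear implicits.
Hypothesis Gf : Gamma f.
Hypothesis hconv : forall x y (t : R), 0 < t < 1 ->
  h (t *: x + (1 - t) *: y) <= t * h x + (1 - t) * h y.
Hypothesis hdiff : forall y, differentiable h y.
Hypothesis hlip : forall x y, `|grad h x - grad h y| <= mu * `|x - y|.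
Hypothesis Gg : forall i, Gamma (g i).
Hypothesis Gl : forall i, Gamma (l i).
Hypothesis nu0 : forall i, 0 < nu i.
Hypothesis mu0 : 0 < mu.
Hypothesis lstrong : forall i, strongly_convex (nu i)^-1 (l i).
Hypothesis Lc : forall i, continuous (L i).

Definition pd_space (o : option 'I_m) : hilbertType R :=
  if o is Some i then G i else H.

Definition pd_pair (x : H) (v : forall i, G i) : hprod pd_space := fun o =>
  match o return pd_space o with None => x | Some i => v i end.

Definition pd_function (o : option 'I_m) : pd_space o -> \bar R :=
  match o return pd_space o -> \bar R with
  | None => f | Some i => conjugate (g i) end.

Definition pd_smooth (o : option 'I_m) : pd_space o -> \bar R :=
  match o return pd_space o -> \bar R with
  | None => EFin \o h | Some i => conjugate (l i) end.

Definition pd_grad (o : option 'I_m) : pd_space o -> pd_space o :=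
  match o return pd_space o -> pd_space o with
  | None => grad h | Some i => grad (fine \o conjugate (l i)) end.
Arguments pd_function : clear implicits.
Arguments pd_smooth : clear implicits.
Arguments pd_grad : clear implicits.

(* The shift by - z and r is put into pd_B, so that the resolvent of pd_A is
   made of plain proximal points. *)
Definition pd_A (s : hprod pd_space) : set (hprod pd_space) :=
  [set u | forall o, subdiff (pd_function o) (s o) (u o)].

Definition pd_skew (s : hprod pd_space) : hprod pd_space :=
  pd_pair (\sum_i adjoint (L i) (s (Some i))) (fun i => - L i (s None)).

Definition pd_B (s : hprod pd_space) : hprod pd_space := fun o =>
  pd_grad o (s o) + pd_skew s o + pd_pair (- z) r o.

Lemma Gamma_pd_function o : Gamma (pd_function o).
Proof. by case: o => [i|] //; exact: (Gamma_conjugate (Gg i)). Qed.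

Let nuV0 i : 0 < (nu i)^-1. Proof. by rewrite invr_gt0. Qed.

Lemma pd_grad_subdiff o x : subdiff (pd_smooth o) x (pd_grad o x).
Proof.
case: o x => [i|] x; last exact: subdiff_grad.
apply: subdiff_conjugate.
exact: (conjugate_grad_subdiff (Gl i) (nuV0 i) (lstrong i)).
Qed.

Lemma pd_grad_monotone o x y : 0 <= inner (pd_grad o x - pd_grad o y) (x - y).
Proof. by apply: subdiff_monotone; exact: pd_grad_subdiff. Qed.

Let mx := \big[Num.max/mu]_(i < m) nu i.

Let mx_ge0 : 0 <= mx.
Proof. by apply: le_trans (ltW mu0) _; exact: bigmax_ge_id. Qed.

Lemma pd_grad_lipschitz o x y : `|pd_grad o x - pd_grad o y| <= mx * `|x - y|.
Proof.
case: o x y => [i|] x y.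
  apply: le_trans (conjugate_grad_lipschitz (Gl i) (nuV0 i) (lstrong i) x y) _.
  by rewrite invrK ler_wpM2r//; exact: le_bigmax.
apply: le_trans (hlip x y) _.
by rewrite ler_wpM2r//; exact: bigmax_ge_id.
Qed.

Lemma pd_A_monotone x y u v : pd_A x u -> pd_A y v -> 0 <= inner (u - v) (x - y).
Proof.
move=> xu yv; rewrite hprod_innerE; apply: sumr_ge0 => o _.
exact: subdiff_monotone (xu o) (yv o).
Qed.

Lemma pd_A_resolvent (gamma : R) x : 0 < gamma ->
  exists p, pd_A p (gamma^-1 *: (x - p)).
Proof.
move=> g0; exists (fun o => prox gamma (pd_function o) (x o)) => o.
exact: prox_subdiff (Gamma_pd_function o) g0.
Qed.

Lemma pd_skew_inner s : inner (pd_skew s) s = 0.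
Proof.
rewrite hprod_innerE big_option /= innerC inner_sumr -big_split/= big1// => i _.
by rewrite -(adjointP (@Lc i)) innerNl subrr.
Qed.

Lemma pd_B_sub x y : pd_B x - pd_B y =
  ((fun o => pd_grad o (x o) - pd_grad o (y o)) : hprod pd_space) + pd_skew (x - y).
Proof.
apply: functional_extensionality_dep => o.
have -> : (pd_B x - pd_B y) o = pd_B x o - pd_B y o by [].
have -> : forall a b : hprod pd_space, (a + b) o = a o + b o by [].
have -> : pd_skew (x - y) o = pd_skew x o - pd_skew y o.
  case: o => [i|] /=.
    by rewrite (linearB (L i)) opprB addrC opprK.
  rewrite -sumrB; apply: eq_bigr => i _.
  by rewrite -adjointN// -adjointD.
by apply: inner_inj => u; rewrite /pd_B !innerE; ring.
Qed.

Lemma pd_B_inner x y : inner (pd_B x - pd_B y) (x - y) =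
  \sum_o inner (pd_grad o (x o) - pd_grad o (y o)) (x o - y o).
Proof. by rewrite pd_B_sub innerDl pd_skew_inner addr0. Qed.

Lemma pd_B_monotone x y : 0 <= inner (pd_B x - pd_B y) (x - y).
Proof.
by rewrite pd_B_inner; apply: sumr_ge0 => o _; exact: pd_grad_monotone.
Qed.

Let Lam := Num.sqrt (\sum_i opnorm (L i) ^+ 2).

Let stack (x : H) : hprod G := fun i => L i x.

Let stack_le x : `|stack x| <= Lam * `|x|.
Proof.
have q0 : 0 <= \sum_i opnorm (L i) ^+ 2 by apply: sumr_ge0 => i _; exact: sqr_ge0.
rewrite -(@ler_pXn2r _ 2) ?nnegrE ?mulr_ge0 ?sqrtr_ge0//.
rewrite exprMn /Lam (sqr_sqrtr q0) hprod_norm_sqr mulr_suml; apply: ler_sum => i _.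
by rewrite -exprMn ler_pXn2r ?nnegrE ?mulr_ge0 ?opnorm_ge0// opnorm_le.
Qed.

(** The sum is the adjoint of [stack] applied to [v], so pairing it with itself transfers the bound
    for [stack]. *)
Let adjoint_sum_le (v : hprod G) : `|\sum_i adjoint (L i) (v i)| <= Lam * `|v|.
Proof.
set S := \sum_i _; have [->|S0] := eqVneq S 0.
  by rewrite normr0 mulr_ge0 ?sqrtr_ge0.
rewrite -(@ler_pM2r _ `|S|) ?normr_gt0// -expr2 -inner_norm.
have -> : inner S S = inner v (stack S).
  rewrite {1}/S hprod_innerE innerC inner_sumr; apply: eq_bigr => i _.
  by rewrite -adjointP// innerC.
apply: le_trans (inner_le _ _) _.
by rewrite mulrAC mulrC ler_wpM2r// stack_le.
Qed.

(** The two blocks act on, and map into, mutually orthogonal components; their squared bounds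
    therefore add up without doubling the constant. *)
Lemma pd_skew_le s : `|pd_skew s| <= Lam * `|s|.
Proof.
rewrite -(@ler_pXn2r _ 2) ?nnegrE ?mulr_ge0 ?sqrtr_ge0//.
rewrite exprMn !hprod_norm_sqr !big_option /= mulrDr addrC.
pose v : hprod G := fun i => s (Some i).
have -> : \sum_i `|- L i (s None)| ^+ 2 = `|stack (s None)| ^+ 2.
  by rewrite hprod_norm_sqr; apply: eq_bigr => i _; rewrite normrN.
have -> : \sum_i `|s (Some i)| ^+ 2 = `|v| ^+ 2 by rewrite hprod_norm_sqr.
by rewrite -!exprMn; apply: lerD; rewrite ler_pXn2r ?nnegrE ?mulr_ge0 ?sqrtr_ge0.
Qed.

Lemma pd_B_lipschitz x y : `|pd_B x - pd_B y| <= (mx + Lam) * `|x - y|.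
Proof.
rewrite pd_B_sub; apply: le_trans (ler_normD _ _) _; rewrite mulrDl.
apply: lerD; last exact: pd_skew_le.
rewrite -(@ler_pXn2r _ 2) ?nnegrE ?mulr_ge0//.
rewrite exprMn !hprod_norm_sqr mulr_sumr; apply: ler_sum => o _.
by rewrite -exprMn ler_pXn2r ?nnegrE ?mulr_ge0// pd_grad_lipschitz.
Qed.

Lemma pd_optimality x v : optimality_conditions f h z g l r L x v <->
  pd_A (pd_pair x v) (- pd_B (pd_pair x v)).
Proof.
rewrite (optimality_conditionsP f h z r L Gg Gl nu0 lstrong) /pd_A /=.
have EN : (- pd_B (pd_pair x v)) None =
    z - \sum_i adjoint (L i) (v i) - grad h x.
  have -> : (- pd_B (pd_pair x v)) None = - (pd_B (pd_pair x v) None) by [].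
  by apply: inner_inj => u; rewrite /pd_B /= !innerE; ring.
have ES i : (- pd_B (pd_pair x v)) (Some i) =
    L i x - r i - grad (fine \o conjugate (l i)) (v i).
  have -> : (- pd_B (pd_pair x v)) (Some i) = - (pd_B (pd_pair x v) (Some i)) by [].
  by apply: inner_inj => u; rewrite /pd_B /= !innerE; ring.
split=> [[fx gl] [i|]|xv]; first by rewrite ES; exact: gl.
  by rewrite EN.
by split => [|i]; [have := xv None; rewrite EN|have := xv (Some i); rewrite ES].
Qed.

(** The skew part and the constant shift cancel in the right-hand side, leaving a sum of nonnegative
    gaps; the left-hand side is the gap of the coordinate [o]. *)
Lemma pd_gap_le p w s o : pd_A p (w - pd_B p) -> pd_A s (- pd_B s) ->
  inner ((w - pd_B p) o + pd_grad o (p o) - ((- pd_B s) o + pd_grad o (s o)))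
    (p o - s o) <= inner w (p - s).
Proof.
move=> pw ss.
have -> : inner w (p - s) = inner ((w - pd_B p) - (- pd_B s)) (p - s)
    + inner (pd_B p - pd_B s) (p - s).
  by rewrite !innerE; ring.
rewrite pd_B_inner hprod_innerE -big_split/=.
apply: le_trans (sum_le_point o _); last first.
  move=> o'; apply: addr_ge0; last exact: pd_grad_monotone.
  exact: subdiff_monotone (pw o') (ss o').
have -> : (w - pd_B p - - pd_B s) o = (w - pd_B p) o - (- pd_B s) o by [].
by rewrite le_eqVlt; apply/orP; left; apply/eqP; rewrite !innerE; ring.
Qed.

Lemma pd_cvg (p w : nat -> hprod pd_space) s o :
  (forall n, pd_A (p n) (w n - pd_B (p n))) -> pd_A s (- pd_B s) ->
  (fun n => inner (w n) (p n - s)) @ \oo --> (0 : R) ->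
  uniformly_convex (fun y => pd_function o y + pd_smooth o y)%E ->
  (fun n => p n o) @ \oo --> s o.
Proof.
move=> pw ss w0 uc; apply: (uniformly_convex_cvg uc) w0.
- by move=> n; apply: subdiff_add; [exact: pw|exact: pd_grad_subdiff].
- by apply: subdiff_add; [exact: ss|exact: pd_grad_subdiff].
- by move=> n; exact: pd_gap_le.
Qed.

End PrimalDualOperators.

Theorem theorem12 (R : realType) (H : hilbertType R) (z : H)
  (f : H -> \bar R) (h : H -> R) (mu : R)
  (m : nat) (G : 'I_m -> hilbertType R) (r : forall i, G i)
  (g l : forall i, G i -> \bar R) (nu : 'I_m -> R)
  (L : forall i, {linear H -> G i})
  (beta lambda sigma alpha1 alpha2 : R)
  (lambda_ alpha1_ alpha2_ : nat -> R)
  (x p1 : nat -> H) (v p2 : forall i, nat -> G i) :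
  Gamma f ->
  convex_function (setT : set (convex_lmodType H)) h ->
  (forall y, differentiable h y) ->
  0 < mu -> mu.-lipschitz (grad h) ->
  (0 < m)%N ->
  (forall i, Gamma (g i)) ->
  (forall i, Gamma (l i)) ->
  (forall i, 0 < nu i) ->
  (forall i, strongly_convex (nu i)^-1 (l i)) ->
  (forall i, continuous (L i)) ->
  (forall i, exists y, L i y != 0) ->
  (exists y, minimizer (primal_objective f h z g l r L) y) ->
  regular f g l r L ->
  beta = \big[Num.max/mu]_(i < m) nu i
         + Num.sqrt (\sum_(i < m) opnorm (L i) ^+ 2) ->
  0 < lambda -> 0 < sigma -> 0 <= alpha1 -> 0 <= alpha2 ->
  12 * alpha2 ^+ 2 + 9 * (alpha1 + alpha2) + 4 * sigma < 1 ->
  (forall n, (1 <= n)%N -> lambda <= lambda_ n /\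
    lambda_ n <= beta^-1 * Num.sqrt
      ((1 - 12 * alpha2 ^+ 2 - 9 * (alpha1 + alpha2) - 4 * sigma) /
       (12 * alpha2 ^+ 2 + 8 * (alpha1 + alpha2) + 4 * sigma + 2))) ->
  alpha1_ 1%N = 0 -> alpha2_ 1%N = 0 ->
  (forall n, (1 <= n)%N -> alpha1_ n <= alpha1_ n.+1) ->
  (forall n, (1 <= n)%N -> alpha2_ n <= alpha2_ n.+1) ->
  (forall n, (1 <= n)%N -> 0 <= alpha1_ n <= alpha1) ->
  (forall n, (1 <= n)%N -> 0 <= alpha2_ n <= alpha2) ->
  (forall n, (1 <= n)%N ->
    p1 n = prox (lambda_ n) f
      (x n - lambda_ n *: (grad h (x n)
                           + \sum_(i < m) adjoint (L i) (v i n) - z)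
       + alpha1_ n *: (x n - x n.-1))) ->
  (forall n i, (1 <= n)%N ->
    p2 i n = prox (lambda_ n) (conjugate (g i))
      (v i n + lambda_ n *: (L i (x n)
                             - grad (fine \o conjugate (l i)) (v i n) - r i)
       + alpha1_ n *: (v i n - v i n.-1))) ->
  (forall n i, (1 <= n)%N ->
    v i n.+1 = lambda_ n *: L i (p1 n - x n)
      + lambda_ n *: (grad (fine \o conjugate (l i)) (v i n)
                      - grad (fine \o conjugate (l i)) (p2 i n))
      + p2 i n + alpha2_ n *: (v i n - v i n.-1)) ->
  (forall n, (1 <= n)%N ->
    x n.+1 = lambda_ n *: (\sum_(i < m) adjoint (L i) (v i n - p2 i n))
      + lambda_ n *: (grad h (x n) - grad h (p1 n))
      + p1 n + alpha2_ n *: (x n - x n.-1)) ->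
  [/\ (\sum_(0 <= n <oo) (`|x n.+1 - x n| ^+ 2)%:E < +oo)%E,
      (\sum_(1 <= n <oo) (`|x n - p1 n| ^+ 2)%:E < +oo)%E,
      forall i, (\sum_(0 <= n <oo) (`|v i n.+1 - v i n| ^+ 2)%:E < +oo)%E &
      forall i, (\sum_(1 <= n <oo) (`|v i n - p2 i n| ^+ 2)%:E < +oo)%E]
  /\
  exists (xbar : H) (vbar : forall i, G i),
    [/\ optimality_conditions f h z g l r L xbar vbar,
        [/\ minimizer (primal_objective f h z g l r L) xbar,
            maximizer (dual_objective f h z g l r L) vbar &
            ereal_inf (range (primal_objective f h z g l r L)) =
            ereal_sup (range (dual_objective f h z g l r L))],
        [/\ weakly_cvg x xbar, weakly_cvg p1 xbar,
            forall i, weakly_cvg (v i) (vbar i) &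
            forall i, weakly_cvg (p2 i) (vbar i)],
        uniformly_convex (fun y => f y + (h y)%:E)%E ->
          x @ \oo --> xbar /\ p1 @ \oo --> xbar &
        forall i,
          uniformly_convex
            (fun y => conjugate (g i) y + conjugate (l i) y)%E ->
          v i @ \oo --> vbar i /\ p2 i @ \oo --> vbar i].
Proof.
move=> Gf hconvf hdiff mu0 hlipf m0 Gg Gl nu0 lsc Lc Lnz pmin reg betaE.
move=> lambda0 sigma0 al10 al20 als lamP a11 a21 a1nd a2nd a1le a2le p1E p2E vE xE.
have hconv x' y t : 0 < t < 1 ->
    h (t *: x' + (1 - t) *: y) <= t * h x' + (1 - t) * h y.
  move=> /andP[/ltW t0 /ltW t1].
  by have := hconvf (Itv01 t0 t1) x' y; rewrite !inE => /(_ I I).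
have hlip x' y : `|grad h x' - grad h y| <= mu * `|x' - y|.
  by have := hlipf (x', y); apply.
have [xs [vs opt]] :=
  optimality_exists Gf hconv hdiff hlip Gg Gl nu0 lsc Lc pmin reg.
pose A := pd_A f g; pose B := pd_B h z l r L.
pose zn n : hprod pd_space := pd_pair (x n) (fun i => v i n).
pose pn n : hprod pd_space := pd_pair (p1 n) (fun i => p2 i n).
have beta0 : 0 < beta.
  rewrite betaE ltr_pwDl ?sqrtr_ge0//; apply: lt_le_trans mu0 _.
  exact: bigmax_ge_id.
have Blip : forall s t, `|B s - B t| <= beta * `|s - t|.
  by rewrite betaE; exact: pd_B_lipschitz.
have lam_ge n : lambda <= lambda_ n.+1 by case: (lamP n.+1 isT).
(* The upper bound on the step size, squared and cleared of denominators. *)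
have lam_le n : (lambda_ n.+1 * beta) ^+ 2 *
    (12 * alpha2 ^+ 2 + 8 * (alpha1 + alpha2) + 4 * sigma + 2) <=
    1 - 12 * alpha2 ^+ 2 - 9 * (alpha1 + alpha2) - 4 * sigma.
  have [h1 h2] := lamP n.+1 isT; have q0 : 0 <= alpha2 ^+ 2 by exact: sqr_ge0.
  have D0 : 0 < 12 * alpha2 ^+ 2 + 8 * (alpha1 + alpha2) + 4 * sigma + 2 by lra.
  rewrite -ler_pdivlMr//; move: h2; set q := _ / _ => h2.
  have q1 : 0 <= q by rewrite divr_ge0 ?(ltW D0)//; lra.
  rewrite -(sqr_sqrtr q1) ler_pXn2r ?nnegrE ?sqrtr_ge0//.
    by rewrite -ler_pdivlMr// mulrC.
  by rewrite mulr_ge0 ?(ltW beta0)// (le_trans (ltW lambda0)).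
have Hp n : A (pn n.+1) ((lambda_ n.+1)^-1 *: (zn n.+1
    - lambda_ n.+1 *: B (zn n.+1) + alpha1_ n.+1 *: (zn n.+1 - zn n) - pn n.+1)).
  have lam0 : 0 < lambda_ n.+1 by exact: lt_le_trans (lam_ge n).
  case=> [i|].
    have := prox_subdiff (v i n.+1 + lambda_ n.+1 *: (L i (x n.+1)
      - grad (fine \o conjugate (l i)) (v i n.+1) - r i)
      + alpha1_ n.+1 *: (v i n.+1 - v i n)) (Gamma_conjugate (Gg i)) lam0.
    rewrite -(p2E n.+1 i isT); congr (subdiff _ _ (_ *: _)); congr (_ - _).
    rewrite -[RHS]/(v i n.+1 - lambda_ n.+1 *: B (zn n.+1) (Some i)
      + alpha1_ n.+1 *: (v i n.+1 - v i n)).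
    by apply: inner_inj => u; rewrite /B /pd_B /= !innerE; ring.
  have := prox_subdiff (x n.+1 - lambda_ n.+1 *: (grad h (x n.+1)
    + \sum_(i < m) adjoint (L i) (v i n.+1) - z)
    + alpha1_ n.+1 *: (x n.+1 - x n)) Gf lam0.
  by rewrite -(p1E n.+1 isT).
have Hz n : zn n.+2 = pn n.+1 + lambda_ n.+1 *: (B (zn n.+1) - B (pn n.+1))
    + alpha2_ n.+1 *: (zn n.+1 - zn n).
  apply: functional_extensionality_dep => -[i|].
    rewrite -[RHS]/(p2 i n.+1 + lambda_ n.+1 *: (B (zn n.+1) (Some i)
      - B (pn n.+1) (Some i)) + alpha2_ n.+1 *: (v i n.+1 - v i n)).
    rewrite -[LHS]/(v i n.+2) (vE n.+1 i isT) (linearB (L i)).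
    by apply: inner_inj => u; rewrite /B /pd_B /= !innerE; ring.
  rewrite -[RHS]/(p1 n.+1 + lambda_ n.+1 *: (B (zn n.+1) None
    - B (pn n.+1) None) + alpha2_ n.+1 *: (x n.+1 - x n)).
  rewrite -[LHS]/(x n.+2) (xE n.+1 isT).
  have -> : \sum_(i < m) adjoint (L i) (v i n.+1 - p2 i n.+1) =
      \sum_i adjoint (L i) (v i n.+1) - \sum_i adjoint (L i) (p2 i n.+1).
    by rewrite -sumrB; apply: eq_bigr => i _; rewrite adjointD// adjointN.
  by apply: inner_inj => u; rewrite /B /pd_B /= !innerE; ring.
have zero : exists s, A s (- B s).
  by exists (pd_pair xs vs); apply/(pd_optimality f h z r L Gg Gl nu0 lsc).
have [[Cd dC] [Ce eC] pz0 _ [s [As zs ws]]] := inertial_convergence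
  (@pd_A_monotone _ _ _ _ f g) (pd_A_resolvent Gf Gg)
  (pd_B_monotone z r hconv hdiff Gl nu0 lsc Lc) beta0 Blip lambda0 sigma0 al20 als
  lam_ge lam_le a11 a21 (fun n => a1nd n.+1 isT) (fun n => a2nd n.+1 isT)
  (fun n => a1le n.+1 isT) (fun n => a2le n.+1 isT) Hp Hz
  zero.
have coord_sq (w : hprod (@pd_space R H m G)) o : `|w o| ^+ 2 <= `|w| ^+ 2.
  by rewrite ler_pXn2r ?nnegrE// hprod_norm_coord.
(* The shifts [k + 0] here and [k + 1] in [eCo] match [nneseries_bounded] for series starting at 0
   and at 1. *)
have dCo o n : \sum_(0 <= k < n) `|zn (k + 0).+1 o - zn (k + 0)%N o| ^+ 2 <= Cd.
  apply: le_trans (dC n); apply: ler_sum => k _; rewrite addn0.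
  exact: (coord_sq (zn k.+1 - zn k)).
have eCo o n : \sum_(0 <= k < n) `|zn (k + 1)%N o - pn (k + 1)%N o| ^+ 2 <= Ce.
  apply: le_trans (eC n); apply: ler_sum => k _; rewrite addn1 distrC.
  exact: (coord_sq (pn k.+1 - zn k.+1)).
pose xbar : H := s None; pose vbar i : G i := s (Some i).
have sE : s = pd_pair xbar vbar.
  by apply: functional_extensionality_dep => -[].
have opts : optimality_conditions f h z g l r L xbar vbar.
  by apply/(pd_optimality f h z r L Gg Gl nu0 lsc); rewrite -sE.
have ps : weakly_cvg pn s.
  move=> u; rewrite -(cvg_shiftS (fun n => inner (pn n) u)).
  rewrite (_ : (fun n => _) = (fun n => inner (pn n.+1 - zn n.+1) u + inner (zn n.+1) u)).
    have -> : inner s u = inner 0 u + inner s u by rewrite inner0l add0r.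
    apply: cvgD.
      by apply: cvg_inner; [exact: pz0|exact: cvg_cst].
    by have := zs u; rewrite -(cvg_shiftS (fun n => inner (zn n) u)).
  by apply: funext => n; rewrite -innerDl subrK.
have strong o :
    uniformly_convex (fun y => pd_function f g (o := o) y + pd_smooth h l (o := o) y)%E ->
    (fun n => zn n o) @ \oo --> s o /\ (fun n => pn n o) @ \oo --> s o.
  move=> uc.
  have po : (fun n => pn n.+1 o) @ \oo --> s o.
    exact: (pd_cvg hconv hdiff Gl nu0 lsc Lc (residual_in lambda0 lam_ge Hp) As ws uc).
  split; last by rewrite -(cvg_shiftS (fun n => pn n o)).
  rewrite -(cvg_shiftS (fun n => zn n o)).
  (* Uniform convexity controls [pn] directly; [zn] follows because the difference of the two tends
     to 0. *)
  rewrite (_ : (fun n => _) = (fun n => pn n.+1 o - (pn n.+1 - zn n.+1) o)).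
    rewrite -[s o]subr0; apply: cvgB => //.
    by have := @cvg_hprod_coord _ _ _ _ _ _ _ _ o pz0; apply.
  by apply: funext => n; rewrite -[X in _ - X]/(pn n.+1 o - zn n.+1 o) opprB addrC subrK.
split.
  split.
  - by apply: (nneseries_bounded (C := Cd)) => [n|n]; [exact: sqr_ge0|exact: (dCo None)].
  - by apply: (nneseries_bounded (C := Ce)) => [n|n]; [exact: sqr_ge0|exact: (eCo None)].
  - move=> i; apply: (nneseries_bounded (C := Cd)) => [n|n]; first exact: sqr_ge0.
    exact: (dCo (Some i)).
  - move=> i; apply: (nneseries_bounded (C := Ce)) => [n|n]; first exact: sqr_ge0.
    exact: (eCo (Some i)).
exists xbar, vbar; split => //.
- exact: (strong_duality hconv hdiff Lc opts).
- split.
  + exact: (@weakly_cvg_coord R _ _ zn s None zs).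
  + exact: (@weakly_cvg_coord R _ _ pn s None ps).
  + by move=> i; exact: (@weakly_cvg_coord R _ _ zn s (Some i) zs).
  + by move=> i; exact: (@weakly_cvg_coord R _ _ pn s (Some i) ps).
- exact: (strong None).
- by move=> i; exact: (strong (Some i)).
Qed.
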